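(* Let $X$ be a complex Banach space and $T\in B(X)$. The following assertions are equivalent: (i) $T$ is power $\gamma$-bounded; (ii) $\sigma(T)\subset\overline{\mathbb{D}}$ and there exists a constant $C>0$ such that for all $N\in\mathbb{N}$, $r_1,\dots,r_N>1$, $x_1,\dots,x_N\in X$ and $x_1^*,\dots,x_N^*\in X^*$, the functions $(t,k)\mapsto\sqrt{r_k^2-1}\,R(r_ke^{it},T)x_k$ and $(t,k)\mapsto\sqrt{r_k^2-1}\,R(r_ke^{it},T^* )x_k^*$ belong to $\gamma([0,2\pi)\times\mathbb{N}_N;X)$ and $\gamma'([0,2\pi)\times\mathbb{N}_N;X^* )$ respectively, and satisfy $$\big\|(t,k)\mapsto\sqrt{r_k^2-1}\,R(r_ke^{it},T)x_k\big\|_{\gamma([0,2\pi)\times\mathbb{N}_N;X)}\le C\|(x_k)_{k\in\mathbb{N}_N}\|_{\gamma(\mathbb{N}_N;X)}$$ and $$\big\|(t,k)\mapsto\sqrt{r_k^2-1}\,R(r_ke^{it},T^* )x_k^*\big\|_{\gamma'([0,2\pi)\times\mathbb{N}_N;X^* )}\le C\|(x_k^* )_{k\in\mathbb{N}_N}\|_{\gamma'(\mathbb{N}_N;X^* )};$$ (iii) $T$ is a $\gamma$-GFS operator.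
   Context: $\overline{\mathbb{D}}$ is the closed unit disc, $\sigma(T)$ the spectrum, $R(\lambda,T)=(\lambda I-T)^{-1}$, $T^*\in B(X^* )$ the Banach-space adjoint, $\mathbb{N}=\{1,2,\dots\}$, $\mathbb{N}_N=\{1,\dots,N\}$ (with counting measure); $[0,2\pi)$ carries the normalized measure $dt/2\pi$. Gaussian sums: $(\gamma_k)_{k\ge1}$ are independent complex standard Gaussian variables on a probability space $\Sigma$, and $\|\sum_k\gamma_k\otimes x_k\|_{G(X)}=\big(\int_\Sigma\|\sum_k\gamma_k(\lambda)x_k\|^2d\lambda\big)^{1/2}$ for finitely many $x_k\in X$. A set $\mathcal{T}\subset B(X)$ is $\gamma$-bounded if there is $C\ge0$ with $\|\sum_{n=1}^N\gamma_n\otimes T_nx_n\|_{G(X)}\le C\|\sum_{n=1}^N\gamma_n\otimes x_n\|_{G(X)}$ for all $N$, $T_n\in\mathcal{T}$, $x_n\in X$. $T$ is power $\gamma$-bounded if $\{T^n:n\in\mathbb{N}\}$ is $\gamma$-bounded. $\gamma$-spaces: let $H$ be a Hilbert space. For a linear operator $S:H\to X$ put $\|S\|_\gamma=\sup\|\sum_{n=1}^N\gamma_n\otimes Sh_n\|_{G(X)}$, the supremum over all finite orthonormal systems $(h_1,\dots,h_N)$ in $H$. $\gamma_\infty(H;X)$ is the Banach space of $S$ with $\|S\|_\gamma<\infty$, and $\gamma(H;X)$ is the closure in it of the finite rank operators. For a bounded operator $V:H\to X^*$ put $\|V\|_{\gamma'}=\sup\big|\sum_{n=1}^N\langle y_n,Vh_n\rangle\big|$,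 the supremum over all finite orthonormal systems $(h_1,\dots,h_N)$ in $H$ and all $y_1,\dots,y_N\in X$ with $\|\sum_n\gamma_n\otimes y_n\|_{G(X)}\le1$ (trace duality with $\gamma(H;X)$). $\gamma'_\infty(H;X^* )$ is the space of $V$ with $\|V\|_{\gamma'}<\infty$, and $\gamma'(H;X^* )$ is the closure in it of the finite rank operators. For a measure space $(S,\mu)$ and a Banach space $E$, a measurable function $f:S\to E$ is weakly $L^2$ if $\langle f(\cdot),e^*\rangle\in L^2(S)$ for all $e^*\in E^*$; then $\mathbb{I}_f:L^2(S)\to E$, $\mathbb{I}_f(g)=\int_Sg f\,d\mu$ (Pettis integral). $\gamma(S;X)$ (resp. $\gamma'(S;X^* )$) is the space of measurable weakly $L^2$ functions $f$ with values in $X$ (resp. $X^*$) with $\mathbb{I}_f\in\gamma(L^2(S);X)$ (resp. $\gamma'(L^2(S);X^* )$), normed by $\|f\|_{\gamma(S;X)}=\|\mathbb{I}_f\|_\gamma$ (resp. $\|f\|_{\gamma'(S;X^* )}=\|\mathbb{I}_f\|_{\gamma'}$). In particular $\|(x_k)\|_{\gamma(\mathbb{N}_N;X)}=\|\sum_{k=1}^N\gamma_k\otimes x_k\|_{G(X)}$ and $\|(x_k^* )\|_{\gamma'(\mathbb{N}_N;X^* )}=\sup\{|\sum_{k=1}^N\langle x_k,x_k^*\rangle|:\|(x_k)\|_{\gamma(\mathbb{N}_N;X)}\le1\}$. $\gamma$-GFS operators: for an integer $m\ge1$, $T$ has $(\gamma\text{-}GFS)_m$ if $\sigma(T)\subset\overline{\mathbb{D}}$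 and there is $C>0$ such that for all $N\ge1$, $r_1,\dots,r_N>1$, $x_k\in X$, $x_k^*\in X^*$, $$\sum_{k=1}^N\int_0^{2\pi}|\langle(r_k+1)(r_k-1)^mR(r_ke^{it},T)^{m+1}x_k,x_k^*\rangle|\,dt\le C\|(x_k)\|_{\gamma(\mathbb{N}_N;X)}\|(x_k^* )\|_{\gamma'(\mathbb{N}_N;X^* )}.$$ If $\sigma(T)\subset\overline{\mathbb{D}}$, $T$ has $m$-derivative $\gamma$-bounded functional calculus if $\{(r-1)^m\phi^{(m)}(T):r>1,\ \phi\text{ analytic on }r\mathbb{D},\ \sup_{r\mathbb{D}}|\phi|\le1\}$ is $\gamma$-bounded, where $r\mathbb{D}$ is the open disc of radius $r$ centred at $0$ and $\phi^{(m)}(T)$ is defined by the Riesz–Dunford calculus. For every $m\ge1$, the following are equivalent: $(\gamma\text{-}GFS)_m$; $1$-derivative $\gamma$-bounded functional calculus; $m$-derivative $\gamma$-bounded functional calculus. $T$ is called a $\gamma$-GFS operator if it satisfies one (hence all) of these conditions; in particular if and only if it has $(\gamma\text{-}GFS)_1$. *)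

(* Defs.v *)
From HB Require Import structures.
From mathcomp Require Import all_boot all_order all_algebra.
From mathcomp Require Import complex.
From mathcomp Require Import all_classical all_reals all_analysis.

Set Implicit Arguments.
Unset Strict Implicit.
Unset Printing Implicit Defensive.

Import Order.TTheory GRing.Theory Num.Theory.
Import numFieldNormedType.Exports.

Local Open Scope classical_set_scope.
Local Open Scope ring_scope.
Local Open Scope complex_scope.

(* The norm of a normed space over R[i] takes its values in R[i]; [rnorm] is
   the same nonnegative number, in R. *)
Definition rnorm {R : realType} {E : normedModType R[i]} (x : E) : R :=
  complex.Re `|x|.

Section rnorm_theory.
Context {R : realType} {E : normedModType R[i]}.
Implicit Types x y : E.

Lemma rnormE x : (rnorm x)%:C = `|x|.
Proof.
rewrite /rnorm; have : 0 <= `|x| by [].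
by case: `|x| => a b; rewrite lecE /= => /andP[/eqP -> _].
Qed.

Lemma rnorm_ge0 x : 0 <= rnorm x.
Proof. by rewrite -lecR rnormE; exact: normr_ge0. Qed.

Lemma rnormD x y : rnorm (x + y) <= rnorm x + rnorm y.
Proof. by rewrite -lecR rmorphD /= !rnormE ler_normD. Qed.

Lemma rnorm0 : rnorm (0 : E) = 0.
Proof. by rewrite /rnorm normr0. Qed.

Lemma rnorm0_eq0 x : rnorm x = 0 -> x = 0.
Proof. by move=> x0; apply/eqP; rewrite -normr_eq0 -rnormE x0. Qed.

Lemma rnormZ (a : R[i]) x : rnorm (a *: x) = rnorm (a : R[i]^o) * rnorm x.
Proof.
suff /(congr1 (@complex.Re R)) :
  (rnorm (a *: x))%:C = (rnorm (a : R[i]^o) * rnorm x)%:C by [].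
by rewrite rmorphM /= !rnormE normrZ.
Qed.

End rnorm_theory.

Section bounded_operators.
Context {R : realType} (X Y : normedModType R[i]).

Definition is_bounded_op : {pred X -> Y} := fun f =>
  `[< linear f /\ exists M : R, forall x, rnorm (f x) <= M * rnorm x >].

Lemma is_bounded_op_submod_closed : submod_closed is_bounded_op.
Proof.
split.
  apply/asboolP; split; first by move=> a x y; rewrite /= scaler0 addr0.
  by exists 0 => x; rewrite mul0r rnorm0.
move=> a f g /asboolP[lf [M fM]] /asboolP[lg [M' gM']].
have E z : (a *: f + g) z = a *: f z + g z by [].
apply/asboolP; split.
  by move=> b x y; rewrite !E lf lg !scalerDr !scalerA (mulrC b) addrACA.
exists (rnorm (a : R[i]^o) * M + M') => x; rewrite E.
rewrite (le_trans (rnormD _ _))// mulrDl lerD//.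
by rewrite rnormZ -mulrA ler_wpM2l// rnorm_ge0.
Qed.

HB.instance Definition _ :=
  GRing.isSubmodClosed.Build _ _ is_bounded_op is_bounded_op_submod_closed.

Record bop := Bop { bop_fun :> X -> Y; bop_mem : bop_fun \in is_bounded_op }.

HB.instance Definition _ := [isSub for bop_fun].
HB.instance Definition _ := [Choice of bop by <:].
HB.instance Definition _ := [SubChoice_isSubLmodule of bop by <:].

Implicit Types f g : bop.

Lemma bop_linear f : linear f.
Proof. by have /asboolP[] := bop_mem f. Qed.

HB.instance Definition _ f :=
  GRing.isLinear.Build R[i] X Y *:%R (bop_fun f) (bop_linear f).

Lemma bop_bounded f : exists M : R, forall x, rnorm (f x) <= M * rnorm x.
Proof. by have /asboolP[] := bop_mem f. Qed.

Lemma bop_ext f g : (forall x, f x = g x) -> f = g.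
Proof. by move=> fg; apply/val_inj/funext. Qed.

Definition opnorm f : R := sup [set rnorm (f x) | x in [set x | rnorm x <= 1]].

Lemma opnorm_has_sup f :
  has_sup [set rnorm (f x) | x in [set x | rnorm x <= 1]].
Proof.
split; first by exists (rnorm (f 0)); exists 0 => //=; rewrite rnorm0.
have [M fM] := bop_bounded f.
exists (Num.max M 0) => _ [x /= x1 <-]; apply: (le_trans (fM x)).
rewrite (@le_trans _ _ (Num.max M 0 * rnorm x))//.
  by rewrite ler_wpM2r ?rnorm_ge0// le_max lexx.
by rewrite ler_piMr// le_max lexx orbT.
Qed.

Lemma opnorm_ub f x : rnorm x <= 1 -> rnorm (f x) <= opnorm f.
Proof.
by move=> x1; apply: ub_le_sup; [exact: (opnorm_has_sup f).2|exists x].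
Qed.

Lemma opnorm_le f M :
  (forall x, rnorm x <= 1 -> rnorm (f x) <= M) -> opnorm f <= M.
Proof.
move=> fM; apply: ge_sup; first exact: (opnorm_has_sup f).1.
by move=> _ [x /= x1 <-]; exact: fM.
Qed.

Lemma opnorm_ge0 f : 0 <= opnorm f.
Proof.
by apply: (le_trans (rnorm_ge0 (f 0))); apply: opnorm_ub; rewrite rnorm0.
Qed.

Lemma rnorm_real_scale (E : normedModType R[i]) (a : R) (x : E) :
  0 <= a -> rnorm (a%:C *: x) = a * rnorm x.
Proof.
move=> a0; rewrite rnormZ; congr (_ * _).
by rewrite /rnorm ger0_norm// lecR.
Qed.

Lemma opnormP f x : rnorm (f x) <= opnorm f * rnorm x.
Proof.
have [x0|x0] := eqVneq (rnorm x) 0.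
  by rewrite (rnorm0_eq0 x0) linear0 !rnorm0 mulr0.
have xp : 0 < rnorm x by rewrite lt_neqAle eq_sym x0 rnorm_ge0.
rewrite -ler_pdivrMr// mulrC -rnorm_real_scale ?invr_ge0 ?rnorm_ge0// -linearZ.
apply: opnorm_ub.
by rewrite rnorm_real_scale ?invr_ge0 ?rnorm_ge0// mulVf.
Qed.

Lemma opnormD f g : (opnorm (f + g))%:C <= (opnorm f)%:C + (opnorm g)%:C.
Proof.
rewrite -rmorphD /= lecR; apply: opnorm_le => x x1.
by apply: (le_trans (rnormD (f x) (g x))); rewrite lerD// opnorm_ub.
Qed.

Lemma opnormZ (a : R[i]) f : (opnorm (a *: f))%:C = `|a| * (opnorm f)%:C.
Proof.
have le1 (b : R[i]) g : opnorm (b *: g) <= rnorm (b : R[i]^o) * opnorm g.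
  apply: opnorm_le => x x1; rewrite [bop_fun _ x]/(b *: g x) rnormZ.
  by rewrite ler_wpM2l ?rnorm_ge0// opnorm_ub.
have -> : `|a| = (rnorm (a : R[i]^o))%:C by rewrite rnormE.
rewrite -rmorphM; congr (_%:C); apply/eqP; rewrite eq_le le1/=.
have [->|a0] := eqVneq a 0.
  by rewrite rnorm0 mul0r opnorm_ge0.
have na0 : 0 < rnorm (a : R[i]^o).
  by rewrite lt_neqAle rnorm_ge0 andbT eq_sym; apply: contra_neq a0 => /rnorm0_eq0.
rewrite -ler_pdivlMl//.
have := le1 a^-1 (a *: f); rewrite scalerA mulVf// scale1r => /le_trans; apply.
rewrite ler_wpM2r ?opnorm_ge0// le_eqVlt; apply/orP; left.
suff /eqP/(congr1 (@complex.Re R))/eqP :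
  (rnorm (a^-1 : R[i]^o))%:C == ((rnorm (a : R[i]^o))^-1)%:C by [].
by rewrite fmorphV /= !rnormE normrV ?unitfE.
Qed.

Lemma opnorm0_eq0 f : (opnorm f)%:C = 0 -> f = 0.
Proof.
move=> /(congr1 (@complex.Re R))/= f0; apply: bop_ext => x.
apply: rnorm0_eq0; apply/eqP; rewrite eq_le rnorm_ge0 andbT.
by have := opnormP f x; rewrite f0 mul0r.
Qed.

HB.instance Definition _ :=
  Lmodule_isNormed.Build R[i] bop opnormD opnormZ opnorm0_eq0.

End bounded_operators.

Definition dual {R : realType} (X : normedModType R[i]) := bop X R[i]^o.

Section bop_algebra.
Context {R : realType} {X : normedModType R[i]}.
Implicit Types S T : bop X X.

Lemma bop_id_subproof : (@idfun X) \in @is_bounded_op R X X.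
Proof. by apply/asboolP; split => //; exists 1 => x; rewrite mul1r. Qed.

Definition bop_id : bop X X := Bop bop_id_subproof.

Lemma bop_comp_subproof (Y Z : normedModType R[i]) (S : bop Y Z) (T : bop X Y) :
  (S \o T : X -> Z) \in @is_bounded_op R X Z.
Proof.
apply/asboolP; split; first by move=> a x y /=; rewrite !linearP.
exists (opnorm S * opnorm T) => x /=.
by rewrite (le_trans (opnormP _ _))// -mulrA ler_wpM2l ?opnorm_ge0// opnormP.
Qed.

Definition bop_comp (Y Z : normedModType R[i]) (S : bop Y Z) (T : bop X Y) :
  bop X Z := Bop (bop_comp_subproof S T).

Definition bop_pow T (n : nat) : bop X X := iter n (bop_comp T) bop_id.

Lemma adjoint_subproof T :
  (fun phi : dual X => bop_comp phi T) \in @is_bounded_op R (dual X) (dual X).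
Proof.
apply/asboolP; split; first by move=> a phi psi; exact: bop_ext.
exists (opnorm T) => phi; apply: opnorm_le => x x1 /=.
rewrite (le_trans (opnormP _ _))// mulrC ler_wpM2r//; first exact: opnorm_ge0.
exact: opnorm_ub.
Qed.

Definition adjoint T : bop (dual X) (dual X) := Bop (adjoint_subproof T).

Definition is_resolvent T (z : R[i]) S :=
  bop_comp S (z *: bop_id - T) = bop_id /\ bop_comp (z *: bop_id - T) S = bop_id.

Definition spectrum T : set R[i] := [set z | ~ exists S, is_resolvent T z S].

(* The inverse of z I - T; 0 when z is in the spectrum. *)
Definition resolvent (z : R[i]) T : bop X X := xget 0 (is_resolvent T z).

Definition spectrum_in_disc T := spectrum T `<=` [set z | `|z| <= 1].

End bop_algebra.

Section complex_L2.
Context d (S : measurableType d) (R : realType).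
Variable mu : {measure set S -> \bar R}.

Definition cintegral (f : S -> R[i]) : R[i] :=
  Rintegral mu setT (fun s => complex.Re (f s)) +i*
  Rintegral mu setT (fun s => complex.Im (f s)).

Definition square_integrable : {pred S -> R[i]} := fun f =>
  ((fun s => complex.Re (f s)) \in Lfun mu 2%:E) &&
  ((fun s => complex.Im (f s)) \in Lfun mu 2%:E).

Lemma square_integrable_submod_closed : submod_closed square_integrable.
Proof.
have subm := Lfun_submod_closed mu (lee1n 2).
have Lfun0 : (0 : S -> R) \in Lfun mu 2%:E := subm.1.
have LfunD (a : R) (u v : S -> R) : u \in Lfun mu 2%:E -> v \in Lfun mu 2%:E ->
  (fun s => a * u s + v s) \in Lfun mu 2%:E := subm.2 a u v.
split; first by apply/andP.
move=> a f g /andP[f1 f2] /andP[g1 g2]; apply/andP; split.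
  have -> : (fun s => complex.Re ((a *: f + g) s)) =
      (fun s => complex.Re a * complex.Re (f s)
      + (- complex.Im a * complex.Im (f s) + complex.Re (g s))).
    apply/funext => s /=; rewrite [(a *: f + g) s]/(a * f s + g s).
    by case: (a) (f s) (g s) => a1 a2 [b1 b2] [c1 c2] /=; rewrite mulNr addrA.
  exact/LfunD/LfunD.
have -> : (fun s => complex.Im ((a *: f + g) s)) =
    (fun s => complex.Re a * complex.Im (f s)
    + (complex.Im a * complex.Re (f s) + complex.Im (g s))).
  apply/funext => s /=; rewrite [(a *: f + g) s]/(a * f s + g s).
  by case: (a) (f s) (g s) => a1 a2 [b1 b2] [c1 c2] /=; rewrite addrA (mulrC a2).
exact/LfunD/LfunD.
Qed.

HB.instance Definition _ := GRing.isSubmodClosed.Build _ _ square_integrable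
  square_integrable_submod_closed.

Record L2fun :=
  L2Fun { L2fun_fun :> S -> R[i]; L2fun_mem : L2fun_fun \in square_integrable }.

HB.instance Definition _ := [isSub for L2fun_fun].
HB.instance Definition _ := [Choice of L2fun by <:].
HB.instance Definition _ := [SubChoice_isSubLmodule of L2fun by <:].

Definition L2null : {pred L2fun} := fun f => `[< {ae mu, forall s, f s = 0} >].

Lemma L2null_zmod_closed : zmod_closed L2null.
Proof.
split; first by apply/asboolP; exact: nearW.
move=> f g /asboolP f0 /asboolP g0; apply/asboolP.
apply: filterS2 f0 g0 => s fs gs.
rewrite [LHS]/(f s - g s) fs gs; exact: (subrr (0 : R[i])).
Qed.

HB.instance Definition _ := GRing.isZmodClosed.Build _ L2null L2null_zmod_closed.

Lemma L2null_scale (a : R[i]) f : f \in L2null -> a *: f \in L2null.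
Proof.
move=> /asboolP f0; apply/asboolP; apply: filterS f0 => s fs.
rewrite [LHS]/(a * f s) fs; exact: (mulr0 (a : R[i])).
Qed.

(* The Hilbert space L^2(S, mu; C): square-integrable functions modulo
   equality almost everywhere. *)
Definition L2 : Type := Quotient.quot (L2null : zmodClosed L2fun).

HB.instance Definition _ := GRing.Zmodule.on L2.
HB.instance Definition _ := EqQuotient.on L2.

Local Open Scope quotient_scope.

Lemma L2_piD f g : \pi_L2 (f + g) = \pi_L2 f + \pi_L2 g.
Proof. exact: Quotient.pi_add. Qed.

Definition L2scale (a : R[i]) (q : L2) : L2 := \pi_L2 (a *: repr q).

Lemma L2scale_pi a f : L2scale a (\pi_L2 f) = \pi_L2 (a *: f).
Proof.
apply/eqP; rewrite -Quotient.idealrBE -scalerBr; apply: L2null_scale.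
by rewrite Quotient.idealrBE reprK.
Qed.

Lemma L2scaleA a b q : L2scale a (L2scale b q) = L2scale (a * b) q.
Proof. by rewrite {2}/L2scale L2scale_pi scalerA. Qed.

Lemma L2scale1 : left_id 1 L2scale.
Proof. by move=> q; rewrite /L2scale scale1r reprK. Qed.

Lemma L2scaleDr : right_distributive L2scale +%R.
Proof.
move=> a q q'; rewrite -[q]reprK -[q']reprK -L2_piD.
by rewrite !L2scale_pi scalerDr L2_piD.
Qed.

Lemma L2scaleDl q : {morph L2scale^~ q : a b / a + b}.
Proof. by move=> a b; rewrite /L2scale scalerDl L2_piD. Qed.

HB.instance Definition _ :=
  GRing.Zmodule_isLmodule.Build R[i] L2 L2scaleA L2scale1 L2scaleDr L2scaleDl.

Definition L2_fun (q : L2) : S -> R[i] := repr q.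

Definition L2_ip (f g : L2) : R[i] :=
  cintegral (fun s => L2_fun f s * (L2_fun g s)^*).

End complex_L2.

Section gaussian_sequences.
Context d (Sigma : measurableType d) (R : realType) (P : probability Sigma R).

(* (g + i g') / sqrt 2 with g, g' independent real standard Gaussians: the
   real and imaginary parts are independent of variance 1/2.  The second
   argument of [normal_prob] is the standard deviation. *)
Definition complex_standard_gaussian (Z : Sigma -> R[i]) :=
  [/\ measurable_fun setT (fun w => complex.Re (Z w)),
      measurable_fun setT (fun w => complex.Im (Z w)) &
      forall A B : set R, measurable A -> measurable B ->
        P [set w | A (complex.Re (Z w)) /\ B (complex.Im (Z w))] =
        (normal_prob 0 (Num.sqrt 2^-1) A * normal_prob 0 (Num.sqrt 2^-1) B)%E].

Definition mutually_independent (Z : nat -> Sigma -> R[i]) :=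
  forall (J : seq nat) (A : nat -> set (R * R)), uniq J ->
    (forall k, measurable (A k)) ->
    P [set w | forall k, k \in J -> A k (complex.Re (Z k w), complex.Im (Z k w))] =
    (\prod_(k <- J) P [set w | A k (complex.Re (Z k w), complex.Im (Z k w))])%E.

Definition gaussian_sequence (gam : nat -> Sigma -> R[i]) :=
  (forall k, complex_standard_gaussian (gam k)) /\ mutually_independent gam.

End gaussian_sequences.

Section gamma_norms.
Context d (Sigma : measurableType d) (R : realType) (P : probability Sigma R).
Variable gam : nat -> Sigma -> R[i].

(* The norm of \sum_k gam_k (x) x_k in G(E). *)
Definition gauss_norm (E : normedModType R[i]) N (x : 'I_N -> E) : \bar R :=
  Lnorm P 2%:E (fun w => (rnorm (\sum_(k < N) gam k w *: x k))%:E).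

(* The norm of (phi_k) in gamma'(N_N; E^* ); [gauss_norm] is the norm of (x_k)
   in gamma(N_N; E). *)
Definition gauss_dual_norm (E : normedModType R[i]) N (phi : 'I_N -> dual E) :
    \bar R :=
  ereal_sup [set (rnorm (\sum_(k < N) phi k (x k)))%:E
            | x in [set x : 'I_N -> E | (gauss_norm x <= 1)%E]].

Definition gamma_bounded (E : normedModType R[i]) (TT : set (bop E E)) :=
  exists2 C : R, 0 <= C & forall N (T : 'I_N.+1 -> bop E E) (x : 'I_N.+1 -> E),
    (forall k, TT (T k)) ->
    (gauss_norm (fun k => T k (x k)) <= C%:E * gauss_norm x)%E.

Definition power_gamma_bounded (E : normedModType R[i]) (T : bop E E) :=
  gamma_bounded [set bop_pow T n | n in [set n | (0 < n)%N]].

Section gamma_operators.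
Context (H : lmodType R[i]) (ip : H -> H -> R[i]).

Definition orthonormal_system N (h : 'I_N -> H) :=
  forall i j, ip (h i) (h j) = (i == j)%:R.

Definition finite_rank (E : normedModType R[i]) (S : H -> E) :=
  linear S /\ exists n (y : 'I_n -> E), forall h, exists c : 'I_n -> R[i],
    S h = \sum_(k < n) c k *: y k.

Definition gamma_norm (E : normedModType R[i]) (S : H -> E) : \bar R :=
  ereal_sup [set v | exists N (h : 'I_N -> H),
    orthonormal_system h /\ v = gauss_norm (fun k => S (h k))].

Definition gamma_infty (E : normedModType R[i]) (S : H -> E) :=
  linear S /\ (gamma_norm S < +oo)%E.

Definition gamma_op (E : normedModType R[i]) (S : H -> E) :=
  gamma_infty S /\ forall e : R, 0 < e -> exists F : H -> E,
    [/\ finite_rank F, gamma_infty F &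
        (gamma_norm (fun h => (S h - F h)%R) < e%:E)%E].

Definition gamma'_norm (E : normedModType R[i]) (V : H -> dual E) : \bar R :=
  ereal_sup [set v | exists N (h : 'I_N -> H) (y : 'I_N -> E),
    [/\ orthonormal_system h, (gauss_norm y <= 1)%E &
        v = (rnorm (\sum_(k < N) V (h k) (y k)))%:E]].

Definition gamma'_infty (E : normedModType R[i]) (V : H -> dual E) :=
  [/\ linear V,
      exists M : R, forall h, rnorm (V h) <= M * Num.sqrt (complex.Re (ip h h)) &
      (gamma'_norm V < +oo)%E].

Definition gamma'_op (E : normedModType R[i]) (V : H -> dual E) :=
  gamma'_infty V /\ forall e : R, 0 < e -> exists F : H -> dual E,
    [/\ finite_rank F, gamma'_infty F &
        (gamma'_norm (fun h => (V h - F h)%R) < e%:E)%E].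

End gamma_operators.

Section gamma_functions.
Context dS (S : measurableType dS) (mu : {measure set S -> \bar R}).

Definition strongly_measurable (E : normedModType R[i]) (f : S -> E) :=
  exists s : nat -> S -> E,
    (forall n, finite_set (range (s n)) /\
               forall y, measurable (s n @^-1` [set y])) /\
    forall t, s n t @[n --> \oo] --> f t.

Definition weakly_L2 (E : normedModType R[i]) (f : S -> E) :=
  forall phi : dual E, (fun s => phi (f s) : R[i]) \in square_integrable mu.

Definition is_pettis_integral (E : normedModType R[i]) (f : S -> E) (y : E) :=
  forall phi : dual E, phi y = cintegral mu (fun s => phi (f s)).

Definition pettis_integral (E : normedModType R[i]) (f : S -> E) : E :=
  xget 0 (is_pettis_integral f).

Definition pettis_op (E : normedModType R[i]) (f : S -> E) (g : L2 mu) : E :=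
  pettis_integral (fun s => L2_fun g s *: f s).

(* Existence of the Pettis integrals defining [pettis_op f] is automatic when
   E is complete; it is recorded so that the default value 0 of
   [pettis_integral] never matters. *)
Definition pettis_L2 (E : normedModType R[i]) (f : S -> E) :=
  [/\ strongly_measurable f, weakly_L2 f &
      forall g : L2 mu, exists y,
        is_pettis_integral (fun s => L2_fun g s *: f s) y].

Definition gamma_fun (E : normedModType R[i]) (f : S -> E) :=
  pettis_L2 f /\ gamma_op (@L2_ip _ _ _ mu) (pettis_op f).

Definition gamma_fun_norm (E : normedModType R[i]) (f : S -> E) : \bar R :=
  gamma_norm (@L2_ip _ _ _ mu) (pettis_op f).

Definition gamma'_fun (E : normedModType R[i]) (f : S -> dual E) :=
  pettis_L2 f /\ gamma'_op (@L2_ip _ _ _ mu) (pettis_op f).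

Definition gamma'_fun_norm (E : normedModType R[i]) (f : S -> dual E) : \bar R :=
  gamma'_norm (@L2_ip _ _ _ mu) (pettis_op f).

End gamma_functions.

End gamma_norms.

HB.instance Definition _ n := isPointed.Build 'I_n.+1 ord0.

HB.instance Definition _ n := @isMeasurable.Build default_measure_display
  'I_n.+1 discrete_measurable discrete_measurable0
  discrete_measurableC discrete_measurableU.

(* [counting] on 'I_n.+1, under a name of its own because the library's
   sigma-finiteness instance for [counting] is specific to nat. *)
Definition counting_ord (R : realType) n : set 'I_n.+1 -> \bar R := counting.

HB.instance Definition _ (R : realType) n :=
  Measure.copy (@counting_ord R n) (@counting 'I_n.+1 R).

Lemma counting_ord_sigma_finite (R : realType) n :
  sigma_finite [set: 'I_n.+1] (@counting_ord R n).
Proof.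
exists (fun=> setT) => [|k]; first by rewrite bigcup_const//; exists 0%N.
by split => //; rewrite /counting_ord /counting asboolT ?ltry//; exact: finite_finset.
Qed.

HB.instance Definition _ (R : realType) n :=
  @Measure_isSigmaFinite.Build _ _ _ (@counting_ord R n)
    (@counting_ord_sigma_finite R n).

Section resolvent_conditions.
Context {R : realType}.

Lemma inv_two_pi_ge0 : 0 <= (2 * pi)^-1 :> R.
Proof. by rewrite invr_ge0 mulr_ge0 ?pi_ge0. Qed.

(* The measure dt / 2 pi on [0, 2 pi), as a measure on R carried by
   [0, 2 pi). *)
Definition circle_measure : {measure set (measurableTypeR R) -> \bar R} :=
  mscale (NngNum inv_two_pi_ge0)
    (mrestr (@lebesgue_measure R) (measurable_itv `[0, 2 * pi[)).

Definition circle_ord_measure (N : nat) :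
    {measure set (measurableTypeR R * 'I_N.+1) -> \bar R} :=
  (circle_measure \x @counting_ord R N)%E.

Definition expi (t : R) : R[i] := cos t +i* sin t.

Definition resolvent_fun (E : normedModType R[i]) (T : bop E E) N
    (r : 'I_N.+1 -> R) (x : 'I_N.+1 -> E) (p : measurableTypeR R * 'I_N.+1) : E :=
  (Num.sqrt (r p.2 ^+ 2 - 1))%:C *: resolvent ((r p.2)%:C * expi p.1) T (x p.2).

Context d (Sigma : measurableType d) (P : probability Sigma R).
Variable gam : nat -> Sigma -> R[i].
Context (X : normedModType R[i]).

Definition resolvent_square_functions (T : bop X X) :=
  spectrum_in_disc T /\
  exists2 C : R, 0 < C &
    forall N (r : 'I_N.+1 -> R) (x : 'I_N.+1 -> X) (phi : 'I_N.+1 -> dual X),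
      (forall k, 1 < r k) ->
      [/\ gamma_fun P gam (circle_ord_measure N) (resolvent_fun T r x),
          gamma'_fun P gam (circle_ord_measure N)
            (resolvent_fun (adjoint T) r phi),
          (gamma_fun_norm P gam (circle_ord_measure N) (resolvent_fun T r x)
             <= C%:E * gauss_norm P gam x)%E &
          (gamma'_fun_norm P gam (circle_ord_measure N)
             (resolvent_fun (adjoint T) r phi)
             <= C%:E * gauss_dual_norm P gam phi)%E].

Definition gamma_GFS (m : nat) (T : bop X X) :=
  spectrum_in_disc T /\
  exists2 C : R, 0 < C &
    forall N (r : 'I_N.+1 -> R) (x : 'I_N.+1 -> X) (phi : 'I_N.+1 -> dual X),
      (forall k, 1 < r k) ->
      (\sum_(k < N.+1) \int[lebesgue_measure]_(t in `[0%R, (2 * pi)%R[)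
          (rnorm (phi k (((r k + 1) * (r k - 1) ^+ m)%:C *:
             bop_pow (resolvent ((r k)%:C * expi t) T) m.+1 (x k))))%:E
        <= C%:E * (gauss_norm P gam x * gauss_dual_norm P gam phi))%E.

(* The conditions (gamma-GFS)_m, m >= 1, are all equivalent; the case m = 1 is
   taken as the definition. *)
Definition gamma_GFS_operator (T : bop X X) := gamma_GFS 1 T.

End resolvent_conditions.

(* Main.v *)
(* Write [R(z)] for the resolvent of [T].

   (i) => (ii).  [R(r e^{it}) = sum_n r^{-n-1} e^{-i(n+1)t} T^n] expands the
   square function of [(x_k)] along the orthonormal functions
   [e^{-i(n+1)t} (x) delta_k], with coefficients [sqrt (r_k^2 - 1) r_k^{-n-1}]
   which are square-summable in [n] with sum [1].  By Bessel's inequality the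
   change from an arbitrary orthonormal system to this one is a contraction of
   coefficients, and contractive matrices do not increase Gaussian norms; the
   dual estimate uses the transposed matrices.  The contraction principle comes
   from the invariance of Gaussian rows under orthogonal matrices, obtained from
   plane rotations written as three shears, and from a dilation of a contraction
   to a pair of matrices with orthonormal columns.

   (ii) => (iii).  Test both operators on the normalized indicators of the cells
   [arc x {k}] of a fine partition of [[0, 2 pi) x {1..N}]: trace duality bounds
   the resulting Riemann sums for
   [(r_k^2 - 1) int |<R(r_k e^{it})^2 x_k, phi_k>| dt].

   (iii) => (i).  [(n + 1) T^n] is the mean over the circle of radius
   [r = 1 + 1/(n+1)] of [z^{n+2} R(z)^2], where [r^{n+2}] stays bounded, and
   Hahn-Banach provides functionals norming the Gaussian norm of
   [(T^{n_k} x_k)].  The expansion of [R(z)] up to the unit circle needs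
   [T^n = O(rho^n)] for every [rho > 1]; this is the spectral radius formula,
   proved by averaging resolvents over roots of unity. *)
Require Import Defs.
From HB Require Import structures.
From mathcomp Require Import all_boot all_order all_algebra.
From mathcomp Require Import complex.
From mathcomp Require Import all_classical all_reals all_analysis.
From mathcomp Require Import measurable_realfun.
From mathcomp Require Import ring lra.

Set Implicit Arguments.
Unset Strict Implicit.
Unset Printing Implicit Defensive.

Import Order.TTheory GRing.Theory Num.Theory.
Import numFieldNormedType.Exports.

Local Open Scope classical_set_scope.
Local Open Scope ring_scope.

(** * Orthogonal invariance of rows of independent normal variables *)

Section plane_lebesgue.
Context {R : realType}.
Notation leb := (@lebesgue_measure R).
Notation mR := (measurableTypeR R).
Implicit Types (f : R -> \bar R) (H : R * R -> \bar R).

Let shift (a : R) : mR -> mR := fun x => x + a.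

Let measurable_shift a : measurable_fun setT (shift a).
Proof. by apply: measurable_funD. Qed.

Lemma lebesgue_measure_shift (a : R) (A : set mR) : measurable A ->
  leb A = leb (shift a @^-1` A).
Proof.
move=> mA.
rewrite (@lebesgue_measure_unique R (pushforward leb (shift a)))// => X.
case=> -[u v] /= uv <-; rewrite /pushforward.
have -> : shift a @^-1` `]u, v]%classic = `]u - a, v - a]%classic.
  by apply/seteqP; split=> x /=; rewrite !in_itv /= ltrBlDr lerBrDr.
rewrite !lebesgue_measure_itv /= !lte_fin ltrD2r.
by case: ifP => // _; rewrite -!EFinB; congr _%:E; ring.
Qed.

Lemma ge0_integral_lebesgue_shift (a : R) (f : mR -> \bar R) :
  measurable_fun setT f -> (forall x, 0 <= f x)%E ->
  (\int[leb]_x f (x + a)%R = \int[leb]_x f x)%E.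
Proof.
move=> mf f0.
rewrite [RHS](@eq_measure_integral _ _ _ _ (pushforward leb (shift a)))//; last first.
  by move=> A mA _; exact: lebesgue_measure_shift.
by rewrite (ge0_integral_pushforward (measurable_shift a)).
Qed.

Notation leb2 := (leb \x leb)%E.

Lemma ge0_integral_shear1 (a : R) (H : mR * mR -> \bar R) :
  measurable_fun setT H -> (forall z, 0 <= H z)%E ->
  (\int[leb2]_z H (z.1 + a * z.2, z.2)%R = \int[leb2]_z H z)%E.
Proof.
move=> mH H0.
have mf : measurable_fun setT (fun z : mR * mR => (z.1 + a * z.2, z.2) : mR * mR).
  apply: measurable_fun_pair => //; apply: measurable_funD => //.
  exact: measurable_funM.
rewrite (fubini_tonelli2 _ mH H0) fubini_tonelli2; last 2 first.
- exact: measurableT_comp mf.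
- by move=> z; exact: H0.
apply: eq_integral => y _; rewrite /fubini_G /=.
rewrite -(@ge0_integral_lebesgue_shift (a * y) (fun x => H (x, y)))//.
exact: measurableT_comp.
Qed.

Lemma ge0_integral_shear2 (a : R) (H : mR * mR -> \bar R) :
  measurable_fun setT H -> (forall z, 0 <= H z)%E ->
  (\int[leb2]_z H (z.1, z.2 + a * z.1)%R = \int[leb2]_z H z)%E.
Proof.
move=> mH H0.
have mf : measurable_fun setT (fun z : mR * mR => (z.1, z.2 + a * z.1) : mR * mR).
  apply: measurable_fun_pair => //; apply: measurable_funD => //.
  exact: measurable_funM.
rewrite (fubini_tonelli1 _ mH H0) fubini_tonelli1; last 2 first.
- exact: measurableT_comp mf.
- by move=> z; exact: H0.
apply: eq_integral => x _; rewrite /fubini_F /=.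
rewrite -(@ge0_integral_lebesgue_shift (a * x) (fun y => H (x, y)))//.
exact: measurableT_comp.
Qed.

(* A rotation of angle other than pi is a product of three shears. *)
Lemma ge0_integral_rotation (c s : R) (H : mR * mR -> \bar R) :
  c ^+ 2 + s ^+ 2 = 1 -> 0 <= c ->
  measurable_fun setT H -> (forall z, 0 <= H z)%E ->
  (\int[leb2]_z H (c * z.1 - s * z.2, s * z.1 + c * z.2)%R = \int[leb2]_z H z)%E.
Proof.
move=> cs c0 mH H0.
have c1 : 1 + c != 0 by rewrite gt_eqF// ltr_wpDr.
pose t := s / (1 + c).
have mf1 a : measurable_fun setT (fun z : mR * mR => (z.1 + a * z.2, z.2) : mR * mR).
  apply: measurable_fun_pair => //; apply: measurable_funD => //.
  exact: measurable_funM.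
have mf2 a : measurable_fun setT (fun z : mR * mR => (z.1, z.2 + a * z.1) : mR * mR).
  apply: measurable_fun_pair => //; apply: measurable_funD => //.
  exact: measurable_funM.
rewrite -(ge0_integral_shear1 (- t) mH H0).
have mH1 := measurableT_comp mH (mf1 (- t)).
rewrite -(ge0_integral_shear2 s mH1); last by move=> z; exact: H0.
have mH2 := measurableT_comp mH1 (mf2 s).
rewrite -(ge0_integral_shear1 (- t) mH2); last by move=> z; exact: H0.
have st : t * (1 + c) = s by rewrite /t divfK.
have ct : c = 1 - s * t.
  apply: (mulIf c1); rewrite mulrBl -mulrA st; lra.
apply: eq_integral => -[x y] _ /=; congr (H (_, _)); last by rewrite [in LHS]ct; ring.
by rewrite -[s in c * x - s * y]st [in LHS]ct; ring.
Qed.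

End plane_lebesgue.

Section product_rectangles.
Context d1 d2 (T1 : measurableType d1) (T2 : measurableType d2) (R : realType).

Lemma measure_eq_rectangles (m m' : {measure set (T1 * T2) -> \bar R}) :
  (m setT < +oo)%E ->
  (forall A B, measurable A -> measurable B -> m (A `*` B) = m' (A `*` B)) ->
  forall X, measurable X -> m X = m' X.
Proof.
move=> moo mm' X mX.
pose C : set (set (T1 * T2)) :=
  [set C | exists A, measurable A /\ exists B, measurable B /\ C = A `*` B].
apply: (measure_unique C (fun=> setT)) => //.
- rewrite measurable_prod_measurableType //; congr (<<s _ >>).
  rewrite predeqE; split => [[A mA [B mB <-]]|[A [mA [B [mB ->]]]]].
    by exists A; split => //; exists B.
  by exists A => //; exists B.
- move=> _ _ [A [mA [B [mB ->]]]] [A' [mA' [B' [mB' ->]]]].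
  rewrite -setXI; exists (A `&` A'); split; first exact: measurableI.
  by exists (B `&` B'); split => //; exact: measurableI.
- by move=> _; exists setT; split => //; exists setT; split => //; rewrite setXTT.
- by rewrite bigcup_const//; exists 0%N.
- by move=> _ [A [mA [B [mB ->]]]]; exact: mm'.
Qed.

End product_rectangles.

Section normal_plane.
Context {R : realType} (sg : R).
Hypothesis sg0 : sg != 0.
Notation mR := (measurableTypeR R).
Notation leb2 := (@lebesgue_measure R \x @lebesgue_measure R)%E.
Notation pdf := (normal_pdf 0 sg).
Notation G := (normal_prob 0 sg).

Let pdf2 (z : mR * mR) : \bar R := (pdf z.1 * pdf z.2)%:E.

Let mpdf2 : measurable_fun setT pdf2.
Proof.
apply/measurable_EFinP/measurable_funM.
  exact: (measurableT_comp (measurable_normal_pdf 0 sg) measurable_fst).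
exact: (measurableT_comp (measurable_normal_pdf 0 sg) measurable_snd).
Qed.

Let pdf2_ge0 z : (0 <= pdf2 z)%E.
Proof. by rewrite lee_fin mulr_ge0 ?normal_pdf_ge0. Qed.

Definition normal_plane (B : set (mR * mR)) : \bar R := (\int[leb2]_(z in B) pdf2 z)%E.

Let normal_plane0 : normal_plane set0 = 0%E.
Proof. by rewrite /normal_plane integral_set0. Qed.

Let normal_plane_ge0 B : (0 <= normal_plane B)%E.
Proof. by apply: integral_ge0. Qed.

Let normal_plane_sigma_additive : semi_sigma_additive normal_plane.
Proof.
move=> /= A mA tA mUA.
rewrite /normal_plane ge0_integral_bigcup//=; last exact: measurable_funTS.
apply: is_cvg_ereal_nneg_natsum_cond => n _ _.
exact: integral_ge0.
Qed.

HB.instance Definition _ := isMeasure.Build _ _ _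
  normal_plane normal_plane0 normal_plane_ge0 normal_plane_sigma_additive.

Lemma normal_planeX (A B : set mR) : measurable A -> measurable B ->
  normal_plane (A `*` B) = (G A * G B)%E.
Proof.
move=> mA mB; rewrite /normal_plane integral_mkcond.
have mAB : measurable (A `*` B : set (mR * mR)) by exact: measurableX.
rewrite fubini_tonelli1; last 2 first.
- exact/(measurable_restrictT _ _).1/measurable_funTS.
- by move=> z; apply: erestrict_ge0.
transitivity (\int[lebesgue_measure]_x (((fun x => (pdf x)%:E) \_ A) x * G B))%E.
  apply: eq_integral => x _; rewrite /fubini_F.
  rewrite /normal_prob [in RHS]integral_mkcond.
  have -> : ((fun x => (pdf x)%:E) \_ A) x = (pdf x * \1_A x)%:E.
    rewrite patchE indicE; case: ifP => _; by rewrite ?mulr1 ?mulr0.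
  rewrite -ge0_integralZl//; last 3 first.
  - apply/(measurable_restrictT _ _).1 => //; apply/measurable_funTS/measurable_EFinP.
    exact: measurable_normal_pdf.
  - by move=> y _; apply: erestrict_ge0 => z _; rewrite lee_fin normal_pdf_ge0.
  - by rewrite lee_fin mulr_ge0 ?normal_pdf_ge0.
  apply: eq_integral => y _; rewrite !patchE indicE in_setX /=.
  by case: (x \in A) => /=; case: (y \in B) => //=; rewrite ?mule0 ?mulr1 ?mulr0 ?mul0e// EFinM.
rewrite ge0_integralZr//; last 2 first.
- apply/(measurable_restrictT _ _).1 => //; apply/measurable_funTS/measurable_EFinP.
  exact: measurable_normal_pdf.
- by move=> y _; apply: erestrict_ge0 => z _; rewrite lee_fin normal_pdf_ge0.
by rewrite -integral_mkcond.
Qed.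

Lemma normal_plane_rotation (c s : R) (B : set (mR * mR)) :
  c ^+ 2 + s ^+ 2 = 1 -> 0 <= c -> measurable B ->
  normal_plane ((fun z => (c * z.1 - s * z.2, s * z.1 + c * z.2)) @^-1` B) =
  normal_plane B.
Proof.
move=> cs c0 mB; rewrite /normal_plane [LHS]integral_mkcond [RHS]integral_mkcond.
rewrite -[RHS](ge0_integral_rotation cs c0); last 2 first.
- apply: (proj1 (measurable_restrictT _ mB)); exact: measurable_funTS mpdf2.
- by move=> z; apply: erestrict_ge0.
apply: eq_integral => -[x y] _; rewrite !patchE.
have -> : (c * x - s * y, s * x + c * y) \in B =
   ((x, y) \in (fun z => (c * z.1 - s * z.2, s * z.1 + c * z.2)) @^-1` B) by [].
case: ifP => // _; congr _%:E.
rewrite /pdf2 /= !normal_pdfE// mulrACA [RHS]mulrACA; congr (_ * _).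
rewrite /normal_fun -!expRD; congr expR; rewrite -!mulrDl; congr (_ / _).
rewrite !subr0; transitivity (- ((c ^+ 2 + s ^+ 2) * (x ^+ 2 + y ^+ 2))); last by ring.
by rewrite cs; ring.
Qed.

Lemma normal_prob_opp (A : set mR) : measurable A ->
  G ((fun x : mR => - x : mR) @^-1` A) = G A.
Proof.
move=> mA; have mN : measurable_fun setT (fun x : mR => - x : mR).
  exact: measurable_funN.
have leN X : measurable X -> lebesgue_measure X = lebesgue_measure ((fun x : mR =>
  - x : mR) @^-1` X).
  move=> mX.
  rewrite (@lebesgue_measure_unique R (pushforward lebesgue_measure (fun x : mR =>
    - x : mR)))// => Y.
  case=> -[u v] /= uv <-; rewrite /pushforward.
  have -> : (fun x : mR => - x : mR) @^-1` `]u, v]%classic = `[- v, - u[%classic.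
    by apply/seteqP; split=> x /=; rewrite !in_itv /= lerNl ltrNr andbC.
  rewrite !lebesgue_measure_itv /= !lte_fin ltrN2.
  by case: ifP => // _; rewrite -!EFinB; congr _%:E; ring.
have mG : measurable_fun setT (fun x : mR => (pdf x)%:E).
  by apply/measurable_EFinP; exact: (measurable_normal_pdf 0 sg).
have G0 x : (0 <= (pdf x)%:E)%E by rewrite lee_fin normal_pdf_ge0.
rewrite /normal_prob [in RHS](@eq_measure_integral _ _ _ _ (pushforward lebesgue_measure (fun x
  : mR => - x : mR))); last first.
  by move=> X mX _; exact: leN.
rewrite [RHS](ge0_integral_pushforward mN _ mA); last 2 first.
- exact: measurable_funTS.
- by move=> x _; exact: G0.
apply: eq_integral => x _ /=; congr _%:E.
by rewrite !normal_pdfE// /normal_fun !subr0 sqrrN.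
Qed.

End normal_plane.

Section normal_row.
Context d (Sigma : measurableType d) (R : realType) (P : probability Sigma R).
Variable sg : R.
Hypothesis sg0 : sg != 0.
Notation mR := (measurableTypeR R).
Notation G := (normal_prob 0 sg).

(* The entries of [g] are independent normal variables, and independent of the
   event [E]. *)
Definition normal_row (E : set Sigma) n (g : Sigma -> 'I_n -> R) :=
  (forall i, measurable_fun setT (fun w => g w i : mR)) /\
  forall A : 'I_n -> set mR, (forall i, measurable (A i)) ->
    P (E `&` [set w | forall i, A i (g w i)]) = (P E * \prod_(i < n) G (A i))%E.

Lemma measurable_forall_ord n (Q : 'I_n -> set Sigma) :
  (forall i, measurable (Q i)) -> measurable [set w | forall i, Q i w].
Proof.
move=> mQ; have -> : [set w | forall i, Q i w] = \bigcap_(i in [set: 'I_n]) Q i.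
  by apply/seteqP; split=> w /= h => [i _|i]; exact: h.
by apply: fin_bigcap_measurable => //; exact: finite_finset.
Qed.

Lemma normal_row_event E n (g : Sigma -> 'I_n -> R) (A : 'I_n -> set mR) :
  measurable E -> normal_row E g -> (forall i, measurable (A i)) ->
  measurable (E `&` [set w | forall i, A i (g w i)]).
Proof.
move=> mE [mg _] mA; apply: measurableI => //.
apply: measurable_forall_ord => i.
by rewrite -[X in measurable X]setTI; exact: mg.
Qed.

Let GT : G setT = 1%E. Proof. exact: probability_setT. Qed.

Definition givens n (i j : 'I_n) (c s : R) (v : 'I_n -> R) : 'I_n -> R :=
  fun k => if k == i then c * v i - s * v j
           else if k == j then s * v i + c * v j else v k.

Lemma normal_row_givens E n (g : Sigma -> 'I_n -> R) i j c s :
  i != j -> c ^+ 2 + s ^+ 2 = 1 -> 0 <= c -> measurable E ->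
  normal_row E g -> normal_row E (fun w => givens i j c s (g w)).
Proof.
move=> ij cs c0 mE [mg gE]; split.
  move=> k; rewrite /givens; case: (k == i).
    by apply: measurable_funB; apply: measurable_funM => //; exact: mg.
  case: (k == j); last exact: mg.
  by apply: measurable_funD; apply: measurable_funM => //; exact: mg.
move=> A mA.
pose A' X Y k := if k == i then X else if k == j then Y else A k.
have mA' X Y : measurable X -> measurable Y -> forall k, measurable (A' X Y k).
  by move=> mX mY k; rewrite /A'; case: (k == i) => //; case: (k == j).
have prodA' X Y : (\prod_(k < n) G (A' X Y k) =
    (G X * G Y) * \prod_(k < n | (k != i) && (k != j)) G (A k))%E.
  rewrite (bigD1 i)//= (bigD1 j)/=; last by rewrite eq_sym.
  rewrite muleA; congr (_ * _ * _)%E.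
  - by rewrite /A' eqxx.
  - by rewrite /A' eqxx eq_sym (negbTE ij).
  - by apply: eq_bigr => k /andP[/negbTE ki /negbTE kj]; rewrite /A' ki kj.
pose F := E `&` [set w | forall k, A' setT setT k (g w k)].
have mF : measurable F by apply: normal_row_event => //; exact: mA'.
have PF : P F = (P E * \prod_(k < n | (k != i) && (k != j)) G (A k))%E.
  by rewrite gE; [rewrite prodA' GT !mul1e|exact: mA'].
pose h w : mR * mR := (g w i, g w j).
have mh : measurable_fun setT h by exact: measurable_fun_pair.
have Fh X Y : h @^-1` (X `*` Y) `&` F =
    E `&` [set w | forall k, A' X Y k (g w k)].
  apply/seteqP; split=> w /=.
    move=> [[/= hX hY] [Ew h']]; split => // k.
    by have := h' k; rewrite /A'; case: eqP => [->|_] //; case: eqP => [->|].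
  move=> [Ew h']; split; last first.
    split => // k.
    by have := h' k; rewrite /A'; case: eqP => [_|_] //; case: eqP.
  split => /=.
    by have := h' i; rewrite /A' eqxx.
  by have := h' j; rewrite /A' eqxx eq_sym (negbTE ij).
have PFfin : P F \is a fin_num by exact: fin_num_measure.
have PF0 : 0 <= fine (P F) by rewrite fine_ge0.
have lawF (B : set (mR * mR)) : measurable B ->
    P (h @^-1` B `&` F) = (P F * normal_plane sg B)%E.
  move=> mB.
  have scE X : mscale (NngNum PF0) (normal_plane sg) X = (P F * normal_plane sg X)%E.
    by rewrite /mscale /= fineK.
  have rectE X Y : measurable X -> measurable Y ->
      P (h @^-1` (X `*` Y) `&` F) = (P F * normal_plane sg (X `*` Y))%E.
    move=> mX mY; rewrite Fh gE; last exact: mA'.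
    by rewrite normal_planeX// prodA' PF -!muleA; congr (_ * _)%E; rewrite [RHS]muleC muleA.
  rewrite -scE; apply: (@measure_eq_rectangles _ _ _ _ _
    (pushforward (mrestr P mF) h) (mscale (NngNum PF0) (normal_plane sg))) => //.
    by change (P (h @^-1` setT `&` F) < +oo)%E; rewrite preimage_setT setTI -ge0_fin_numE.
  by move=> X Y mX mY; exact: etrans (rectE X Y mX mY) (esym (scE _)).
pose rot (z : mR * mR) : mR * mR := (c * z.1 - s * z.2, s * z.1 + c * z.2).
have mrot : measurable_fun setT rot.
  by apply: measurable_fun_pair; [apply: measurable_funB|apply: measurable_funD];
     apply: measurable_funM.
have mAij : measurable (A i `*` A j) by exact: measurableX.
have -> : E `&` [set w | forall k, A k (givens i j c s (g w) k)] =
    h @^-1` (rot @^-1` (A i `*` A j)) `&` F.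
  apply/seteqP; split=> w /=.
    move=> [Ew h']; split; last first.
      split=> // k; have := h' k; rewrite /A' /givens.
      by case: eqP => // _; case: eqP.
    split => /=.
      by have := h' i; rewrite /givens eqxx.
    by have := h' j; rewrite /givens eqxx eq_sym (negbTE ij).
  move=> [[/= hX hY] [Ew h']]; split => // k; have := h' k.
  by rewrite /A' /givens; case: eqP => [->|_] //; case: eqP => [->|].
rewrite lawF; last by rewrite -[X in measurable X]setTI; exact: mrot.
rewrite (normal_plane_rotation sg0 cs c0 mAij) normal_planeX// PF.
rewrite [in RHS](_ : \prod_(k < n) G (A k) = \prod_(k < n) G (A' (A i) (A j) k))%E.
  by rewrite prodA' -[in LHS]muleA; congr (_ * _)%E; rewrite muleC.
apply: eq_bigr => k _; congr (G _); rewrite /A'.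
by case: eqP => [->//|_]; case: eqP => [->|].
Qed.

Definition flip n (i : 'I_n) (v : 'I_n -> R) : 'I_n -> R :=
  fun k => if k == i then - v k else v k.

Lemma normal_row_flip E n (g : Sigma -> 'I_n -> R) i :
  normal_row E g -> normal_row E (fun w => flip i (g w)).
Proof.
move=> [mg gE]; split.
  move=> k; rewrite /flip; case: (k == i); last exact: mg.
  by apply: measurable_funN; exact: mg.
move=> A mA; pose A' k := if k == i then (fun x : mR => - x : mR) @^-1` (A k) else A k.
rewrite [X in P (_ `&` X)](_ : _ = [set w | forall k, A' k (g w k)]); last first.
  by apply/seteqP; split=> w /= h k; have := h k; rewrite /A' /flip; case: (k == i).
rewrite gE; last first.
  move=> k; rewrite /A'; case: (k == i) => //.
  rewrite -[X in measurable X]setTI.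
  have mN : measurable_fun setT (fun x : mR => - x : mR) by exact: measurable_funN.
  exact: mN.
congr (_ * _)%E; apply: eq_bigr => k _; rewrite /A'; case: (k == i) => //.
exact: normal_prob_opp.
Qed.

End normal_row.

Section euclidean.
Context {R : realType}.

Definition dot n (u v : 'I_n -> R) : R := \sum_(i < n) u i * v i.

Lemma dot_givens n (i j : 'I_n) (c s : R) (u v : 'I_n -> R) :
  i != j -> c ^+ 2 + s ^+ 2 = 1 ->
  dot (givens i j c s u) (givens i j c s v) = dot u v.
Proof.
move=> ij cs; rewrite /dot.
rewrite (bigD1 i)//= (bigD1 j)/=; last by rewrite eq_sym.
rewrite [RHS](bigD1 i)//= [in RHS](bigD1 j)/=; last by rewrite eq_sym.
rewrite (eq_bigr (fun k => u k * v k)); last first.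
  by move=> k /andP[/negbTE ki /negbTE kj]; rewrite /givens ki kj.
rewrite !addrA; congr (_ + _); rewrite /givens !eqxx eq_sym (negbTE ij).
transitivity ((c ^+ 2 + s ^+ 2) * (u i * v i + u j * v j)); first by ring.
by rewrite cs mul1r.
Qed.

Lemma dot_flip n (i : 'I_n) (u v : 'I_n -> R) :
  dot (flip i u) (flip i v) = dot u v.
Proof.
by apply: eq_bigr => k _; rewrite /flip; case: (k == i); rewrite ?mulrNN.
Qed.

Lemma cholesky m (Q : 'I_m -> 'I_m -> R) :
  (forall i j, Q i j = Q j i) ->
  (forall v : 'I_m -> R, 0 <= \sum_(i < m) \sum_(j < m) v i * v j * Q i j) ->
  exists D : 'I_m -> 'I_m -> R, forall i j, dot (D i) (D j) = Q i j.
Proof.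
elim: m Q => [|m IHm] Q symQ psdQ; first by exists (fun _ _ => 0) => -[].
pose q := Q ord0 ord0; pose b j := Q ord0 (lift ord0 j).
pose ext c (v : 'I_m -> R) i := if unlift ord0 i is Some k then v k else c.
have quad c v : 0 <= c ^+ 2 * q + 2 * c * (\sum_(j < m) v j * b j)
    + \sum_(i < m) \sum_(j < m) v i * v j * Q (lift ord0 i) (lift ord0 j).
  have := psdQ (ext c v); rewrite big_ord_recl big_ord_recl /ext unlift_none.
  under eq_bigr do rewrite liftK.
  under [X in _ + X]eq_bigr do rewrite big_ord_recl unlift_none liftK.
  rewrite big_split /=.
  under [X in _ + (_ + X)]eq_bigr do under eq_bigr do rewrite liftK.
  suff -> : \sum_(i < m) v i * c * Q (lift ord0 i) ord0 = c * (\sum_(j < m) v j * b j).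
    suff -> : \sum_(i < m) c * v i * Q ord0 (lift ord0 i) = c * (\sum_(j < m) v j * b j).
      by rewrite -/q => h; apply: (le_trans h); rewrite le_eqVlt; apply/orP; left; apply/eqP; ring.
    by rewrite mulr_sumr; apply: eq_bigr => i _; rewrite mulrA.
  by rewrite mulr_sumr; apply: eq_bigr => i _; rewrite symQ -/(b i); ring.
have q0 : 0 <= q.
  have := quad 1 (fun=> 0); rewrite expr1n mul1r big1; last by move=> j _; rewrite mul0r.
  by rewrite mulr0 addr0 big1 ?addr0// => i _; rewrite big1// => j _; rewrite !mul0r.
have b0 v : q = 0 -> \sum_(j < m) v j * b j = 0.
  move=> qe; apply/eqP; apply: contraT => Bne.
  set B := \sum_(j < m) _ in Bne;
    set W := \sum_(i < m) \sum_(j < m) v i * v j * Q (lift ord0 i) (lift ord0 j).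
  have := quad (- (W + 1) / (2 * B)) v; rewrite qe mulr0 add0r -/B -/W.
  have -> : 2 * (- (W + 1) / (2 * B)) * B = - (W + 1) by field.
  lra.
pose dl := Num.sqrt q.
have dl2 : dl ^+ 2 = q by rewrite sqr_sqrtr.
pose e j := b j / dl.
have dle j : dl * e j = b j.
  have [d0|d0] := eqVneq dl 0; last by rewrite /e mulrC divfK.
  have q00 : q = 0 by rewrite -dl2 d0 expr0n.
  rewrite d0 mul0r; have := b0 (fun k => (k == j)%:R) q00.
  rewrite (bigD1 j)//= eqxx mul1r big1 ?addr0// => k /negbTE kj.
  by rewrite kj mul0r.
have symQ' i j : Q (lift ord0 i) (lift ord0 j) - e i * e j =
    Q (lift ord0 j) (lift ord0 i) - e j * e i.
  by rewrite symQ [e i * _]mulrC.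
have psdQ' v : 0 <= \sum_(i < m) \sum_(j < m)
    v i * v j * (Q (lift ord0 i) (lift ord0 j) - e i * e j).
  have -> : \sum_(i < m) \sum_(j < m) v i * v j * (Q (lift ord0 i) (lift ord0 j) - e i * e j)
     = \sum_(i < m) \sum_(j < m) v i * v j * Q (lift ord0 i) (lift ord0 j) - (\sum_(j < m) v j *
       e j) ^+ 2.
    rewrite expr2 mulr_suml -sumrB; apply: eq_bigr => i _.
    rewrite mulr_sumr -sumrB; apply: eq_bigr => j _; ring.
  have [d0|d0] := eqVneq dl 0.
    rewrite (_ : \sum_(j < m) v j * e j = 0) ?[0 ^+ 2]expr0n.
      have := quad 0 v; rewrite expr0n /= mul0r mulr0 !mul0r !add0r.
      by rewrite subr0.
    by rewrite big1// => j _; rewrite /e d0 invr0 !mulr0.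
  have qn0 : q != 0 by rewrite -dl2 expf_neq0.
  have Be : \sum_(j < m) v j * b j = dl * \sum_(j < m) v j * e j.
    by rewrite mulr_sumr; apply: eq_bigr => j _; rewrite -dle; ring.
  have := quad (- (\sum_(j < m) v j * e j) / dl) v; rewrite Be -dl2.
  set W := \sum_(i < m) \sum_(j < m) _; set S := \sum_(j < m) _.
  suff -> : (- S / dl) ^+ 2 * dl ^+ 2 + 2 * (- S / dl) * (dl * S) + W = W - S ^+ 2 by [].
  by field.
have [D DQ] := IHm _ symQ' psdQ'.
exists (fun i => if unlift ord0 i is Some k then ext (e k) (D k) else ext dl (fun=> 0)).
  move=> i j; rewrite /dot big_ord_recl.
  case: (unliftP ord0 i) => [i'|] ->; case: (unliftP ord0 j) => [j'|] ->.
  + rewrite /ext unlift_none; under eq_bigr do rewrite liftK.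
    by rewrite -/(dot (D i') (D j')) DQ addrC subrK.
  + rewrite /ext unlift_none; under eq_bigr do rewrite liftK mulr0.
    by rewrite big1// addr0 mulrC dle symQ.
  + rewrite /ext unlift_none; under eq_bigr do rewrite liftK mul0r.
    by rewrite big1// addr0 dle.
  + rewrite /ext unlift_none; under eq_bigr do rewrite liftK mul0r.
    by rewrite big1// addr0 -expr2 dl2.
Qed.

End euclidean.

Section normal_row_orthonormal.
Context d (Sigma : measurableType d) (R : realType) (P : probability Sigma R).
Variable sg : R.
Hypothesis sg0 : sg != 0.
Notation mR := (measurableTypeR R).
Notation G := (normal_prob 0 sg).
Notation normal_row := (normal_row P sg).

Let admissible n (L : ('I_n -> R) -> ('I_n -> R)) :=
  (forall u v, dot (L u) (L v) = dot u v) /\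
  (forall E g, measurable E -> normal_row E g -> normal_row E (L \o g)).

Let admissible_comp n (L M : ('I_n -> R) -> ('I_n -> R)) :
  admissible L -> admissible M -> admissible (L \o M).
Proof.
move=> [L1 L2] [M1 M2]; split => [u v|E g mE h]; first by rewrite /= L1 M1.
by apply: (L2 _ (M \o g)) => //; exact: M2.
Qed.

Let admissible_align n (o : 'I_n.+1 -> R) : dot o o = 1 ->
  exists2 L, admissible L & forall k, L o k = (k == ord0)%:R.
Proof.
move=> o1.
have [L [aL Lo]] : exists L, admissible L /\ forall i : 'I_n.+1, i != ord0 -> L o i = 0.
  suff /(_ n) [L [aL Lo]] : forall k, exists L, admissible L /\
      forall i : 'I_n.+1, i != ord0 -> (i <= k)%N -> L o i = 0.
    by exists L; split => // i i0; apply: Lo => //; rewrite -ltnS.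
  elim=> [|k [L [aL Lo]]].
    exists idfun; split; first by split => // u v; rewrite /=.
    by move=> i /negP i0; rewrite leqn0 => i1; case: i0.
  have [kn|nk] := ltnP k.+1 n.+1; last first.
    exists L; split => // i i0 _; apply: Lo => //.
    by rewrite -ltnS (leq_trans (ltn_ord i)).
  pose j : 'I_n.+1 := Ordinal kn.
  set a := L o ord0; set b := L o j.
  have ij : ord0 != j by [].
  have [b0|b0] := eqVneq b 0.
    exists L; split => // i i0; rewrite leq_eqVlt => /orP[/eqP ik|]; last exact: Lo.
    by have -> : i = j by apply: val_inj.
  have rp : 0 < a ^+ 2 + b ^+ 2 by rewrite ltr_wpDl ?sqr_ge0// exprn_even_gt0.
  pose r := Num.sqrt (a ^+ 2 + b ^+ 2).
  have r2 : r ^+ 2 = a ^+ 2 + b ^+ 2 by rewrite sqr_sqrtr// ltW.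
  have r0 : r != 0 by rewrite gt_eqF// sqrtr_gt0.
  have rge0 : 0 <= r by exact: sqrtr_ge0.
  have [c [s [c0 cs z]]] : exists c s, [/\ 0 <= c, c ^+ 2 + s ^+ 2 = 1 & s * a + c * b = 0].
    have [a0|a0] := leP 0 a.
      exists (a / r), (- b / r); split; first by rewrite divr_ge0.
        by rewrite !expr_div_n sqrrN -mulrDl -r2 divff// expf_neq0.
      ring.
    exists (- a / r), (b / r); split; first by rewrite divr_ge0// oppr_ge0 ltW.
      by rewrite !expr_div_n sqrrN -mulrDl -r2 divff// expf_neq0.
    ring.
  exists (givens ord0 j c s \o L); split.
    apply: admissible_comp => //; split; first by move=> u v; rewrite dot_givens.
    by move=> E g mE gE; exact: normal_row_givens.
  move=> i i0 ik; rewrite /= /givens (negbTE i0).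
  case: eqP => [_|/eqP ij']; first by rewrite -/a -/b.
  apply: Lo => //; move: ik; rewrite leq_eqVlt => /orP[/eqP ik|//].
  by move/eqP : ij'; case; exact: val_inj.
have L00 : L o ord0 ^+ 2 = 1.
  rewrite -o1 -[RHS](proj1 aL) /dot (bigD1 ord0)//= big1 ?addr0 -?expr2// => i i0.
  by rewrite Lo// mul0r.
have /eqP := L00; rewrite sqrf_eq1 => /orP[] /eqP L0.
  by exists L => // k; case: eqP => [->|/eqP/Lo].
exists (flip ord0 \o L).
  apply: admissible_comp => //; split; first by move=> u v; rewrite dot_flip.
  by move=> E g mE gE; exact: normal_row_flip.
by move=> k; rewrite /= /flip; case: eqP => [->|/eqP/Lo//]; rewrite L0 opprK.
Qed.

Lemma normal_row_orthonormal m n (O : 'I_m -> 'I_n -> R) E (g : Sigma -> 'I_n -> R) :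
  measurable E -> (forall i j, dot (O i) (O j) = (i == j)%:R) ->
  normal_row E g -> normal_row E (fun w j => dot (g w) (O j)).
Proof.
elim: m n O E g => [|m IHm] n O E g mE onO gE.
  split; first by move=> [].
  move=> A mA; rewrite big_ord0 mule1 [X in _ `&` X](_ : _ = setT) ?setIT//.
  by apply/seteqP; split=> w //= _ [].
case: n O g onO gE => [|n] O g onO gE.
  by have := onO ord0 ord0; rewrite /dot big_ord0 eqxx => /eqP; rewrite eq_sym oner_eq0.
have [L [L1 L2] L0] : exists2 L, admissible L & forall k, L (O ord0) k = (k == ord0)%:R.
  by apply: admissible_align; rewrite onO eqxx.
have gE' : normal_row E (L \o g) by exact: L2.
have dot0 v : dot v (L (O ord0)) = v ord0.
  rewrite /dot (bigD1 ord0)//= L0 eqxx mulr1 big1 ?addr0// => i /negbTE i0.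
  by rewrite L0 i0 mulr0.
have Lj0 j : L (O (lift ord0 j)) ord0 = 0 by rewrite -dot0 L1 onO.
pose g' w i := L (g w) (lift ord0 i).
pose O' j i := L (O (lift ord0 j)) (lift ord0 i).
have g'O' w j : dot (g w) (O (lift ord0 j)) = dot (g' w) (O' j).
  by rewrite -L1 /dot big_ord_recl Lj0 mulr0 add0r.
have onO' i j : dot (O' i) (O' j) = (i == j)%:R.
  have : dot (L (O (lift ord0 i))) (L (O (lift ord0 j))) = (i == j)%:R.
    by rewrite L1 onO (inj_eq lift_inj).
  by rewrite {1}/dot big_ord_recl Lj0 mul0r add0r.
have mg0 : measurable_fun setT (fun w => L (g w) ord0 : mR) by have [+ _] := gE'; exact.
have cons_row (X : set mR) (A : 'I_n -> set mR) :
    [set w | X (L (g w) ord0)] `&` [set w | forall i, A i (g' w i)] =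
    [set w | forall i, (if unlift ord0 i is Some k then A k else X) ((L \o g) w i)].
  apply/seteqP; split=> w /=.
    by move=> [h0 h] i; case: (unliftP ord0 i) => [k|] ->.
  move=> h; split; first by have := h ord0; rewrite unlift_none.
  by move=> i; have := h (lift ord0 i); rewrite liftK.
have PE (X : set mR) (A : 'I_n -> set mR) : measurable X -> (forall i, measurable (A i)) ->
    P ((E `&` [set w | X (L (g w) ord0)]) `&` [set w | forall i, A i (g' w i)]) =
    (P E * (G X * \prod_(i < n) G (A i)))%E.
  move=> mX mA; rewrite -setIA cons_row//.
  rewrite (gE'.2 (fun i => if unlift ord0 i is Some k then A k else X)); last first.
    by move=> i; case: (unliftP ord0 i) => [k|] _.
  rewrite big_ord_recl unlift_none; congr (_ * (_ * _))%E.
  by apply: eq_bigr => i _; rewrite liftK.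
split.
  move=> j; rewrite /dot.
  have -> : (fun w => \sum_(i < n.+1) g w i * O j i) =
      (fun w => \sum_(i <- enum 'I_n.+1) (g w i * O j i)).
    by apply/funext => w; rewrite big_enum.
  apply: measurable_sum => i; apply: measurable_funM => //.
  by have [+ _] := gE; exact.
move=> A mA.
have mE' : measurable (E `&` [set w | A ord0 (L (g w) ord0)]).
  by apply: measurableI => //; rewrite -[X in measurable X]setTI; exact: mg0.
have [|_ IH] := IHm n O' (E `&` [set w | A ord0 (L (g w) ord0)]) g' mE' onO'.
  split; first by move=> i; have [+ _] := gE'; exact.
  move=> B mB; rewrite PE// muleA; congr (_ * _)%E.
  have := PE (A ord0) (fun=> setT) (mA _) (fun=> measurableT).
  rewrite [X in _ `&` X](_ : _ = setT) ?setIT; last by apply/seteqP; split.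
  rewrite big1 ?mule1// => i _.
  exact: probability_setT.
rewrite [X in P X](_ : _ = (E `&` [set w | A ord0 (L (g w) ord0)]) `&`
    [set w | forall i, A (lift ord0 i) (dot (g' w) (O' i))]).
  rewrite (IH (fun i => A (lift ord0 i)))//; rewrite big_ord_recl muleA; congr (_ * _)%E.
  have := PE (A ord0) (fun=> setT) (mA _) (fun=> measurableT).
  rewrite [X in _ `&` X](_ : _ = setT) ?setIT; last by apply/seteqP; split.
  rewrite big1 ?mule1// => i _.
  exact: probability_setT.
apply/seteqP; split=> w /=.
  move=> [Ew h]; split; first by split => //; rewrite -dot0 L1.
  by move=> i; rewrite -g'O'.
move=> [[Ew h0] h]; split => // j; case: (unliftP ord0 j) => [k|] ->.
  by rewrite g'O'.
by rewrite -L1 dot0.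
Qed.

End normal_row_orthonormal.

Local Open Scope complex_scope.

Section rnorm_more.
Context {R : realType} {E : normedModType R[i]}.
Implicit Types x y : E.

Lemma rnormN x : rnorm (- x) = rnorm x.
Proof. by rewrite /rnorm normrN. Qed.

Lemma rnormB_sym x y : rnorm (x - y) = rnorm (y - x).
Proof. by rewrite -rnormN opprB. Qed.

Lemma rnorm_sum n (x : 'I_n -> E) : rnorm (\sum_(i < n) x i) <= \sum_(i < n) rnorm (x i).
Proof.
elim/big_ind2 : _ => //; first by rewrite rnorm0.
by move=> a b c e ab ce; rewrite (le_trans (rnormD _ _))// lerD.
Qed.

Lemma ler_dist_rnorm x y : `|rnorm x - rnorm y| <= rnorm (x - y).
Proof.
rewrite ler_norml; apply/andP; split.
  rewrite lerNl opprB lerBlDr.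
  by rewrite rnormB_sym -[in leLHS](subrK x y) rnormD.
by rewrite lerBlDr -[in leLHS](subrK y x) rnormD.
Qed.

Lemma rnorm_rscale (a : R) x : rnorm (a%:C *: x) = `|a| * rnorm x.
Proof.
have [a0|a0] := leP 0 a; first by rewrite rnorm_real_scale// ger0_norm.
rewrite ltr0_norm// -rnormN -scaleNr -rmorphN /= rnorm_real_scale//.
by rewrite oppr_ge0 ltW.
Qed.

End rnorm_more.

Section law.
Context {R : realType} (n : nat).
Notation mR := (measurableTypeR R).

Definition rectangles : set (set ('I_n -> R)) :=
  [set B | exists A : 'I_n -> set mR, (forall i, measurable (A i)) /\
     B = [set v | forall i, A i (v i)]].

Definition sup_lipschitz (F : ('I_n -> R) -> R) := exists2 K : R, 0 <= K &
  forall u v e, (forall i, `|u i - v i| <= e) -> 0 <= e -> `|F u - F v| <= K * e.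

Lemma measurable_sup_lipschitz (F : ('I_n -> R) -> R) : sup_lipschitz F ->
  measurable_fun setT (F : g_sigma_algebraType rectangles -> mR).
Proof.
move=> [K K0 FK]; apply: (measurability _ (RGenOInfty.measurableE R)) => //.
move=> /= _ [_ [a ->] <-]; rewrite preimage_itvoy setTI.
pose box (q : {ffun 'I_n -> rat} * rat) : set ('I_n -> R) :=
  [set v | forall i, `](ratr (q.1 i) - ratr q.2), (ratr (q.1 i) + ratr q.2)[%classic (v i)].
rewrite [X in measurable X](_ : _ = \bigcup_(q : {ffun 'I_n -> rat} * rat)
  (if `[< box q `<=` [set v | a < F v] >] then box q else set0)).
  apply: countable_bigcupT_measurable; first exact: countableP.
  move=> q; case: asboolP => // _; apply: sub_sigma_algebra.
  exists (fun i => `](ratr (q.1 i) - ratr q.2), (ratr (q.1 i) + ratr q.2)[%classic).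
  by split=> // i; exact: measurable_itv.
apply/seteqP; split=> v /=; last first.
  by move=> [q _]; case: asboolP => // h; exact: h.
move=> aF.
have K1 : 0 < 2 * (K + 1) by rewrite mulr_gt0// ltr_wpDl.
have e0 : 0 < (F v - a) / (2 * (K + 1)) by rewrite divr_gt0// subr_gt0.
have [p /andP[p0 pe]] : exists p : rat, (0 : R) < ratr p < (F v - a) / (2 * (K + 1)).
  by have [p] := rat_in_itvoo e0; rewrite inE /= => /itvP h; exists p; rewrite !h.
have /choice [q qv] : forall i, exists q : rat, v i - ratr p < ratr q < v i + ratr p.
  move=> i; have : v i - ratr p < v i + ratr p by lra.
  by move=> /rat_in_itvoo[q]; rewrite inE /= => /itvP h; exists q; rewrite !h.
have vbox : box (finfun q, p) v.
  by move=> i; rewrite /= in_itv /= ffunE; have /andP[] := qv i; lra.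
exists (finfun q, p) => //; case: asboolP => // -[] u ubox /=.
have : `|F u - F v| <= K * (2 * ratr p).
  apply: FK; last by lra.
  move=> i; have := ubox i; have := vbox i; rewrite /= !in_itv /= ffunE.
  by rewrite ler_norml; lra.
move: pe; rewrite ltr_pdivlMr// ler_norml => pe /andP[+ _].
have : 0 <= ratr p :> R by lra.
nra.
Qed.

Context d (Sigma : measurableType d) (P : probability Sigma R) (sg : R).

Lemma normal_row_measurable (E : set Sigma) (g : Sigma -> 'I_n -> R) :
  normal_row P sg E g ->
  measurable_fun setT (g : Sigma -> g_sigma_algebraType rectangles).
Proof.
move=> [mg _]; apply: (@measurability _ _ Sigma (g_sigma_algebraType rectangles) setT g
  rectangles erefl).
move=> _ [_ [A [mA ->]] <-]; rewrite setTI.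
by apply: measurable_forall_ord => i; rewrite -[X in measurable X]setTI; exact: mg.
Qed.

Lemma normal_row_Lnorm (g h : Sigma -> 'I_n -> R) (F : ('I_n -> R) -> R) :
  normal_row P sg setT g -> normal_row P sg setT h -> sup_lipschitz F ->
  Lnorm P 2%:E (fun w => (F (g w))%:E) = Lnorm P 2%:E (fun w => (F (h w))%:E).
Proof.
move=> ng nh lF; rewrite Lnorm.unlock /Lnorm.body.
apply: (congr1 (fun z => (z `^ 2^-1)%E)).
have mF := measurable_sup_lipschitz lF.
have mg := normal_row_measurable ng; have mh := normal_row_measurable nh.
pose H (v : g_sigma_algebraType rectangles) : \bar R := (`|(F v)%:E| `^ 2)%E.
have mH : measurable_fun setT H.
  rewrite /H; apply/measurable_EFinP.
  by apply: (measurableT_comp (measurable_powR _)); apply: measurableT_comp.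
have H0 v : (0 <= H v)%E by exact: poweR_ge0.
rewrite -[LHS](ge0_integral_pushforward mg P measurableT mH (fun v _ => H0 v)).
rewrite -[RHS](ge0_integral_pushforward mh P measurableT mH (fun v _ => H0 v)).
apply: eq_measure_integral => A mA _.
have gG k : rectangles ((fun=> setT) (k : nat)).
  by exists (fun=> setT); split => //; apply/seteqP; split.
pose T' := g_sigma_algebraType rectangles.
apply: (@measure_unique _ R T' rectangles (fun=> setT) erefl _ gG _
  (pushforward P (g : Sigma -> T')) (pushforward P (h : Sigma -> T')) _ _ A mA).
- move=> _ _ [A1 [mA1 ->]] [A2 [mA2 ->]].
  exists (fun i => A1 i `&` A2 i); split; first by move=> i; exact: measurableI.
  by apply/seteqP; split=> v /=; [move=> [h1 h2] i|move=> h'; split => i; have [] := h' i].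
- by rewrite bigcup_const//; exists 0%N.
- move=> _ [A1 [mA1 ->]].
  have E1 := ng.2 _ mA1; have E2 := nh.2 _ mA1; rewrite !setTI in E1 E2.
  exact: etrans E1 (esym E2).
- by move=> _; rewrite /= /pushforward preimage_setT -ge0_fin_numE ?fin_num_measure.
Qed.

End law.

Section Lnorm2.
Context d (T : measurableType d) (R : realType) (mu : {measure set T -> \bar R}).
Implicit Types f g : T -> R.

Let measurable_sqr f : measurable_fun setT f ->
  measurable_fun setT (fun w => `|(f w)%:E| `^ 2)%E.
Proof.
move=> mf; apply/measurable_EFinP; apply: (measurableT_comp (measurable_powR _)).
exact: measurableT_comp.
Qed.

Lemma le_Lnorm2 f g : measurable_fun setT f -> measurable_fun setT g ->
  (forall w, `|f w| <= `|g w|) ->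
  (Lnorm mu 2%:E (EFin \o f) <= Lnorm mu 2%:E (EFin \o g))%E.
Proof.
move=> mf mg fg; rewrite Lnorm.unlock /Lnorm.body.
have I0 h : (0 <= \int[mu]_w (`|(h w)%:E| `^ 2))%E.
  by apply: integral_ge0 => w _; exact: poweR_ge0.
apply: gt0_ler_poweR; first by rewrite invr_ge0.
- by rewrite in_itv /= leey andbT; exact: I0.
- by rewrite in_itv /= leey andbT; exact: I0.
apply: ge0_le_integral.
- exact: measurableT.
- by move=> w _; exact: poweR_ge0.
- exact: measurable_sqr.
- exact: measurable_sqr.
by move=> w _; rewrite /= lee_fin ge0_ler_powR// nnegrE.
Qed.

Lemma Lnorm2Z (a : R) f : 0 <= a -> measurable_fun setT f ->
  Lnorm mu 2%:E (fun w => (a * f w)%:E) = (a%:E * Lnorm mu 2%:E (EFin \o f))%E.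
Proof.
move=> a0 mf; rewrite Lnorm.unlock /Lnorm.body.
transitivity (((a `^ 2)%:E * \int[mu]_w (`|(f w)%:E| `^ 2)) `^ 2^-1)%E.
  apply: (congr1 (fun z => (z `^ 2^-1)%E)).
  rewrite -(ge0_integralZl mu measurableT); last 3 first.
  - exact: measurable_sqr.
  - by move=> w _; exact: poweR_ge0.
  - by rewrite lee_fin powR_ge0.
  apply: eq_integral => w _; rewrite EFinM abseM poweRM// ?abse_ge0//.
  by rewrite gee0_abs.
rewrite poweRM; last 2 first.
- by rewrite lee_fin powR_ge0.
- by apply: integral_ge0 => w _; exact: poweR_ge0.
by congr (_ * _)%E; rewrite /= -powRrM mulfV// powRr1.
Qed.

End Lnorm2.

Section normal_contraction.
Context d (Sigma : measurableType d) (R : realType) (P : probability Sigma R).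
Variable sg : R.
Hypothesis sg0 : sg != 0.
Notation normal_row := (normal_row P sg).
Context (X : normedModType R[i]).

Lemma sup_lipschitz_rnorm m (u : 'I_m -> X) :
  sup_lipschitz (fun v => rnorm (\sum_(j < m) (v j)%:C *: u j)).
Proof.
exists (\sum_(j < m) rnorm (u j)).
  by apply: sumr_ge0 => j _; exact: rnorm_ge0.
move=> v w e vw e0; apply: (le_trans (ler_dist_rnorm _ _)).
rewrite -sumrB (le_trans (rnorm_sum _))// mulr_suml ler_sum// => j _.
rewrite -scalerBl -rmorphB /= rnorm_rscale mulrC ler_wpM2l//.
exact: rnorm_ge0.
Qed.

Lemma normal_row_rnorm_measurable m (u : 'I_m -> X) E (g : Sigma -> 'I_m -> R) :
  normal_row E g ->
  measurable_fun setT (fun w => rnorm (\sum_(j < m) (g w j)%:C *: u j) : measurableTypeR R).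
Proof.
move=> ng; have := measurable_sup_lipschitz (sup_lipschitz_rnorm u).
by move=> /measurableT_comp; apply; exact: normal_row_measurable ng.
Qed.

Lemma normal_contraction n m (O : 'I_m -> 'I_n -> R) (u : 'I_m -> X)
    (g : Sigma -> 'I_(n + m) -> R) (xi : Sigma -> 'I_m -> R) :
  (forall v : 'I_m -> R,
     \sum_(i < n) (\sum_(j < m) v j * O j i) ^+ 2 <= \sum_(j < m) v j ^+ 2) ->
  normal_row setT g -> normal_row setT xi ->
  (Lnorm P 2%:E (fun w => (rnorm (\sum_(j < m)
      (\sum_(i < n) g w (lshift m i) * O j i)%:C *: u j))%:E) <=
   Lnorm P 2%:E (fun w => (rnorm (\sum_(j < m) (xi w j)%:C *: u j))%:E))%E.
Proof.
move=> cO ng nx.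
have [D DQ] : exists D : 'I_m -> 'I_m -> R,
    forall i j, dot (D i) (D j) = (i == j)%:R - dot (O i) (O j).
  apply: cholesky; first by move=> i j; rewrite eq_sym /dot; congr (_ - _);
    apply: eq_bigr => k _; rewrite mulrC.
  move=> v; have := cO v; rewrite -subr_ge0; congr (0 <= _).
  under [RHS]eq_bigr do under eq_bigr do rewrite mulrBr.
  under [RHS]eq_bigr do rewrite sumrB.
  rewrite sumrB; congr (_ - _).
    apply: eq_bigr => i _; rewrite (bigD1 i)//= eqxx mulr1 big1 ?addr0 ?expr2//.
    by move=> j; rewrite eq_sym => /negbTE ->; rewrite mulr0.
  transitivity (\sum_(k < n) \sum_(i < m) \sum_(j < m) v i * v j * (O i k * O j k)).
    apply: eq_bigr => k _; rewrite expr2 mulr_suml; apply: eq_bigr => i _.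
    by rewrite mulr_sumr; apply: eq_bigr => j _; ring.
  rewrite exchange_big; apply: eq_bigr => i _; rewrite exchange_big; apply: eq_bigr => j _.
  by rewrite /dot mulr_sumr.
pose V (s : R) (j : 'I_m) (k : 'I_(n + m)) : R :=
  match fintype.split k with inl i => O j i | inr i => s * D j i end.
have dotV s v j : dot v (V s j) =
    \sum_(i < n) v (lshift m i) * O j i + s * \sum_(i < m) v (rshift n i) * D j i.
  rewrite /dot big_split_ord /= /V; congr (_ + _).
    by apply: eq_bigr => i _; rewrite (unsplitK (inl i)).
  by rewrite mulr_sumr; apply: eq_bigr => i _; rewrite (unsplitK (inr i)) mulrCA.
have onV s : s ^+ 2 = 1 -> forall i j, dot (V s i) (V s j) = (i == j)%:R.
  move=> s2 i j; rewrite dotV.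
  rewrite (eq_bigr (fun k => O i k * O j k)); last first.
    by move=> k _; rewrite /V (unsplitK (inl k)).
  rewrite [X in _ + s * X](eq_bigr (fun k => s * (D i k * D j k))); last first.
    by move=> k _; rewrite /V (unsplitK (inr k)) mulrA.
  rewrite -mulr_sumr mulrA -expr2 s2 mul1r -/(dot (D i) (D j)) DQ.
  by rewrite addrC subrK.
have n1 : normal_row setT (fun w j => dot (g w) (V 1 j)).
  by apply: normal_row_orthonormal => //; apply: onV; rewrite expr1n.
have n2 : normal_row setT (fun w j => dot (g w) (V (-1) j)).
  by apply: normal_row_orthonormal => //; apply: onV; rewrite sqrrN expr1n.
pose u2 j : X := (2^-1 : R)%:C *: u j.
pose F (s : R) w := rnorm (\sum_(j < m) (dot (g w) (V s j))%:C *: u2 j).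
have n3 s : normal_row setT (fun w j => dot (g w) (V s j)) ->
    (Lnorm P 2%:E (EFin \o F s) =
    Lnorm P 2%:E (fun w => (rnorm (\sum_(j < m) (xi w j)%:C *: u2 j))%:E))%E.
  move=> ns; rewrite /comp /F.
  exact: (@normal_row_Lnorm _ _ _ _ _ _ (fun w j => dot (g w) (V s j)) xi
    (fun v => rnorm (\sum_(j < m) (v j)%:C *: u2 j)) ns nx
    (sup_lipschitz_rnorm _)).
have mF s : normal_row setT (fun w j => dot (g w) (V s j)) -> measurable_fun setT (F s).
  exact: normal_row_rnorm_measurable.
have half (v : 'I_m -> R) : rnorm (\sum_(j < m) (v j)%:C *: u2 j) =
    2^-1 * rnorm (\sum_(j < m) (v j)%:C *: u j).
  rewrite -rnorm_real_scale ?invr_ge0//; congr rnorm; rewrite scaler_sumr.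
  by apply: eq_bigr => j _; rewrite /u2 !scalerA mulrC.
have -> : Lnorm P 2%:E (fun w => (rnorm (\sum_(j < m) (xi w j)%:C *: u j))%:E) =
   (Lnorm P 2%:E (EFin \o F 1%R) + Lnorm P 2%:E (EFin \o F (-1)%R))%E.
  rewrite !n3//.
  set N := Lnorm P _ _.
  have -> : Lnorm P 2%:E (fun w => (rnorm (\sum_(j < m) (xi w j)%:C *: u2 j))%:E) =
      (2^-1%:E * N)%E.
    rewrite -Lnorm2Z ?invr_ge0//; last exact: normal_row_rnorm_measurable nx.
    by apply: eq_Lnorm => w; rewrite half.
  rewrite -ge0_muleDl ?lee_fin ?invr_ge0// -EFinD.
  by rewrite (_ : 2^-1 + 2^-1 = 1 :> R) ?mul1e//; lra.
have := minkowski_EFin P (mF 1 n1) (mF (-1) n2) (ler1n R 2).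
apply: le_trans.
apply: le_Lnorm2 => [||w].
- pose u' (k : 'I_(n + m)) : X :=
    match fintype.split k with inl i => \sum_(j < m) (O j i)%:C *: u j | inr i => 0 end.
  have -> : (fun w => rnorm (\sum_(j < m) (\sum_(i < n) g w (lshift m i) * O j i)%:C *: u j)) =
     (fun w => rnorm (\sum_(k < n + m) (g w k)%:C *: u' k)).
    apply/funext => w; congr rnorm; rewrite big_split_ord /= [X in _ + X]big1 ?addr0; last first.
      by move=> i _; rewrite /u' (unsplitK (inr i)) scaler0.
    under eq_bigr do rewrite rmorph_sum scaler_suml.
    rewrite exchange_big; apply: eq_bigr => i _; rewrite /u' (unsplitK (inl i)).
    by rewrite scaler_sumr; apply: eq_bigr => j _; rewrite rmorphM scalerA.
  exact: normal_row_rnorm_measurable ng.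
- by apply: measurable_funD; exact: mF.
rewrite !ger0_norm ?rnorm_ge0//; last by rewrite addr_ge0// rnorm_ge0.
apply: le_trans (rnormD _ _); rewrite le_eqVlt; apply/orP; left; apply/eqP; congr rnorm.
rewrite -big_split /=; apply: eq_bigr => j _; rewrite /u2 !scalerA -scalerDl; congr (_ *: _).
rewrite -!rmorphM -rmorphD; congr (_%:C); rewrite !dotV; lra.
Qed.

End normal_contraction.

Section normal_moment.
Context {R : realType} (sg : R).
Hypothesis sg0 : sg != 0.
Notation mR := (measurableTypeR R).
Notation leb := (@lebesgue_measure R).

Lemma ge0_integral_normal_prob (f : mR -> \bar R) :
  measurable_fun setT f -> (forall x, 0 <= f x)%E ->
  (\int[normal_prob 0 sg]_x f x = \int[leb]_x (f x * (normal_pdf 0 sg x)%:E))%E.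
Proof.
move=> mf f0.
have dom := @normal_prob_dominates R 0 sg.
rewrite -(Radon_Nikodym_SigmaFinite.change_of_variables dom f0 measurableT mf).
pose h := Radon_Nikodym_SigmaFinite.f (normal_prob 0 sg) leb.
have ih : leb.-integrable setT h by exact: Radon_Nikodym_SigmaFinite.f_integrable.
have mp : measurable_fun setT (fun x : mR => (normal_pdf 0 sg x)%:E).
  by apply/measurable_EFinP; exact: (measurable_normal_pdf 0 sg).
apply: ae_eq_integral => //.
- by apply: emeasurable_funM => //; exact: measurable_int ih.
- exact: emeasurable_funM.
have : ae_eq leb setT h (fun x => (normal_pdf 0 sg x)%:E).
  apply: integral_ae_eq => // A _ mA.
  by rewrite -Radon_Nikodym_SigmaFinite.f_integral.
by apply: filterS => x + _ => /(_ I) <-.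
Qed.

Lemma normal_second_moment_lty :
  (\int[normal_prob 0 sg]_x (x ^+ 2)%:E < +oo)%E.
Proof.
rewrite ge0_integral_normal_prob; last 2 first.
- by apply/measurable_EFinP; exact: measurable_funX.
- by move=> x; rewrite lee_fin sqr_ge0.
pose s' := Num.sqrt 2 * sg.
have s'0 : s' != 0 by rewrite mulf_neq0// gt_eqF// sqrtr_gt0.
have s'2 : s' ^+ 2 = 2 * sg ^+ 2 by rewrite exprMn sqr_sqrtr.
pose c := 4 * sg ^+ 2 * normal_peak sg / normal_peak s'.
have p'0 := normal_peak_gt0 s'0; have p0 := normal_peak_gt0 sg0.
have sgp : 0 < sg ^+ 2 by rewrite exprn_even_gt0.
have c0 : 0 <= c.
  by apply: divr_ge0; [apply: mulr_ge0; [apply: mulr_ge0|]|]; rewrite ?ltW.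
apply: (@le_lt_trans _ _ (\int[leb]_x (c%:E * (normal_pdf 0 s' x)%:E))%E); last first.
  rewrite (ge0_integralZl leb measurableT); last 3 first.
  - by apply/measurable_EFinP; exact: (measurable_normal_pdf 0 s').
  - by move=> x _; rewrite lee_fin normal_pdf_ge0.
  - by rewrite lee_fin.
  by rewrite integral_normal_pdf mule1 ltry.
apply: ge0_le_integral.
- exact: measurableT.
- by move=> x _; rewrite -EFinM lee_fin mulr_ge0 ?sqr_ge0 ?normal_pdf_ge0.
- apply: emeasurable_funM; apply/measurable_EFinP; first exact: measurable_funX.
  exact: (measurable_normal_pdf 0 sg).
- apply: emeasurable_funM => //; apply/measurable_EFinP.
  exact: (measurable_normal_pdf 0 s').
move=> x _; rewrite -!EFinM lee_fin !normal_pdfE//.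
have -> : x ^+ 2 * (normal_peak sg * normal_fun 0 sg x) =
    normal_peak sg * (x ^+ 2 * normal_fun 0 sg x) by ring.
have -> : c * (normal_peak s' * normal_fun 0 s' x) =
    normal_peak sg * (4 * sg ^+ 2 * normal_fun 0 s' x).
  by rewrite /c; field; rewrite gt_eqF.
rewrite ler_pM2l//.
rewrite /normal_fun subr0 s'2.
set y := x ^+ 2 / (4 * sg ^+ 2).
have -> : - x ^+ 2 / (sg ^+ 2 *+ 2) = - y - y by rewrite /y -mulr_natr; field.
have -> : - x ^+ 2 / (2 * sg ^+ 2 *+ 2) = - y by rewrite /y -mulr_natr; field.
have -> : x ^+ 2 = 4 * sg ^+ 2 * y by rewrite /y; field.
rewrite expRD mulrA ler_wpM2r ?expR_ge0//.
rewrite -mulrA -[leRHS]mulr1 (ler_pM2l (mulr_gt0 _ sgp))//.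
rewrite expRN ler_pdivrMr ?expR_gt0// mul1r.
by apply: le_trans (expR_ge1Dx y); lra.
Qed.

End normal_moment.

Section gaussian_rows.
Context d (Sigma : measurableType d) (R : realType) (P : probability Sigma R).
Variable gam : nat -> Sigma -> R[i].
Hypothesis gamG : gaussian_sequence P gam.
Notation mR := (measurableTypeR R).

Let sg : R := Num.sqrt 2^-1.
Notation G := (normal_prob 0 sg).

Lemma gaussian_std_neq0 : Num.sqrt 2^-1 != 0 :> R.
Proof. by rewrite gt_eqF// sqrtr_gt0 invr_gt0. Qed.

Definition gaussian_part (p : nat * bool) (w : Sigma) : R :=
  if p.2 then complex.Im (gam p.1 w) else complex.Re (gam p.1 w).

Lemma gaussian_normal_row n (idx : 'I_n -> nat * bool) : injective idx ->
  normal_row P sg setT (fun w i => gaussian_part (idx i) w).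
Proof.
move=> idxI; have [std ind] := gamG.
split.
  move=> i; rewrite /gaussian_part; have [mre mim _] := std (idx i).1.
  by case: (idx i).2.
move=> A mA; rewrite setTI probability_setT mul1e.
pose M := \max_(i < n) (idx i).1.+1.
have iM i : ((idx i).1 < M)%N by exact: (@leq_bigmax _ (fun i => (idx i).1.+1) i).
pose jdx i : 'I_M * bool := (Ordinal (iM i), (idx i).2).
have jdxI : injective jdx.
  move=> i j [h1 h2]; apply: idxI.
  by rewrite (surjective_pairing (idx i)) (surjective_pairing (idx j)) h1 h2.
pose B (p : nat * bool) : set mR :=
  if [pick i | idx i == p] is Some i then A i else setT.
have Bidx i : B (idx i) = A i.
  rewrite /B; case: pickP => [j /eqP/idxI -> //|/(_ i)]; by rewrite eqxx.
have mB p : measurable (B p) by rewrite /B; case: pickP.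
pose C k : set (R * R) := B (k, false) `*` B (k, true).
have mC k : measurable (C k) by apply: measurableX; exact: mB.
have := ind (iota 0 M) C (iota_uniq 0 M) mC.
have -> : [set w | forall k, k \in iota 0 M -> C k (complex.Re (gam k w), complex.Im (gam k w))] =
    [set w | forall i, A i (gaussian_part (idx i) w)].
  apply/seteqP; split=> w /= h.
    move=> i; have := h (idx i).1; rewrite mem_iota /= add0n iM => /(_ isT)[/= h1 h2].
    rewrite -Bidx /gaussian_part; move: h1 h2.
    by rewrite [in B (idx i)](surjective_pairing (idx i)); case: (idx i).2.
  move=> k _; split => /=.
    rewrite /B; case: pickP => // i /eqP ik; have := h i.
    by rewrite /gaussian_part ik.
  rewrite /B; case: pickP => // i /eqP ik; have := h i.
  by rewrite /gaussian_part ik.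
move=> ->.
transitivity (\prod_(p : 'I_M * bool) G (B (val p.1, p.2)))%E.
  rewrite -(pair_big predT predT (fun (k : 'I_M) b => G (B (val k, b))))/=.
  rewrite -{1}(subn0 M) -/(index_iota 0 M) big_mkord; apply: eq_bigr => k _.
  have [_ _ ->] := std k; [|exact: mB|exact: mB].
  by rewrite big_bool muleC.
rewrite (bigID [pred p | p \in codom jdx])/= [X in (_ * X)%E]big1 ?mule1; last first.
  move=> [k b] /= kb; rewrite /B; case: pickP => [i /eqP ikb|_]; last exact: probability_setT.
  case/negP: kb; apply/codomP; exists i; rewrite /jdx; congr (_, _).
    by apply: val_inj; rewrite /= ikb.
  by rewrite ikb.
rewrite (@reindex_omap _ _ _ _ _ jdx (fun p => [pick i | jdx i == p]))/=; last first.
  move=> p /codomP[i ->]; case: pickP => [j /eqP/jdxI -> //|/(_ i)]; by rewrite eqxx.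
apply: eq_big => [i|i _]; last by rewrite -(Bidx i) -surjective_pairing.
rewrite codom_f /=; case: pickP => [j /eqP/jdxI -> |/(_ i)]; by rewrite eqxx.
Qed.

End gaussian_rows.

Section nsq.
Context {R : realType}.
Implicit Types z : R[i].

Definition nsq z : R := complex.Re z ^+ 2 + complex.Im z ^+ 2.

Lemma nsq_ge0 z : 0 <= nsq z. Proof. by rewrite addr_ge0 ?sqr_ge0. Qed.

Lemma rnorm_nsq (z : R[i]^o) : rnorm z ^+ 2 = nsq z.
Proof. by rewrite /rnorm normc_def /= sqr_sqrtr ?nsq_ge0. Qed.

Lemma parts_le_rnorm (z : R[i]) :
  `|complex.Re z| <= rnorm (z : R[i]^o) /\ `|complex.Im z| <= rnorm (z : R[i]^o).
Proof.
have h : rnorm (z : R[i]^o) ^+ 2 = `|complex.Re z| ^+ 2 + `|complex.Im z| ^+ 2.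
  by rewrite rnorm_nsq !real_normK ?num_real.
by split; rewrite -ler_sqr ?nnegrE ?rnorm_ge0// h ?lerDl ?lerDr sqr_ge0.
Qed.

End nsq.

(** * Gaussian norms *)

Section gauss_norm_theory.
Context d (Sigma : measurableType d) (R : realType) (P : probability Sigma R).
Variable gam : nat -> Sigma -> R[i].
Hypothesis gamG : gaussian_sequence P gam.
Context (X : normedModType R[i]).
Notation mR := (measurableTypeR R).
Notation sg := (Num.sqrt 2^-1 : R).
Notation gnorm := (gauss_norm P gam).

Let sg0 : sg != 0. Proof. exact: gaussian_std_neq0. Qed.

(* The first [n] complex variables as [n + n] real ones; [real_vectors] is the
   matching list of vectors [x_k], [i x_k]. *)
Let part n (k : 'I_(n + n)) : nat * bool :=
  match fintype.split k with inl i => (val i, false) | inr i => (val i, true) end.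

Let part_inj n : injective (@part n).
Proof.
move=> i j; rewrite /part.
case: (splitP i) => i' ii'; case: (splitP j) => j' jj' // [] ij;
  by apply: val_inj; rewrite /= ii' jj' ij.
Qed.

Definition real_vectors n (x : 'I_n -> X) (k : 'I_(n + n)) : X :=
  match fintype.split k with inl i => x i | inr i => (0 +i* 1) *: x i end.

Lemma complex_scaleE (z : R[i]) (x : X) :
  z *: x = (complex.Re z)%:C *: x + (complex.Im z)%:C *: ((0 +i* 1) *: x).
Proof.
rewrite scalerA -scalerDl; congr (_ *: _); case: z => a b /=.
by apply/eqP; rewrite eq_complex /=; apply/andP; split; apply/eqP; ring.
Qed.

Lemma gauss_sum_real n (x : 'I_n -> X) w :
  \sum_(k < n) gam k w *: x k =
  \sum_(k < n + n) (gaussian_part gam (part k) w)%:C *: real_vectors x k.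
Proof.
rewrite big_split_ord /= -big_split /=; apply: eq_bigr => k _.
by rewrite complex_scaleE /real_vectors /part (unsplitK (inl k)) (unsplitK (inr k)).
Qed.

Lemma measurable_gauss_sum n (x : 'I_n -> X) :
  measurable_fun setT (fun w => rnorm (\sum_(k < n) gam k w *: x k) : mR).
Proof.
under eq_fun do rewrite gauss_sum_real.
exact: normal_row_rnorm_measurable (gaussian_normal_row gamG (@part_inj n)).
Qed.

Lemma gauss_norm_ge0 n (x : 'I_n -> X) : (0 <= gnorm x)%E.
Proof. exact: Lnorm_ge0. Qed.

Lemma eq_gauss_norm n (x y : 'I_n -> X) : x =1 y -> gnorm x = gnorm y.
Proof. by move=> xy; congr (gauss_norm _ _ _); apply/funext. Qed.

Lemma gauss_normD n (x y : 'I_n -> X) :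
  (gnorm (fun k => (x k + y k)%R) <= gnorm x + gnorm y)%E.
Proof.
have := minkowski_EFin P (measurable_gauss_sum x) (measurable_gauss_sum y) (ler1n R 2).
apply: le_trans; apply: le_Lnorm2.
- exact: measurable_gauss_sum.
- by apply: measurable_funD; exact: measurable_gauss_sum.
move=> w; rewrite !ger0_norm ?addr_ge0 ?rnorm_ge0//.
apply: le_trans (rnormD _ _); rewrite -big_split /= le_eqVlt; apply/orP; left; apply/eqP.
by congr rnorm; apply: eq_bigr => k _; rewrite scalerDr.
Qed.

Lemma gauss_normZ n (a : R[i]) (x : 'I_n -> X) :
  gnorm (fun k => a *: x k) = ((rnorm (a : R[i]^o))%:E * gnorm x)%E.
Proof.
rewrite -Lnorm2Z ?rnorm_ge0//; last exact: measurable_gauss_sum.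
apply: eq_Lnorm => w; congr _%:E; rewrite -rnormZ scaler_sumr; congr rnorm.
by apply: eq_bigr => k _; rewrite !scalerA mulrC.
Qed.

Lemma gauss_norm_contraction n m (A : 'I_n -> 'I_m -> R[i]) (x : 'I_m -> X) :
  (forall z : 'I_m -> R[i],
     \sum_(i < n) nsq (\sum_(j < m) A i j * z j) <= \sum_(j < m) nsq (z j)) ->
  (gnorm (fun i => (\sum_(j < m) A i j *: x j)%R) <= gnorm x)%E.
Proof.
move=> cA.
pose Pr i j := complex.Re (A i j); pose Qr i j := complex.Im (A i j).
pose O (j : 'I_(m + m)) (i : 'I_(n + n)) : R :=
  match fintype.split j, fintype.split i with
  | inl j', inl i' => Pr i' j'  | inl j', inr i' => - Qr i' j'
  | inr j', inl i' => Qr i' j'  | inr j', inr i' => Pr i' j' end.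
pose idx (k : 'I_((n + n) + (m + m))) : nat * bool :=
  match fintype.split k with
  | inl k' => part k'
  | inr k' => ((n + (part k').1)%N, (part k').2)
  end.
have part_lt p (k : 'I_(p + p)) : ((part k).1 < p)%N.
  by rewrite /part; case: (fintype.split k) => i /=.
have idxI : injective idx.
  move=> i j; rewrite /idx.
  case: (splitP i) => i' ii'; case: (splitP j) => j' jj'.
  - by move=> /part_inj ij; apply: val_inj; rewrite /= ii' jj' ij.
  - by move=> h; have := part_lt _ i'; rewrite h /= ltnNge leq_addr.
  - by move=> h; have := part_lt _ j'; rewrite -h /= ltnNge leq_addr.
  - move=> [/addnI h1 h2]; have h : i' = j'.
      by apply: part_inj; rewrite (surjective_pairing (part i')) h1 h2 -surjective_pairing.
    by apply: val_inj; rewrite /= ii' jj' h.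
have cO (v : 'I_(m + m) -> R) :
    \sum_(i < n + n) (\sum_(j < m + m) v j * O j i) ^+ 2 <= \sum_(j < m + m) v j ^+ 2.
  pose z j := (v (lshift m j)) +i* (- v (rshift m j)).
  have -> : \sum_(j < m + m) v j ^+ 2 = \sum_(j < m) nsq (z j).
    rewrite big_split_ord /= -big_split /=.
    by apply: eq_bigr => j _; rewrite /nsq /= sqrrN.
  apply: le_trans (cA z).
  rewrite le_eqVlt; apply/orP; left; apply/eqP; rewrite big_split_ord /= -big_split /=.
  apply: eq_bigr => i _; rewrite /nsq !raddf_sum /= !big_split_ord /=; congr (_ ^+ 2 + _).
    rewrite -big_split /=; apply: eq_bigr => j _.
    rewrite /O (unsplitK (inl j)) (unsplitK (inl i)) (unsplitK (inr j)) /Pr /Qr.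
    by case: (A i j) => a b /=; ring.
  rewrite -[RHS]sqrrN -sumrN -big_split /=; congr (_ ^+ 2); apply: eq_bigr => j _.
  rewrite /O (unsplitK (inl j)) (unsplitK (inr i)) (unsplitK (inr j)) /Pr /Qr.
  by case: (A i j) => a b /=; ring.
have := normal_contraction sg0 (real_vectors x) cO (gaussian_normal_row gamG idxI)
  (gaussian_normal_row gamG (@part_inj m)).
congr (_ <= _)%E; last by apply: eq_Lnorm => w; rewrite gauss_sum_real.
apply: eq_Lnorm => w; congr (rnorm _)%:E.
transitivity (\sum_(j < m) (\sum_(i < n) gam i w * A i j) *: x j); last first.
  under eq_bigr do rewrite scaler_suml.
  rewrite exchange_big; apply: eq_bigr => i _; rewrite scaler_sumr.
  by apply: eq_bigr => j _; rewrite scalerA.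
rewrite big_split_ord /= -big_split /=; apply: eq_bigr => j _ /=.
rewrite [RHS]complex_scaleE /real_vectors (unsplitK (inl j)) (unsplitK (inr j)).
congr (_%:C *: _ + _%:C *: _).
  rewrite raddf_sum /= big_split_ord /= -big_split /=; apply: eq_bigr => i _.
  rewrite /idx /O !(unsplitK (inl _)) (unsplitK (inr i)) /part (unsplitK (inl i)) (unsplitK (inr
    i)).
  by rewrite /gaussian_part /Pr /Qr /=; case: (A i j) (gam i w) => a b [e f] /=; ring.
rewrite raddf_sum /= big_split_ord /= -big_split /=; apply: eq_bigr => i _.
rewrite /idx /O !(unsplitK (inl _)) (unsplitK (inr i)) (unsplitK (inr j)) /part (unsplitK (inl
  i)) (unsplitK (inr i)).
by rewrite /gaussian_part /Pr /Qr /=; case: (A i j) (gam i w) => a b [e f] /=; ring.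
Qed.

End gauss_norm_theory.

Lemma rnorm_real {R : realType} (a : R) : rnorm (a%:C : R[i]^o) = `|a|.
Proof. by rewrite /rnorm normc_def /= expr0n addr0 sqrtr_sqr. Qed.

Section gauss_norm_single.
Context d (Sigma : measurableType d) (R : realType) (P : probability Sigma R).
Variable gam : nat -> Sigma -> R[i].
Hypothesis gamG : gaussian_sequence P gam.
Notation mR := (measurableTypeR R).
Notation sg := (Num.sqrt 2^-1 : R).
Notation gnorm := (gauss_norm P gam).

Let K := Lnorm P 2%:E (fun w => (rnorm (gam 0%N w : R[i]^o))%:E).

Let mre : measurable_fun setT (fun w => complex.Re (gam 0%N w) : mR).
Proof. by have [h _ _] := gamG.1 0%N; exact: h. Qed.

Let mim : measurable_fun setT (fun w => complex.Im (gam 0%N w) : mR).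
Proof. by have [_ h _] := gamG.1 0%N; exact: h. Qed.

Let law_re (A : set mR) : measurable A ->
  P ((fun w => complex.Re (gam 0%N w) : mR) @^-1` A) = normal_prob 0 sg A.
Proof.
move=> mA; have [_ _ /(_ A setT mA measurableT)] := gamG.1 0%N.
rewrite [X in (_ * X)%E]probability_setT mule1 => <-.
by congr (P _); apply/seteqP; split=> w //= [].
Qed.

Let law_im (A : set mR) : measurable A ->
  P ((fun w => complex.Im (gam 0%N w) : mR) @^-1` A) = normal_prob 0 sg A.
Proof.
move=> mA; have [_ _ /(_ setT A measurableT mA)] := gamG.1 0%N.
rewrite [X in (X * _)%E]probability_setT mul1e => <-.
by congr (P _); apply/seteqP; split=> w //= [].
Qed.

Let K_part (f : Sigma -> mR) : measurable_fun setT f ->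
  (forall A : set mR, measurable A -> P (f @^-1` A) = normal_prob 0 sg A) ->
  (Lnorm P 2%:E (EFin \o f) < +oo)%E.
Proof.
move=> mf lf; rewrite Lnorm.unlock /Lnorm.body; apply: poweR_lty.
apply: le_lt_trans (normal_second_moment_lty (gaussian_std_neq0 R)).
have mq : measurable_fun setT (fun x : mR => (x ^+ 2)%:E).
  by apply/measurable_EFinP; exact: measurable_funX.
rewrite (@eq_measure_integral _ _ _ _ (pushforward P f)); last first.
  by move=> A mA _; exact: esym (lf A mA).
rewrite (ge0_integral_pushforward mf P measurableT mq); last first.
  by move=> x _; rewrite lee_fin sqr_ge0.
rewrite le_eqVlt; apply/orP; left; apply/eqP; apply: eq_integral => w _ /=.
by congr _%:E; rewrite powR_mulrn// real_normK// num_real.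
Qed.

Let measurable_K : measurable_fun setT (fun w => rnorm (gam 0%N w : R[i]^o) : mR).
Proof.
have := measurable_gauss_sum gamG (fun _ : 'I_1 => 1 : R[i]^o).
by under eq_fun do rewrite big_ord1 [_ *: _]mulr1.
Qed.

Let K_lty : (K < +oo)%E.
Proof.
pose aR w : R := `|complex.Re (gam 0%N w)|.
pose aI w : R := `|complex.Im (gam 0%N w)|.
suff h : (K <= Lnorm P 2%:E (EFin \o aR) + Lnorm P 2%:E (EFin \o aI))%E.
  apply: le_lt_trans h _; rewrite lte_add_pinfty//.
    have := K_part mre law_re; congr (_ < _)%E.
    by rewrite -Lnorm_abse.
  have := K_part mim law_im; congr (_ < _)%E.
  by rewrite -Lnorm_abse.
have mar : measurable_fun setT aR by exact: measurableT_comp mre.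
have mai : measurable_fun setT aI by exact: measurableT_comp mim.
apply: le_trans (minkowski_EFin P mar mai (ler1n R 2)).
apply: le_Lnorm2 => //; first exact: measurable_funD.
have aR0 w : 0 <= aR w by exact: normr_ge0.
have aI0 w : 0 <= aI w by exact: normr_ge0.
move=> w /=; rewrite (ger0_norm (rnorm_ge0 _)) (ger0_norm (addr_ge0 (aR0 w) (aI0 w))).
have : rnorm (gam 0%N w : R[i]^o) ^+ 2 <= (aR w + aI w) ^+ 2.
  rewrite rnorm_nsq /nsq -(real_normK (num_real (complex.Re _))) -/(aR w).
  rewrite -(real_normK (num_real (complex.Im _))) -/(aI w).
  have : 0 <= aR w * aI w by rewrite /aR /aI mulr_ge0.
  by nra.
by rewrite ler_pXn2r// nnegrE ?rnorm_ge0// addr_ge0.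
Qed.

Let K_gt0 : (0 < K)%E.
Proof.
rewrite lt_neqAle Lnorm_ge0 andbT eq_sym; apply/eqP => K0.
have mK : measurable_fun setT (fun w => (rnorm (gam 0%N w : R[i]^o))%:E).
  exact/measurable_EFinP.
have /(_ (ltr0n _ _) K0) := @Lnorm_eq0_eq0 _ _ _ P _ 2%:E mK.
case=> A [mA PA sA].
have Z : P ((fun w => complex.Re (gam 0%N w) : mR) @^-1` [set 0]) = 0%E.
  rewrite law_re//.
  have /null_content_dominatesP h := @normal_prob_dominates R 0 sg.
  by apply: h; [exact: measurable_set1|exact: lebesgue_measure_set1].
set Z0 := (_ @^-1` _) in Z.
have mZ : measurable Z0 by rewrite -[X in measurable X]setTI; exact: mre.
have : (P (A `|` Z0) <= 0)%E.
  apply: le_trans (measureU2 _ mA mZ) _.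
  by rewrite [X in (X + _)%E](PA : P A = 0%E) add0e [leLHS](Z : P Z0 = 0%E).
rewrite (_ : A `|` Z0 = setT) ?probability_setT ?lee_fin ?ler10//.
apply/seteqP; split => // w _; have [wA|wA] := pselect (A w); [by left|right].
have : rnorm (gam 0%N w : R[i]^o) = 0.
  by apply: contrapT => h; apply: wA; apply: sA => /= /(_ I) [].
by move=> /rnorm0_eq0; rewrite /Z0 /= => ->.
Qed.

Lemma gauss_norm_single : exists2 k : R, 0 < k &
  forall (X : normedModType R[i]) (x : X), gnorm (fun _ : 'I_1 => x) = (k * rnorm x)%:E.
Proof.
have Kfin : K \is a fin_num by rewrite ge0_fin_numE ?Lnorm_ge0.
exists (fine K); first by rewrite fine_gt0// K_gt0.
move=> X x; rewrite EFinM fineK// muleC -Lnorm2Z ?rnorm_ge0//.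
by apply: eq_Lnorm => w; rewrite big_ord1 rnormZ mulrC.
Qed.

End gauss_norm_single.

Section gauss_norm_bounds.
Context d (Sigma : measurableType d) (R : realType) (P : probability Sigma R).
Variable gam : nat -> Sigma -> R[i].
Hypothesis gamG : gaussian_sequence P gam.
Context (X : normedModType R[i]).
Notation gnorm := (gauss_norm P gam).
Variable k0 : R.
Hypothesis k00 : 0 < k0.
Hypothesis single : forall (x : X), gnorm (fun _ : 'I_1 => x) = (k0 * rnorm x)%:E.

Lemma rnorm_le_gauss_norm n (x : 'I_n -> X) k : ((k0 * rnorm (x k))%:E <= gnorm x)%E.
Proof.
rewrite -single.
have -> : gnorm (fun _ : 'I_1 => x k) =
    gnorm (fun i : 'I_1 => \sum_(j < n) (j == k)%:R *: x j).
  apply: eq_gauss_norm => i.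
  by rewrite (bigD1 k)//= eqxx scale1r big1 ?addr0// => j /negbTE ->; rewrite scale0r.
apply: (gauss_norm_contraction gamG (A := fun _ j => (j == k)%:R)) => z.
rewrite big_ord1 (bigD1 k)//= eqxx mul1r big1 ?addr0; last first.
  by move=> j /negbTE ->; rewrite mul0r.
by rewrite (bigD1 k)//= lerDl sumr_ge0// => j _; exact: nsq_ge0.
Qed.

Lemma gauss_norm_le_sum n (x : 'I_n -> X) : (gnorm x <= (k0 * \sum_(k < n) rnorm (x k))%:E)%E.
Proof.
pose y (s : seq 'I_n) k := \sum_(j <- s) (k == j)%:R *: x j.
have -> : gnorm x = gnorm (y (enum 'I_n)).
  apply: eq_gauss_norm => i; rewrite /y big_enum /= (bigD1 i)//= eqxx scale1r.
  by rewrite big1 ?addr0// => j; rewrite eq_sym => /negbTE ->; rewrite scale0r.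
rewrite -[X in (k0 * X)%:E]big_enum /=; elim: (enum 'I_n) => [|j s IH].
  rewrite big_nil mulr0 (_ : gnorm _ = 0%E)//.
  rewrite (eq_gauss_norm P gam (y := fun=> 0 *: 0)); last by move=> k; rewrite /y big_nil scaler0.
  by rewrite gauss_normZ// rnorm0 mul0e.
rewrite big_cons mulrDr EFinD.
rewrite (eq_gauss_norm P gam (y := fun k => (k == j)%:R *: x j + y s k)); last first.
  by move=> k; rewrite /y big_cons.
apply: le_trans (gauss_normD gamG _ _) _; apply: leeD => //.
rewrite -single.
rewrite (eq_gauss_norm P gam (y := fun k => \sum_(i < 1) (k == j)%:R *: (fun _ : 'I_1 =>
  x j) i)); last first.
  by move=> k; rewrite big_ord1.
apply: (gauss_norm_contraction gamG (A := fun k _ => (k == j)%:R)) => z.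
rewrite big_ord1 (bigD1 j)//= big_ord1 eqxx mul1r big1 ?addr0// => i /negbTE ->.
by rewrite big_ord1 mul0r /nsq /= expr0n addr0.
Qed.

Lemma gauss_norm_lty n (x : 'I_n -> X) : (gnorm x < +oo)%E.
Proof. exact: le_lt_trans (gauss_norm_le_sum x) (ltry _). Qed.

Lemma gauss_norm_fin_num n (x : 'I_n -> X) : gnorm x \is a fin_num.
Proof. by rewrite ge0_fin_numE ?gauss_norm_ge0 ?gauss_norm_lty. Qed.

Lemma gauss_dual_norm_ge0 n (phi : 'I_n -> dual X) : (0 <= gauss_dual_norm P gam phi)%E.
Proof.
apply: ereal_sup_ubound; exists (fun=> 0) => /=.
  apply: le_trans (gauss_norm_le_sum _) _.
  by rewrite big1 ?mulr0 ?lee_fin// => k _; rewrite rnorm0.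
by rewrite big1 ?rnorm0// => k _; rewrite linear0.
Qed.

Lemma gauss_dual_norm_lty n (phi : 'I_n -> dual X) : (gauss_dual_norm P gam phi < +oo)%E.
Proof.
apply: (@le_lt_trans _ _ ((\sum_(k < n) opnorm (phi k)) / k0)%:E); last exact: ltry.
apply: ge_ereal_sup => _ [x /= x1 <-]; rewrite lee_fin (le_trans (rnorm_sum _))//.
rewrite mulr_suml ler_sum// => k _; apply: (le_trans (opnormP _ _)).
rewrite ler_wpM2l ?opnorm_ge0// -[leRHS]mul1r ler_pdivlMr// mulrC -lee_fin.
exact: le_trans (rnorm_le_gauss_norm x k) x1.
Qed.

Lemma gauss_dual_norm_fin_num n (phi : 'I_n -> dual X) : gauss_dual_norm P gam phi \is a fin_num.
Proof. by rewrite ge0_fin_numE ?gauss_dual_norm_ge0 ?gauss_dual_norm_lty. Qed.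

Lemma gauss_trace_le n (phi : 'I_n -> dual X) (x : 'I_n -> X) :
  ((rnorm (\sum_(k < n) phi k (x k)))%:E <= gauss_dual_norm P gam phi * gnorm x)%E.
Proof.
have xf := gauss_norm_fin_num x; have pf := gauss_dual_norm_fin_num phi.
set a := fine (gnorm x); have aE : gnorm x = a%:E by rewrite fineK.
have [a0|a0] := eqVneq a 0.
  have x0 k : x k = 0.
    apply: rnorm0_eq0; apply/eqP; rewrite eq_le rnorm_ge0 andbT.
    have := rnorm_le_gauss_norm x k; rewrite aE a0 lee_fin.
    by rewrite pmulr_rle0.
  by rewrite aE a0 mule0 big1 ?rnorm0// => k _; rewrite x0 linear0.
have ap : 0 < a by rewrite lt_neqAle eq_sym a0 -lee_fin -aE gauss_norm_ge0.
rewrite aE -(fineK pf) -EFinM lee_fin -ler_pdivrMr//.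
rewrite -lee_fin fineK//; apply: ereal_sup_ubound.
exists (fun k => (a^-1)%:C *: x k) => /=.
  rewrite gauss_normZ// rnorm_real ger0_norm ?invr_ge0 ?(ltW ap)//.
  by rewrite aE -EFinM mulVf.
congr _%:E; rewrite mulrC -[in RHS](ger0_norm (ltW _ : 0 <= a^-1)) ?invr_gt0//.
by rewrite -rnorm_rscale scaler_sumr; congr rnorm; apply: eq_bigr => k _; rewrite linearZ.
Qed.

End gauss_norm_bounds.

(** * Hahn-Banach duality *)

Section hahn_banach.
Context {R : realType} (V : lmodType R[i]) (p : V -> R).
Hypothesis pD : forall x y, p (x + y) <= p x + p y.
Hypothesis pZ : forall (a : R[i]) x, p (a *: x) = rnorm (a : R[i]^o) * p x.

Let pZr (a : R) x : 0 <= a -> p (a%:C *: x) = a * p x.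
Proof. by move=> a0; rewrite pZ rnorm_real ger0_norm. Qed.

Let p0 : p 0 = 0.
Proof. by rewrite -(scale0r 0) pZ rnorm0 mul0r. Qed.

Let pN x : p (- x) = p x.
Proof. by rewrite -scaleN1r pZ /rnorm normrN normr1 mul1r. Qed.

Let p_ge0 x : 0 <= p x.
Proof. by have := pD x (- x); rewrite subrr p0 pN; lra. Qed.

(* Partially defined real-linear functionals are represented by their graphs. *)
Let graph_linear (G : set (V * R)) := forall (a : R) z1 z2, G z1 -> G z2 ->
  G (a%:C *: z1.1 + z2.1, a * z1.2 + z2.2).

Let dominated (y : V) (G : set (V * R)) :=
  [/\ graph_linear G, (forall z, G z -> z.2 <= p z.1) &
      (G !=set0 -> G (y, p y))].

Let graph0 G z : graph_linear G -> G z -> G (0, 0).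
Proof.
move=> lG Gz; have := lG (-1) _ _ Gz Gz.
by rewrite rmorphN rmorph1 scaleN1r mulN1r !addNr.
Qed.

Let graphZ G (a : R) z : graph_linear G -> G z -> G (a%:C *: z.1, a * z.2).
Proof. by move=> lG Gz; have := lG a _ _ Gz (graph0 lG Gz); rewrite !addr0. Qed.

Let graph_fun y G x r s : dominated y G -> G (x, r) -> G (x, s) -> r = s.
Proof.
have le r' s' : dominated y G -> G (x, r') -> G (x, s') -> s' <= r'.
  move=> [lG bG _] Gr Gs.
  have := bG _ (lG (-1) _ _ Gr Gs); rewrite /= rmorphN rmorph1 scaleN1r addNr p0; lra.
by move=> dG Gr Gs; apply/eqP; rewrite eq_le !le.
Qed.

Let dominated_line y : dominated y [set z | exists t : R, z = (t%:C *: y, t * p y)].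
Proof.
split.
- move=> a _ _ [t ->] [s ->]; exists (a * t + s); congr (_, _) => /=.
    by rewrite scalerA -scalerDl rmorphD rmorphM.
  by rewrite mulrDl mulrA.
- move=> _ [t ->] /=; have [t0|t0] := leP 0 t; first by rewrite pZr.
  by apply: (@le_trans _ _ 0); [rewrite mulr_le0_ge0// ltW|exact: p_ge0].
- by move=> _; exists 1; rewrite scale1r mul1r.
Qed.

Let dominated_extend y G x0 : dominated y G -> G !=set0 ->
  exists c, dominated y
    [set z | exists t : R, exists2 g, G g & z = (g.1 + t%:C *: x0, g.2 + t * c)].
Proof.
move=> dG G0; have [lG bG yG] := dG; have {yG}yG := yG G0.
pose S := [set g.2 - p (g.1 - x0) | g in G].
have ubS g' : G g' -> ubound S (p (g'.1 + x0) - g'.2).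
  move=> Gg' _ [g Gg <-]; rewrite lerBlDr addrAC lerBrDr.
  have := bG _ (lG 1 _ _ Gg Gg'); rewrite /= scale1r mul1r => /le_trans; apply.
  by rewrite (_ : g.1 + g'.1 = (g'.1 + x0) + (g.1 - x0)) ?pD// addrACA subrr addr0 addrC.
have supS : has_sup S.
  by split; [exists ((y, p y).2 - p ((y, p y).1 - x0)); exists (y, p y)|
             exists (p ((y, p y).1 + x0) - (y, p y).2); exact: ubS].
pose c := sup S; exists c.
have c1 g : G g -> g.2 - p (g.1 - x0) <= c.
  by move=> Gg; apply: ub_le_sup; [exact: supS.2|exists g].
have c2 g : G g -> c <= p (g.1 + x0) - g.2.
  by move=> Gg; apply: ge_sup; [exact: supS.1|exact: ubS].
split.
- move=> a _ _ [t [g Gg ->]] [s [h Gh ->]].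
  exists (a * t + s), (a%:C *: g.1 + h.1, a * g.2 + h.2); first exact: lG.
  congr (_, _) => /=; last by ring.
  by rewrite rmorphD rmorphM scalerDl -scalerA scalerDr addrACA.
- move=> _ [t [g Gg ->]] /=.
  have [t0|t0|->] := ltgtP t 0.
  + have tn : 0 < - t by rewrite oppr_gt0.
    have tN : - t != 0 by rewrite gt_eqF.
    have := c1 _ (graphZ (- t)^-1 lG Gg) => /=.
    rewrite -(ler_pM2l tn) mulrBr mulrA mulfV// mul1r.
    have -> : - t * p ((- t)^-1%:C *: g.1 - x0) = p (g.1 + t%:C *: x0).
      rewrite -pZr ?(ltW tn)// scalerBr scalerA -rmorphM mulfV// scale1r.
      by rewrite rmorphN scaleNr opprK.
    lra.
  + have tN : t != 0 by rewrite gt_eqF.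
    have := c2 _ (graphZ t^-1 lG Gg) => /=.
    rewrite -(ler_pM2l t0) mulrBr [t * (_ * _)]mulrA mulfV// mul1r.
    have -> : t * p (t^-1%:C *: g.1 + x0) = p (g.1 + t%:C *: x0).
      by rewrite -pZr ?(ltW t0)// scalerDr scalerA -rmorphM mulfV// scale1r.
    lra.
  + by rewrite scale0r mul0r !addr0; exact: bG.
- by move=> _; exists 0, (y, p y) => //=; rewrite scale0r mul0r !addr0.
Qed.

Let real_functional y : exists f : V -> R,
  [/\ (forall (a : R) u v, f (a%:C *: u + v) = a * f u + f v),
      (forall x, f x <= p x) & f y = p y].
Proof.
have [] := @Zorn_bigcup _ (dominated y).
  move=> F FP tF; split.
  - move=> a z1 z2 [G1 FG1 Gz1] [G2 FG2 Gz2].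
    have [G12|G21] := tF _ _ FG1 FG2.
      by exists G2 => //; have [lG _ _] := FP _ FG2; apply: lG => //; exact: G12.
    by exists G1 => //; have [lG _ _] := FP _ FG1; apply: lG => //; exact: G21.
  - by move=> z [G FG Gz]; have [_ bG _] := FP _ FG; exact: bG.
  - by move=> [z [G FG Gz]]; exists G => //; have [_ _] := FP _ FG; apply; exists z.
move=> G [dG maxG].
have G0 : G !=set0.
  apply/set0P/eqP => G0.
  apply: (maxG _ _ (dominated_line y)); rewrite G0.
  split; first by [].
  by move=> /(_ (y, p y)); apply; exists 1; rewrite scale1r mul1r.
have Gdom x : exists r, G (x, r).
  apply: contrapT => nx.
  have [c dG'] := dominated_extend x dG G0.
  apply: (maxG _ _ dG'); split.
    by move=> g Gg; exists 0, g => //=; rewrite scale0r mul0r !addr0; case: g Gg.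
  move=> sG; apply: nx; exists c; apply: sG.
  have [z Gz] := G0; have [lG _ _] := dG.
  by exists 1, (0, 0); [exact: graph0 lG Gz|rewrite /= scale1r mul1r !add0r].
have [f fG] := choice Gdom; have [lG bG yG] := dG.
exists f; split.
- by move=> a u v; apply: (graph_fun dG (fG _)); exact: lG _ _ _ (fG u) (fG v).
- by move=> x; exact: bG _ (fG x).
- by apply: (graph_fun dG (fG _)); exact: yG.
Qed.

Theorem complex_hahn_banach (y : V) : exists f : V -> R[i],
  [/\ (forall (a : R[i]) u v, f (a *: u + v) = a * f u + f v),
      (forall x, rnorm (f x : R[i]^o) <= p x) & f y = (p y)%:C].
Proof.
have [g [gl gp gy]] := real_functional y.
have gD u v : g (u + v) = g u + g v.
  by have := gl 1 u v; rewrite scale1r mul1r.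
have g0 : g 0 = 0 by have := gD 0 0; rewrite addr0; lra.
have gZ (a : R) u : g (a%:C *: u) = a * g u by have := gl a u 0; rewrite !addr0 g0 addr0.
have gN u : g (- u) = - g u by have := gD u (- u); rewrite subrr g0; lra.
pose I : R[i] := 0 +i* 1.
pose f x : R[i] := g x +i* - g (I *: x).
have fD u v : f (u + v) = f u + f v.
  by rewrite /f scalerDr !gD; apply/eqP; rewrite eq_complex /= opprD !eqxx.
have fZ (a : R[i]) u : f (a *: u) = a * f u.
  case: a => a b.
  have -> : (a +i* b) *: u = a%:C *: u + b%:C *: (I *: u).
    rewrite scalerA -scalerDl; congr (_ *: _).
    by apply/eqP; rewrite eq_complex /=; apply/andP; split; apply/eqP; ring.
  rewrite fD; apply/eqP; rewrite eq_complex /f /=.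
  have II : I *: (I *: u) = - u.
    rewrite scalerA -scaleN1r; congr (_ *: _).
    by apply/eqP; rewrite eq_complex /=; apply/andP; split; apply/eqP; ring.
  have IZ (c : R) v : I *: (c%:C *: v) = c%:C *: (I *: v) by rewrite !scalerA mulrC.
  by rewrite !IZ II !gZ gN; apply/andP; split; apply/eqP; ring.
have fp x : rnorm (f x : R[i]^o) <= p x.
  have [fx0|fx0] := eqVneq (f x) 0; first by rewrite fx0 rnorm0.
  set r := rnorm (f x : R[i]^o).
  have r0 : r != 0 by apply: contra_neq fx0 => /rnorm0_eq0.
  have rE : (r%:C : R[i]) = `|f x| by rewrite /r (rnormE (f x : R[i]^o)).
  have fr : f ((r%:C / f x) *: x) = r%:C by rewrite fZ divfK.
  have <- : g ((r%:C / f x) *: x) = r by have /(congr1 (@complex.Re R)) := fr.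
  apply: le_trans (gp _) _; rewrite pZ.
  suff -> : rnorm (r%:C / f x : R[i]^o) = 1 by rewrite mul1r.
  by rewrite /rnorm normrM rE normr_id normrV ?unitfE// mulfV ?normr_eq0.
exists f; split => //; first by move=> a u v; rewrite fD fZ.
have fy : complex.Re (f y) = p y by rewrite -gy.
have : nsq (f y) <= p y ^+ 2.
  rewrite -rnorm_nsq ler_pXn2r// ?nnegrE ?rnorm_ge0//.
rewrite /nsq fy gerDl => im0.
apply/eqP; rewrite eq_complex fy eqxx /= -sqrf_eq0 eq_le sqr_ge0 andbT.
exact: im0.
Qed.

End hahn_banach.

Section norming.
Context {R : realType} (X : normedModType R[i]).

Lemma dual_norming (x : X) : exists2 phi : dual X,
  (forall y, rnorm (phi y) <= rnorm y) & phi x = (rnorm x)%:C.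
Proof.
have [f [fl fp fx]] := @complex_hahn_banach R X rnorm (@rnormD _ _) (@rnormZ _ _) x.
have fb : (f : X -> R[i]^o) \in @is_bounded_op R X R[i]^o.
  by apply/asboolP; split; [exact: fl|exists 1 => y; rewrite mul1r].
by exists (Bop fb).
Qed.

Lemma dual_separates (x y : X) : (forall phi : dual X, phi x = phi y) -> x = y.
Proof.
move=> xy; have [phi _ phix] := dual_norming (x - y).
apply/eqP; rewrite -subr_eq0; apply/eqP/rnorm0_eq0.
by move: phix; rewrite linearB /= (xy phi) subrr => /(congr1 (@complex.Re R)).
Qed.

End norming.

Section gauss_norming.
Context d (Sigma : measurableType d) (R : realType) (P : probability Sigma R).
Variable gam : nat -> Sigma -> R[i].
Hypothesis gamG : gaussian_sequence P gam.
Context (X : normedModType R[i]).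
Notation gnorm := (gauss_norm P gam).

Lemma gauss_norming n (y : 'I_n -> X) : exists2 phi : 'I_n -> dual X,
  (gauss_dual_norm P gam phi <= 1)%E &
  gnorm y = (rnorm (\sum_(k < n) phi k (y k)))%:E.
Proof.
have [k0 k00 single] := gauss_norm_single gamG.
have fin n' (x : 'I_n' -> X) : gnorm x \is a fin_num.
  exact: (gauss_norm_fin_num gamG (single X)).
pose p (x : 'I_n -> X) : R := fine (gnorm x).
have pE x : gnorm x = (p x)%:E by rewrite fineK.
have pD x z : p (x + z) <= p x + p z.
  by rewrite -lee_fin EFinD -!pE; exact: gauss_normD.
have pZ (a : R[i]) x : p (a *: x) = rnorm (a : R[i]^o) * p x.
  by apply: EFin_inj; rewrite EFinM -!pE; exact: gauss_normZ.
have [f [fl fp fy]] := complex_hahn_banach pD pZ y.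
have f0 : f 0 = 0.
  have := fl 1 0 0; rewrite scaler0 addr0 mul1r => /eqP.
  by rewrite -subr_eq subrr eq_sym => /eqP.
have fD u v : f (u + v) = f u + f v by have := fl 1 u v; rewrite scale1r mul1r.
have fZ (a : R[i]) u : f (a *: u) = a * f u by have := fl a u 0; rewrite !addr0 f0 addr0.
pose e (k : 'I_n) (x : X) : 'I_n -> X := fun j => if j == k then x else 0.
have el k a u v : e k (a *: u + v) = a *: e k u + e k v.
  apply/funext => j; rewrite /e.
  change ((if j == k then a *: u + v else 0) = a *: (if j == k then u else 0) + (if j == k then
    v else 0)).
  by case: (j == k) => //; rewrite scaler0 addr0.
have pe k x : p (e k x) <= k0 * rnorm x.
  rewrite -lee_fin -pE; apply: (le_trans (gauss_norm_le_sum gamG (single X) _)).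
  rewrite lee_fin ler_pM2l// (bigD1 k)//= /e eqxx big1 ?addr0// => j /negbTE ->.
  by rewrite rnorm0.
have fb k : (fun x => f (e k x) : R[i]^o) \in @is_bounded_op R X R[i]^o.
  apply/asboolP; split; first by move=> a u v; rewrite el fl.
  by exists k0 => x; apply: le_trans (fp _) (pe k x).
have fsum x : \sum_(k < n) f (e k (x k)) = f x.
  have -> : f x = f (\sum_(k < n) e k (x k)).
    congr f; apply/funext => j; rewrite fct_sumE (bigD1 j)//= {1}/e eqxx big1 ?addr0//.
    by move=> k; rewrite /e eq_sym => /negbTE ->.
  by elim/big_rec2 : _ => [|k a b _ ->]; rewrite ?f0 ?fD.
exists (fun k => Bop (fb k)).
  apply: ge_ereal_sup => _ [x /= x1 <-]; rewrite fsum; apply: le_trans x1.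
  by rewrite pE lee_fin.
rewrite fsum fy pE; congr _%:E.
by rewrite rnorm_real ger0_norm// -lee_fin -pE gauss_norm_ge0.
Qed.

End gauss_norming.

Section completeness.
Context {R : realType}.

Definition rconverges (X : normedModType R[i]) (u : nat -> X) (l : X) :=
  forall e : R, 0 < e -> exists N, forall n, (N <= n)%N -> rnorm (u n - l) <= e.

Lemma rconverges_complete (X : completeNormedModType R[i]) (u : nat -> X) :
  (forall e : R, 0 < e -> exists N, forall n m, (N <= n <= m)%N -> rnorm (u m - u n) <= e) ->
  exists l, rconverges u l.
Proof.
move=> cu.
have rnorm_lt (x : X) (e : R[i]) : 0 < e -> (`|x| < e) = (rnorm x < complex.Re e).
  by rewrite -rnormE; case: e => a b; rewrite !ltcE /= => /andP[/eqP -> _]; rewrite eqxx.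
have : cvg (u @ \oo).
  apply: cauchy_cvg; apply: cauchy_exP => e e0.
  have e0' : 0 < complex.Re e by move: e0; rewrite ltcE => /andP[_].
  have [N uN] := cu (complex.Re e / 2) (divr_gt0 e0' (ltr0n _ 2)).
  exists (u N); exists N => // n Nn; rewrite /= -ball_normE /= rnorm_lt// rnormB_sym.
  by apply: (le_lt_trans (uN N n _)); [rewrite leqnn|lra].
move=> /cvg_ex[l ul]; exists l => e e0.
have eC : 0 < e%:C by rewrite ltcR.
have /cvgrPdist_lt/(_ _ eC)[N _ uN] := ul.
exists N => n Nn; rewrite rnormB_sym ltW//.
by have := uN n Nn; rewrite /= rnorm_lt.
Qed.

Lemma rconverges_unique (X : normedModType R[i]) (u : nat -> X) l l' :
  rconverges u l -> rconverges u l' -> l = l'.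
Proof.
move=> ul ul'; apply/eqP; rewrite -subr_eq0; apply/eqP/rnorm0_eq0/eqP.
rewrite eq_le rnorm_ge0 andbT; apply/ler_addgt0Pl => e e0; rewrite addr0.
have [N uN] := ul _ (divr_gt0 e0 (ltr0n _ 2)); have [N' uN'] := ul' _ (divr_gt0 e0 (ltr0n _ 2)).
have := uN (maxn N N') (leq_maxl _ _); have := uN' (maxn N N') (leq_maxr _ _).
rewrite (rnormB_sym _ l) => h1 h2.
have := rnormD (l - u (maxn N N')) (u (maxn N N') - l'); rewrite addrA subrK; lra.
Qed.

Lemma rconverges_le (X : normedModType R[i]) (u : nat -> X) l M :
  rconverges u l -> (exists N, forall n, (N <= n)%N -> rnorm (u n) <= M) -> rnorm l <= M.
Proof.
move=> ul [N uM]; apply/ler_addgt0Pl => e e0; have [N' uN'] := ul _ e0.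
have := uN' (maxn N N') (leq_maxr _ _); have := uM (maxn N N') (leq_maxl _ _).
rewrite rnormB_sym => h1 h2.
have := rnormD (l - u (maxn N N')) (u (maxn N N')); rewrite subrK; lra.
Qed.

End completeness.

(** * Resolvents and the spectral radius formula *)

Section bop_ring.
Context {R : realType} (X : normedModType R[i]).
Implicit Types S T U : bop X X.

Let bcompA : associative (fun S T : bop X X => bop_comp S T).
Proof. by move=> S T U; exact: bop_ext. Qed.
Let bcomp1l : left_id (@bop_id R X) (fun S T : bop X X => bop_comp S T).
Proof. by move=> S; exact: bop_ext. Qed.
Let bcomp1r : right_id (@bop_id R X) (fun S T : bop X X => bop_comp S T).
Proof. by move=> S; exact: bop_ext. Qed.
Let bcompDl : left_distributive (fun S T : bop X X => bop_comp S T) +%R.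
Proof. by move=> S T U; exact: bop_ext. Qed.
Let bcompDr : right_distributive (fun S T : bop X X => bop_comp S T) +%R.
Proof. by move=> S T U; apply: bop_ext => x; exact: (linearD S). Qed.

HB.instance Definition _ :=
  GRing.Zmodule_isPzRing.Build (bop X X) bcompA bcomp1l bcomp1r bcompDl bcompDr.

Lemma bop_scaleE (a : R[i]) S x : (a *: S) x = a *: S x. Proof. by []. Qed.
Lemma bop_addE S T x : (S + T) x = S x + T x. Proof. by []. Qed.
Lemma bop_oppE S x : (- S) x = - S x. Proof. by []. Qed.
Lemma bop_mulE S T x : (S * T) x = S (T x). Proof. by []. Qed.
Lemma bop_oneE x : (1 : bop X X) x = x. Proof. by []. Qed.

Lemma bop_sumE I (r : seq I) (Q : pred I) (F : I -> bop X X) x :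
  (\sum_(i <- r | Q i) F i) x = \sum_(i <- r | Q i) F i x.
Proof. by elim/big_rec2 : _ => // i u v _ <-. Qed.

Lemma bop_powE T n : bop_pow T n = T ^+ n.
Proof.
elim: n => [|n IH]; first by rewrite expr0.
by rewrite exprS -IH.
Qed.

Lemma bop_scaleAl (a : R[i]) S T : (a *: S) * T = a *: (S * T).
Proof. exact: bop_ext. Qed.

Lemma bop_scaleAr (a : R[i]) S T : S * (a *: T) = a *: (S * T).
Proof. by apply: bop_ext => x; change (S (a *: T x) = a *: S (T x)); rewrite linearZ. Qed.

Lemma bop_scaleX (a : R[i]) S n : (a *: S) ^+ n = a ^+ n *: S ^+ n.
Proof.
elim: n => [|n IH]; first by rewrite !expr0 scale1r.
by rewrite !exprS IH bop_scaleAl bop_scaleAr scalerA.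
Qed.

Lemma opnorm_le_mul S (M : R) : 0 <= M ->
  (forall x, rnorm (S x) <= M * rnorm x) -> opnorm S <= M.
Proof.
move=> M0 SM; apply: opnorm_le => x x1; apply: (le_trans (SM x)).
by rewrite -[leRHS]mulr1 ler_wpM2l.
Qed.

Lemma opnorm_triangle S T : opnorm (S + T) <= opnorm S + opnorm T.
Proof. by rewrite -lecR rmorphD /=; exact: opnormD. Qed.

Lemma opnorm0 : opnorm (0 : bop X X) = 0.
Proof.
apply/eqP; rewrite eq_le opnorm_ge0 andbT; apply: opnorm_le_mul => // x.
by rewrite mul0r rnorm0.
Qed.

Lemma opnorm_sum n (F : 'I_n -> bop X X) :
  opnorm (\sum_(i < n) F i) <= \sum_(i < n) opnorm (F i).
Proof.
elim/big_ind2 : _ => //; first by rewrite opnorm0.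
by move=> a b c e ab ce; rewrite (le_trans (opnorm_triangle _ _))// lerD.
Qed.

Lemma opnorm_scale (a : R[i]) S : opnorm (a *: S) = rnorm (a : R[i]^o) * opnorm S.
Proof.
have := opnormZ a S; rewrite -(rnormE (a : R[i]^o)) -rmorphM.
by move=> /(congr1 (@complex.Re R)).
Qed.

Lemma opnormN S : opnorm (- S) = opnorm S.
Proof. by rewrite -scaleN1r opnorm_scale /rnorm normrN normr1 mul1r. Qed.

Lemma opnormB_sym S T : opnorm (S - T) = opnorm (T - S).
Proof. by rewrite -opnormN opprB. Qed.

Lemma opnormM S T : opnorm (S * T) <= opnorm S * opnorm T.
Proof.
apply: opnorm_le_mul => [|x]; first by rewrite mulr_ge0 ?opnorm_ge0.
by rewrite (le_trans (opnormP S (T x)))// -mulrA ler_wpM2l ?opnorm_ge0// opnormP.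
Qed.

Lemma opnorm1 : opnorm (1 : bop X X) <= 1.
Proof. by apply: opnorm_le_mul => // x; rewrite mul1r. Qed.

Lemma opnormX S n : opnorm (S ^+ n) <= opnorm S ^+ n.
Proof.
elim: n => [|n IH]; first by rewrite expr0 opnorm1.
by rewrite !exprS (le_trans (opnormM _ _))// ler_wpM2l ?opnorm_ge0.
Qed.

End bop_ring.

Section resolvent_theory.
Context {R : realType} (X : normedModType R[i]).
Implicit Types S T : bop X X.

Lemma is_resolventE T z S :
  is_resolvent T z S <-> S * (z *: (1 : bop X X) - T) = 1 /\ (z *: (1 : bop X X) - T) * S = 1.
Proof. by []. Qed.

Lemma is_resolvent_inj T z S S' : is_resolvent T z S -> is_resolvent T z S' -> S = S'.
Proof.
move=> /is_resolventE[h1 h2] /is_resolventE[h3 h4].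
by rewrite -[S]mulr1 -h4 mulrA h1 mul1r.
Qed.

Lemma resolvent_eq T z S : is_resolvent T z S -> resolvent z T = S.
Proof.
by move=> h; apply: (@is_resolvent_inj T z) => //; rewrite /resolvent; apply: (xgetPex 0); exists S.
Qed.

Lemma resolventP T z : ~ spectrum T z -> is_resolvent T z (resolvent z T).
Proof.
move=> /contrapT[S hS]; rewrite /resolvent; by apply: (xgetPex 0); exists S.
Qed.

Lemma resolvent_identity T z w S S' : is_resolvent T z S -> is_resolvent T w S' ->
  S' - S = (z - w) *: (S' * S).
Proof.
move=> /is_resolventE[h1 h2] /is_resolventE[h3 h4].
have : S' * ((z *: (1 : bop X X) - T) - (w *: (1 : bop X X) - T)) * S = (z - w) *: (S' * S).
  by rewrite opprB addrA subrK -scalerBl bop_scaleAr mulr1 bop_scaleAl.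
by rewrite mulrBr mulrBl -mulrA h2 mulr1 h3 mul1r.
Qed.

Lemma resolvent_perturb T z w S S' : is_resolvent T z S -> is_resolvent T w S' ->
  rnorm (z - w : R[i]^o) * opnorm S <= 2^-1 -> opnorm S' <= 2 * opnorm S.
Proof.
move=> hS hS' zw; have e := resolvent_identity hS hS'.
have : opnorm S' <= opnorm S + 2^-1 * opnorm S'.
  rewrite -[in leLHS](subrK S S') addrC (le_trans (opnorm_triangle _ _))// lerD2l e.
  rewrite opnorm_scale (le_trans (ler_wpM2l (rnorm_ge0 _) (opnormM _ _)))//.
  by rewrite [opnorm S' * _]mulrC mulrA ler_wpM2r ?opnorm_ge0.
lra.
Qed.

Lemma adjoint_resolvent T z S : is_resolvent T z S ->
  is_resolvent (adjoint T) z (adjoint S).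
Proof.
move=> [h1 h2]; split; apply: bop_ext => phi; apply: bop_ext => x.
  have : phi (z *: S x - T (S x)) = phi x.
    exact: (congr1 (fun U : bop X X => phi (U x)) h2).
  by rewrite linearB linearZ.
have : phi (S (z *: x - T x)) = phi x.
  exact: (congr1 (fun U : bop X X => phi (U x)) h1).
by rewrite !linearB !linearZ.
Qed.

End resolvent_theory.

Section expi.
Context {R : realType}.
Implicit Types s t : R.

Lemma expiD s t : expi (s + t) = expi s * expi t.
Proof.
by apply/eqP; rewrite eq_complex /= cosD sinD eqxx addrC eqxx.
Qed.

Lemma expi0 : expi (0 : R) = 1.
Proof. by apply/eqP; rewrite eq_complex /= cos0 sin0 !eqxx. Qed.

Lemma expiX t n : expi t ^+ n = expi (n%:R * t).
Proof.
elim: n => [|n IH]; first by rewrite expr0 mul0r expi0.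
by rewrite exprS IH -expiD -natr1 mulrDl mul1r addrC.
Qed.

Lemma rnorm_expi t : rnorm (expi t : R[i]^o) = 1.
Proof. by rewrite /rnorm normc_def /= cos2Dsin2 sqrtr1. Qed.

Lemma expi_neq0 t : expi t != 0.
Proof.
apply/eqP => e0; have := rnorm_expi t; rewrite e0 rnorm0 => /eqP.
by rewrite eq_sym oner_eq0.
Qed.

Lemma expiN t : expi (- t) = (expi t)^-1.
Proof.
apply: (mulfI (expi_neq0 t)); rewrite mulfV ?expi_neq0//.
by rewrite -expiD subrr expi0.
Qed.

Lemma expi_2pi : expi (2 * pi) = 1 :> R[i].
Proof.
by apply/eqP; rewrite eq_complex /= mulr_natl cos2pi sin2pi !eqxx.
Qed.

Lemma expi_2pin n : expi (n%:R * (2 * pi)) = 1 :> R[i].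
Proof. by rewrite -expiX expi_2pi expr1n. Qed.

Lemma rnormM (a b : R[i]^o) : rnorm (a * b : R[i]^o) = rnorm a * rnorm b.
Proof. exact: (rnormZ (a : R[i]) b). Qed.

Lemma rnormX (a : R[i]^o) n : rnorm ((a : R[i]) ^+ n : R[i]^o) = rnorm a ^+ n.
Proof.
elim: n => [|n IH]; first by rewrite !expr0 /rnorm normr1.
by rewrite !exprS rnormM IH.
Qed.

Lemma rnorm_le_parts (z : R[i]^o) : rnorm z <= `|complex.Re z| + `|complex.Im z|.
Proof.
have : rnorm z ^+ 2 <= (`|complex.Re z| + `|complex.Im z|) ^+ 2.
  rewrite rnorm_nsq /nsq -(real_normK (num_real (complex.Re z))).
  rewrite -(real_normK (num_real (complex.Im z))).
  have : 0 <= `|complex.Re z| * `|complex.Im z| by rewrite mulr_ge0.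
  by nra.
by rewrite ler_pXn2r// nnegrE ?rnorm_ge0// addr_ge0.
Qed.

Let lip (f f' : R -> R) : (forall x : R, is_derive x (1 : R) f (f' x)) ->
  (forall x, `|f' x| <= 1) -> forall s t, `|f s - f t| <= `|s - t|.
Proof.
move=> df f1.
have main s t : t <= s -> `|f s - f t| <= `|s - t|.
  move=> ts; have [|c _ ->] := @MVT_segment R f f' t s ts (fun x _ => df x).
    by apply: continuous_subspaceT => x; apply: differentiable_continuous;
      apply/derivable1_diffP; have [] := df x.
  by rewrite normrM ler_piMl.
move=> s t; have [|/ltW] := leP t s; first exact: main.
by move=> /main; rewrite distrC (distrC t).
Qed.

Lemma expi_lipschitz s t : rnorm (expi s - expi t : R[i]^o) <= 2 * `|s - t|.
Proof.
apply: le_trans (rnorm_le_parts _) _; rewrite mulr_natl mulr2n lerD//=.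
  apply: (@lip _ (fun x => - sin x)) => x.
  by rewrite normrN ler_norml sin_geN1 sin_le1.
by apply: (@lip _ cos) => x; rewrite ler_norml cos_geN1 cos_le1.
Qed.

Lemma expi_neq1 t : 0 < t < 2 * pi -> expi t != 1.
Proof.
move=> /andP[t0 t2]; apply/eqP => /(congr1 (@complex.Re R)) /=.
have -> : t = t / 2 + t / 2 by lra.
rewrite cosD -!expr2 => h.
have := cos2Dsin2 (t / 2) => h2.
have : 0 < sin (t / 2) by apply: sin_gt0_pi; apply/andP; split; lra.
nra.
Qed.

Lemma expi_root_sum L j : (0 < j < L)%N ->
  \sum_(l < L) expi (l%:R * (2 * pi) / L%:R) ^+ j = 0 :> R[i].
Proof.
move=> /andP[j0 jL].
have L0 : (L%:R : R) != 0 by rewrite pnatr_eq0 -lt0n (leq_trans _ jL).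
pose w : R[i] := expi (j%:R * (2 * pi) / L%:R).
have w1 : w != 1.
  apply: expi_neq1; have pi0 := @pi_gt0 R.
  rewrite divr_gt0 ?mulr_gt0 ?ltr0n//=; last by rewrite (leq_trans _ jL).
  rewrite ltr_pdivrMr ?ltr0n ?(leq_trans _ jL)// mulrC ltr_pM2l ?mulr_gt0//.
  by rewrite ltr_nat.
have wL : w ^+ L = 1.
  by rewrite expiX mulrCA mulfV// mulr1 expi_2pin.
have := subrX1 w L; rewrite wL subrr => /esym/eqP;
  rewrite mulf_eq0 subr_eq0 (negbTE w1)/= => /eqP h.
rewrite -[RHS]h.
apply: eq_bigr => l _; rewrite !expiX; congr expi.
by field.
Qed.

End expi.

Section circle_bound.
Context {R : realType} (X : normedModType R[i]) (T : bop X X).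
Hypothesis Tdisc : spectrum_in_disc T.

Definition cres (r t : R) : bop X X := resolvent (r%:C * expi t) T.

Lemma circle_resolvent r t : 1 < r -> is_resolvent T (r%:C * expi t) (cres r t).
Proof.
move=> r1; apply: resolventP => /Tdisc /=; rewrite normrM.
have -> : `|expi t| = 1 by rewrite -(rnormE (expi t : R[i]^o)) rnorm_expi.
have -> : `|r%:C| = (r%:C : R[i]) by rewrite ger0_norm// lecR; lra.
by rewrite mulr1 lecR; lra.
Qed.

Lemma circle_dist r s t : 0 <= r ->
  rnorm (r%:C * expi s - r%:C * expi t : R[i]^o) <= 2 * r * `|s - t|.
Proof.
move=> r0; rewrite -mulrBr rnormM rnorm_real ger0_norm// [2 * r]mulrC -mulrA.
by rewrite ler_wpM2l// expi_lipschitz.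
Qed.

Lemma opnorm_dist (S S' : bop X X) : `|opnorm S - opnorm S'| <= opnorm (S - S').
Proof.
rewrite ler_norml; apply/andP; split.
  rewrite lerNl opprB lerBlDr opnormB_sym.
  by rewrite -[in leLHS](subrK S S') opnorm_triangle.
by rewrite lerBlDr -[in leLHS](subrK S' S) opnorm_triangle.
Qed.

Lemma circle_bounded r : 1 < r -> exists2 M : R, 0 < M &
  forall t, 0 <= t <= 2 * pi -> opnorm (cres r t) <= M.
Proof.
move=> r1; have r0 : 0 < r by lra.
have cN : continuous (fun t : R => opnorm (cres r t)).
  move=> t; apply/cvgrPdist_le => e e0.
  set N := opnorm (cres r t).
  have N0 : 0 <= N by exact: opnorm_ge0.
  pose K := 4 * r * (N + 1) ^+ 2.
  have K0 : 0 < K.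
    by apply: mulr_gt0; [rewrite mulr_gt0|rewrite exprn_gt0// ltr_wpDl].
  pose dl := Num.min 1 e / K.
  have dl0 : 0 < dl by rewrite divr_gt0// lt_min ltr01.
  near=> s.
  have st : `|t - s| <= dl by near: s; apply/nbhs_ballP; exists dl => // u;
    rewrite /ball /= => /ltW.
  have d := @circle_dist r t s (ltW r0).
  have h1 := circle_resolvent t r1; have h2 := circle_resolvent s r1.
  have stK : `|t - s| * K <= Num.min 1 e by rewrite -ler_pdivlMr.
  have [stK1 stKe] : `|t - s| * K <= 1 /\ `|t - s| * K <= e.
    by split; apply: (le_trans stK); rewrite ge_min lexx ?orbT.
  have ts0 : 0 <= `|t - s| by [].
  set D := `|t - s| in stK1 stKe d ts0 *.
  set zz := rnorm _ in d.
  have zz0 : 0 <= zz by exact: rnorm_ge0.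
  have rD0 : 0 <= r * D by rewrite mulr_ge0// ltW.
  have le2 : opnorm (cres r s) <= 2 * N.
    apply: (resolvent_perturb h1 h2); rewrite -/N -/zz.
    apply: (@le_trans _ _ (2 * r * D * N)); first by rewrite ler_wpM2r.
    have : 0 <= (r * D) * (N ^+ 2 + 1) by rewrite mulr_ge0// addr_ge0// sqr_ge0.
    by rewrite /K in stK1; nra.
  apply: (le_trans (opnorm_dist _ _));
    rewrite opnormB_sym (resolvent_identity h1 h2) opnorm_scale -/zz.
  apply: (@le_trans _ _ (2 * r * D * (2 * N * N))).
    apply: ler_pM => //; first exact: opnorm_ge0.
    apply: (le_trans (opnormM _ _)); rewrite -/N ler_wpM2r//.
  by rewrite /K in stKe; nra.
have pi0 := @pi_ge0 R.
have [||c _ Mc] := @EVT_max R (fun t => opnorm (cres r t)) 0 (2 * pi).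
- by rewrite mulr_ge0.
- exact: continuous_subspaceT.
exists (opnorm (cres r c) + 1); first by rewrite ltr_wpDl ?opnorm_ge0.
move=> t /andP[t0 t2]; apply: (@le_trans _ _ (opnorm (cres r c))); last by rewrite lerDl.
by apply: Mc; rewrite in_itv /= t0.
Unshelve. all: by end_near. Qed.

End circle_bound.

Lemma geometric_small {R : realType} (q e : R) : 0 <= q -> q < 1 -> 0 < e ->
  exists N, forall n, (N <= n)%N -> q ^+ n <= e.
Proof.
move=> q0 q1 e0; have : (fun n => q ^+ n) @ \oo --> (0 : R).
  by apply: cvg_expr; rewrite ger0_norm.
move=> /cvgrPdist_le/(_ e e0)[N _ hN]; exists N => n Nn.
by have := hN n Nn; rewrite /= sub0r normrN ger0_norm// exprn_ge0.
Qed.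

Section spectral_radius.
Context {R : realType} (X : normedModType R[i]) (T : bop X X).
Hypothesis Tdisc : spectrum_in_disc T.
Notation cres := (cres T).

Let good (rho : R) := exists2 K : R, 0 < K & forall n, opnorm (T ^+ n) <= K * rho ^+ n.

Let tt (L l : nat) : R := l%:R * (2 * pi) / L%:R.

Let tt_bound L l : (l < L)%N -> 0 <= tt L l <= 2 * pi.
Proof.
move=> lL; have L0 : (0 : R) < L%:R by rewrite ltr0n (leq_trans _ lL).
have pi0 := @pi_gt0 R; have p2 : 0 < 2 * (pi : R) by rewrite mulr_gt0.
apply/andP; split; first by rewrite divr_ge0// mulr_ge0// ltW.
rewrite ler_pdivrMr// mulrC ler_pM2l//.
by rewrite ler_nat ltnW.
Qed.

Let tt_expi L l j : (0 < L)%N -> (j <= L)%N ->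
  (expi (tt L l))^-1 ^+ j = expi (tt L l) ^+ (L - j).
Proof.
move=> L0 jL; have eL : expi (tt L l) ^+ L = 1.
  rewrite expiX (_ : _ * tt L l = l%:R * (2 * pi)) ?expi_2pin//.
  by rewrite /tt mulrC divfK// pnatr_eq0 -lt0n.
have e0 : expi (tt L l) ^+ j != 0 by rewrite expf_neq0// expi_neq0.
by apply: (mulfI e0); rewrite -exprMn mulfV ?expi_neq0// expr1n -exprD subnKC.
Qed.

(* Summing over the roots of unity gives [avg L r = (1 - A L r)^-1]. *)
Let Q (r t : R) : bop X X := (r%:C * expi t) *: cres r t.
Let avg L (r : R) : bop X X := (L%:R^-1 : R)%:C *: \sum_(l < L) Q r (tt L l).
Let A L (r : R) : bop X X := ((r^-1)%:C ^+ L) *: T ^+ L.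

Let avgE L r : (0 < L)%N -> 1 < r -> avg L r * (1 - A L r) = 1.
Proof.
move=> L0 r1; have r0 : r != 0 by rewrite gt_eqF//; lra.
have rC0 : r%:C != 0 :> R[i] by rewrite (_ : 0 = 0%:C)// (inj_eq (@complexI R)).
have QE l : Q r (tt L l) * (1 - A L r) =
    \sum_(j < L) ((r^-1)%:C ^+ j * (expi (tt L l))^-1 ^+ j) *: T ^+ j.
  set z := r%:C * expi (tt L l).
  have z0 : z != 0 by rewrite mulf_neq0 ?expi_neq0.
  have -> : A L r = (z^-1 *: T) ^+ L.
    rewrite bop_scaleX /A /z; congr (_ *: _).
    by rewrite invfM exprMn tt_expi// subnn expr0 mulr1 fmorphV.
  have -> : 1 - (z^-1 *: T) ^+ L = (1 - z^-1 *: T) * \sum_(j < L) (z^-1 *: T) ^+ j.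
    by rewrite -opprB subrX1 -mulNr opprB.
  rewrite mulrA; have /is_resolventE[h _] := circle_resolvent Tdisc (tt L l) r1.
  have -> : Q r (tt L l) * (1 - z^-1 *: T) = 1.
    rewrite /Q -/z -[RHS]h bop_scaleAl -bop_scaleAr; congr (_ * _).
    by rewrite scalerBr scalerA mulfV// scale1r.
  rewrite mul1r; apply: eq_bigr => j _; rewrite bop_scaleX; congr (_ *: _).
  by rewrite /z invfM exprMn fmorphV.
rewrite /avg bop_scaleAl mulr_suml; under eq_bigr do rewrite QE.
rewrite exchange_big /=.
have LC0 : (L%:R : R) != 0 by rewrite pnatr_eq0 -lt0n.
case: L L0 QE LC0 => // L _ QE LC0.
rewrite big_ord_recl [X in _ + X]big1 ?addr0; last first.
  move=> j _; rewrite -scaler_suml -mulr_sumr.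
  under eq_bigr do rewrite (tt_expi _ (ltn0Sn L) (ltnW (ltn_ord (lift ord0 j)))).
  rewrite expi_root_sum ?mulr0 ?scale0r//.
  by rewrite subn_gt0 ltn_ord /= ltn_subrL.
rewrite -scaler_suml -mulr_sumr /= (eq_bigr (fun=> 1)); last by move=> l _; rewrite expr0.
rewrite sumr_const card_ord !expr0 mul1r scalerA.
have -> : (1 *+ L.+1 : R[i]) = (L.+1%:R)%:C by rewrite rmorph_nat.
by rewrite -rmorphM mulVf// scale1r.
Qed.

Let opnormA L r : 0 < r -> opnorm (A L r) = r^-1 ^+ L * opnorm (T ^+ L).
Proof.
move=> r0; rewrite /A opnorm_scale -rmorphXn /= rnorm_real ger0_norm//.
by rewrite exprn_ge0// invr_ge0 ltW.
Qed.

Let good_of_tail (r : R) L0 : 1 < r ->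
  (forall L, (L0 <= L)%N -> opnorm (T ^+ L) <= 3 * r ^+ L) -> good r.
Proof.
move=> r1 h; pose K := 3 + \sum_(n < L0) opnorm (T ^+ n).
have S0 : 0 <= \sum_(n < L0) opnorm (T ^+ n) by apply: sumr_ge0 => n _; exact: opnorm_ge0.
exists K; first by rewrite /K; lra.
move=> n; have rn : 1 <= r ^+ n by rewrite exprn_ege1 ?ltW.
have [L0n|nL0] := leqP L0 n.
  by apply: (le_trans (h n L0n)); rewrite ler_wpM2r ?(le_trans _ rn)// lerDl.
have : opnorm (T ^+ n) <= K.
  rewrite /K (bigD1 (Ordinal nL0))//= addrCA lerDl addr_ge0// sumr_ge0// => i _.
  exact: opnorm_ge0.
have K0 : 0 <= K by rewrite /K; lra.
move=> /le_trans; apply; by rewrite ler_peMr.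
Qed.

Let le3 (a : R) : a <= 3 / 4 + 3 / 4 * a -> a <= 3.
Proof. by lra. Qed.

Let mul_subr1 (S U : bop X X) : S * (1 - U) = 1 -> S * U = S - 1.
Proof.
by move=> h; apply/eqP; rewrite eq_sym subr_eq -[X in _ + X]h mulrBr mulr1 addrC subrK.
Qed.

Let good_step r0 : 1 < r0 -> exists2 dl, 0 < dl & forall r r' rho,
  `|r - r0| <= dl -> `|r' - r0| <= dl -> 1 < r -> 1 < r' -> 0 < rho < r ->
  good rho -> good r'.
Proof.
move=> r01; have [M M0 Mc] := circle_bounded Tdisc r01.
pose B := 2 * M + (r0 + 1) * (4 * M ^+ 2).
have M2 : 0 < M ^+ 2 by rewrite exprn_gt0.
have B0 : 0 < B.
  by apply: addr_gt0; apply: mulr_gt0 => //; [lra|exact: mulr_gt0].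
pose dl := Num.min 1 (Num.min (2 * M)^-1 (8 * B)^-1).
have dl0 : 0 < dl by rewrite !lt_min ltr01 !invr_gt0 !mulr_gt0.
have dl1 : dl <= 1 by rewrite ge_min lexx.
have dl2 : dl * (2 * M) <= 1.
  by rewrite -ler_pdivlMr ?mulr_gt0// div1r !ge_min lexx !orbT.
have dl3 : dl * (8 * B) <= 1.
  by rewrite -ler_pdivlMr ?mulr_gt0// div1r !ge_min lexx !orbT.
exists dl => // r r' rho hr hr' r1 r'1 /andP[rho0 rhor] [K K0 gK].
have bd s t : `|s - r0| <= dl -> 1 < s -> 0 <= t <= 2 * pi -> opnorm (cres s t) <= 2 * M.
  move=> hs s1 ht.
  have b0 := Mc t ht.
  apply: (@le_trans _ _ (2 * opnorm (cres r0 t))); last by rewrite ler_pM2l.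
  apply: (resolvent_perturb (circle_resolvent Tdisc t r01) (circle_resolvent Tdisc t s1)).
  rewrite -mulrBl -rmorphB rnormM rnorm_expi mulr1 rnorm_real distrC.
  have := opnorm_ge0 (cres r0 t); have := normr_ge0 (s - r0); nra.
have rr' : `|r - r'| <= 2 * dl.
  have := ler_normD (r - r0) (r0 - r'); rewrite addrA subrK (distrC r0); lra.
have Qd t : 0 <= t <= 2 * pi -> opnorm (Q r t - Q r' t) <= 4^-1.
  move=> ht.
  have br := bd r t hr r1 ht; have br' := bd r' t hr' r'1 ht.
  set z := r%:C * expi t; set w := r'%:C * expi t.
  have zw : rnorm (z - w : R[i]^o) = `|r - r'|.
    by rewrite -mulrBl -rmorphB rnormM rnorm_expi mulr1 rnorm_real.
  have w1 : rnorm (w : R[i]^o) <= r0 + 1.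
    rewrite rnormM rnorm_expi mulr1 rnorm_real ger0_norm; last by lra.
    by have := ler_norm (r' - r0); lra.
  have e := resolvent_identity (circle_resolvent Tdisc t r'1) (circle_resolvent Tdisc t r1).
  have -> : Q r t - Q r' t = (z - w) *: cres r t + w *: (cres r t - cres r' t).
    by rewrite /Q -/z -/w scalerBl scalerBr addrA subrK.
  rewrite e; apply: (le_trans (opnorm_triangle _ _)); rewrite !opnorm_scale zw.
  rewrite -/w -/z rnormB_sym zw.
  have m1 := opnormM (cres r t) (cres r' t).
  have o1 := opnorm_ge0 (cres r t); have o2 := opnorm_ge0 (cres r' t).
  have o3 := opnorm_ge0 (cres r t * cres r' t).
  have m2 : opnorm (cres r t * cres r' t) <= 4 * M ^+ 2.
    apply: (le_trans m1); apply: (@le_trans _ _ ((2 * M) * (2 * M))); first exact: ler_pM.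
    by rewrite le_eqVlt; apply/orP; left; apply/eqP; ring.
  have n0 := normr_ge0 (r - r'); have w0 := rnorm_ge0 (w : R[i]^o).
  apply: (@le_trans _ _ (`|r - r'| * B)).
    rewrite /B mulrDr lerD//; first exact: ler_wpM2l.
    rewrite mulrCA ler_wpM2l//; exact: ler_pM.
  apply: (@le_trans _ _ (2 * dl * B)); first by rewrite ler_wpM2r// ltW.
  by move: dl3; nra.
have pd L : (0 < L)%N -> opnorm (avg L r - avg L r') <= 4^-1.
  move=> L0; rewrite /avg -scalerBr -sumrB opnorm_scale rnorm_real ger0_norm ?invr_ge0//.
  have Lp : (0 : R) < L%:R by rewrite ltr0n.
  rewrite mulrC ler_pdivrMr//; apply: (le_trans (opnorm_sum _)).
  apply: (@le_trans _ _ (\sum_(l < L) 4^-1)).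
    by apply: ler_sum => l _; apply: Qd; exact: tt_bound.
  by rewrite sumr_const card_ord mulr_natr.
have rp : 0 < r by lra.
have r'p : 0 < r' by lra.
have [L0 hL0] : exists N, forall n, (N <= n)%N -> (rho / r) ^+ n <= (3 * K)^-1.
  apply: geometric_small; rewrite ?divr_ge0 ?ltW ?invr_gt0 ?mulr_gt0//.
  by rewrite ltr_pdivrMr// mul1r.
apply: (@good_of_tail r' (maxn 1 L0)) => // L; rewrite geq_max => /andP[L1 LL0].
have A1 : opnorm (A L r) <= 3^-1.
  rewrite opnormA//; apply: (@le_trans _ _ (K * (rho / r) ^+ L)).
    rewrite expr_div_n exprVn mulrA [leRHS]mulrC ler_wpM2l ?invr_ge0 ?exprn_ge0 ?(ltW rp)//.
  have := hL0 L LL0; rewrite -(ler_pM2l K0) => /le_trans; apply.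
  by rewrite invfM mulrCA mulfV ?gt_eqF// mulr1.
have e1 := avgE L1 r1; have e2 := avgE L1 r'1.
set p := avg L r in e1; set p' := avg L r' in e2.
have pp' : opnorm (p - p') <= 4^-1 by exact: pd.
have pE : p - 1 = p * A L r by rewrite (mul_subr1 e1).
have p'E : A L r' = (p' - 1) - (p' - 1) * A L r'.
  rewrite mulrBl mul1r.
  rewrite (mul_subr1 e2).
  by rewrite opprB addrC subrK.
have pn : opnorm p <= 1 + opnorm p * 3^-1.
  rewrite -[in leLHS](subrK 1 p) pE addrC (le_trans (opnorm_triangle _ _))// lerD ?opnorm1//.
  by apply: (le_trans (opnormM _ _)); rewrite ler_wpM2l ?opnorm_ge0.
have p1 : opnorm (p - 1) <= 2^-1.
  rewrite pE (le_trans (opnormM _ _))//.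
  apply: (@le_trans _ _ (opnorm p * 3^-1)); first by rewrite ler_wpM2l ?opnorm_ge0.
  lra.
have p'1 : opnorm (p' - 1) <= 3 / 4.
  rewrite -[p'](subrK p) -addrA (le_trans (opnorm_triangle _ _))//.
  by rewrite opnormB_sym; lra.
have A3 : opnorm (A L r') <= 3.
  have h : opnorm (A L r') <= 3 / 4 + 3 / 4 * opnorm (A L r').
    rewrite [in leLHS]p'E (le_trans (opnorm_triangle _ _))// lerD// opnormN.
    by rewrite (le_trans (opnormM _ _))// ler_wpM2r ?opnorm_ge0.
  exact: le3.
move: A3; rewrite opnormA// exprVn ler_pdivrMl ?exprn_gt0//.
by rewrite mulrC.
Qed.

Theorem power_growth (rho : R) : 1 < rho ->
  exists2 K : R, 0 < K & forall n, opnorm (T ^+ n) <= K * rho ^+ n.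
Proof.
have gmono a b : 0 <= a -> a <= b -> good a -> good b.
  move=> a0 ab [K K0 h]; exists K => // n; apply: (le_trans (h n)).
  by rewrite ler_pM2l// lerXn2r// nnegrE// (le_trans a0).
pose S := [set a : R | 1 < a /\ good a].
have S0 : S (opnorm T + 2).
  split; first by have := opnorm_ge0 T; lra.
  exists 1 => // n; rewrite mul1r (le_trans (opnormX _ _))// lerXn2r ?nnegrE ?opnorm_ge0//.
    by rewrite addr_ge0 ?opnorm_ge0.
  by rewrite lerDl.
have iS : has_inf S by split; [exists (opnorm T + 2)|exists 1 => a [a1 _]; exact: ltW].
have small e : inf S < e -> exists2 a, S a & a < e.
  move=> h; have h' : 0 < e - inf S by rewrite subr_gt0.
  by have [a Sa ae] := inf_adherent h' iS; exists a => //; move: ae; rewrite addrC subrK.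
move=> rho1; have [h|h] := ltP (inf S) rho.
  have [a [a1 ga] ar] := small _ h.
  by apply: (gmono a) => //; lra.
have r01 : 1 < inf S by lra.
have [dl dl0 step] := good_step r01.
pose m := Num.min dl ((inf S - 1) / 2).
have m0 : 0 < m by rewrite lt_min dl0 divr_gt0// subr_gt0.
have mdl : m <= dl by rewrite ge_min lexx.
have m2 : m <= (inf S - 1) / 2 by rewrite ge_min lexx orbT.
have [a [a1 ga] ar] : exists2 a, S a & a < inf S + m by apply: small; lra.
have g' : good (inf S - m).
  apply: (step (inf S + m) (inf S - m) a) => //; last 2 first.
  - lra.
  - by apply/andP; split; lra.
  - by rewrite addrC addKr ger0_norm// ltW.
  - by rewrite addrC addKr normrN ger0_norm// ltW.
  - lra.
have : inf S <= inf S - m by apply: ge_inf; [exact: iS.2|split => //; lra].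
lra.
Qed.

End spectral_radius.

Section rconverges_theory.
Context {R : realType}.

Lemma geometric_small_scaled (c q e : R) : 0 <= c -> 0 <= q -> q < 1 -> 0 < e ->
  exists N, forall n, (N <= n)%N -> c * q ^+ n <= e.
Proof.
move=> c0 q0 q1 e0; have c1 : 0 < c + 1 by rewrite ltr_wpDl.
have [N hN] := geometric_small q0 q1 (divr_gt0 e0 c1).
exists N => n Nn; have := hN n Nn; rewrite ler_pdivlMr// => h.
by have := exprn_ge0 n q0; nra.
Qed.

Lemma rconverges_geometric (X : normedModType R[i]) (u : nat -> X) l (c q : R) :
  0 <= q -> q < 1 -> (forall n, rnorm (u n - l) <= c * q ^+ n) -> rconverges u l.
Proof.
move=> q0 q1 ul e e0; have c0 : 0 <= c.
  by have := ul 0%N; rewrite expr0 mulr1; apply: le_trans; exact: rnorm_ge0.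
have [N hN] := geometric_small_scaled c0 q0 q1 e0.
by exists N => n Nn; apply: le_trans (ul n) (hN n Nn).
Qed.

Lemma rconvergesD (X : normedModType R[i]) (u v : nat -> X) l m :
  rconverges u l -> rconverges v m -> rconverges (fun n => u n + v n) (l + m).
Proof.
move=> ul vm e e0; have e20 : 0 < e / 2 by rewrite divr_gt0.
have [N hN] := ul _ e20; have [M hM] := vm _ e20.
exists (maxn N M) => n; rewrite geq_max => /andP[Nn Mn].
rewrite opprD addrACA (le_trans (rnormD _ _))//.
by have := hN n Nn; have := hM n Mn; lra.
Qed.

Lemma rconverges_lipschitz (X Y : normedModType R[i]) (f : X -> Y) (K : R) (u : nat -> X) l :
  0 <= K -> (forall x y, rnorm (f x - f y) <= K * rnorm (x - y)) ->
  rconverges u l -> rconverges (fun n => f (u n)) (f l).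
Proof.
move=> K0 fK ul e e0; have K1 : 0 < K + 1 by rewrite ltr_wpDl.
have [N hN] := ul _ (divr_gt0 e0 K1); exists N => n Nn.
have := hN n Nn; rewrite ler_pdivlMr// => h; have := fK (u n) l.
have := rnorm_ge0 (u n - l); nra.
Qed.

Lemma rconverges_bop (X Y : normedModType R[i]) (f : bop X Y) (u : nat -> X) l :
  rconverges u l -> rconverges (fun n => f (u n)) (f l).
Proof.
apply: (@rconverges_lipschitz _ _ _ (opnorm f)); first exact: opnorm_ge0.
by move=> x y; rewrite -linearB opnormP.
Qed.

Lemma rconvergesZ (X : normedModType R[i]) (a : R[i]) (u : nat -> X) l :
  rconverges u l -> rconverges (fun n => a *: u n) (a *: l).
Proof.
apply: (@rconverges_lipschitz _ _ _ (rnorm (a : R[i]^o))); first exact: rnorm_ge0.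
by move=> x y; rewrite -scalerBr rnormZ.
Qed.

End rconverges_theory.

Section neumann.
Context {R : realType}.

Definition neumann (X : normedModType R[i]) (T : bop X X) (z : R[i]) M : bop X X :=
  \sum_(j < M) z^-1 ^+ j.+1 *: T ^+ j.

Lemma neumannE (X : normedModType R[i]) (T : bop X X) z M : z != 0 ->
  (z *: (1 : bop X X) - T) * neumann T z M = 1 - z^-1 ^+ M *: T ^+ M.
Proof.
move=> z0; elim: M => [|M IH].
  by rewrite /neumann big_ord0 mulr0 !expr0 scale1r subrr.
rewrite /neumann big_ord_recr /= mulrDr IH bop_scaleAr mulrBl bop_scaleAl mul1r scalerBr scalerA.
rewrite -[T * T ^+ M]exprS. rewrite [_ * z](_ : _ = z^-1 ^+ M); last by rewrite mulrC exprS mulVKf.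
by rewrite addrA subrK.
Qed.

Lemma neumann_comm (X : normedModType R[i]) (T : bop X X) z M : z != 0 ->
  neumann T z M * (z *: (1 : bop X X) - T) = 1 - z^-1 ^+ M *: T ^+ M.
Proof.
move=> z0; rewrite -neumannE//.
rewrite mulrBr mulrBl bop_scaleAl bop_scaleAr mul1r mulr1; congr (_ - _).
rewrite /neumann mulr_suml mulr_sumr; apply: eq_bigr => j _.
by rewrite bop_scaleAl bop_scaleAr -exprS -exprSr.
Qed.

Lemma resolvent_neumann (X : normedModType R[i]) (T S : bop X X) z M : z != 0 ->
  is_resolvent T z S -> S - neumann T z M = z^-1 ^+ M *: (S * T ^+ M).
Proof.
move=> z0 /is_resolventE[h _].
have := congr1 (fun U => S * U) (neumannE T M z0); rewrite /= mulrA h mul1r => ->.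
by rewrite mulrBr mulr1 opprB addrC subrK bop_scaleAr.
Qed.

Lemma geometric_sum_le (q : R) n m : 0 <= q -> q < 1 -> (n <= m)%N ->
  \sum_(n <= j < m) q ^+ j <= q ^+ n / (1 - q).
Proof.
move=> q0 q1 nm; have q10 : 0 < 1 - q by rewrite subr_gt0.
rewrite ler_pdivlMr//.
suff -> : (\sum_(n <= j < m) q ^+ j) * (1 - q) = q ^+ n - q ^+ m.
  by rewrite lerBlDr lerDl exprn_ge0.
elim: m nm => [|m IH]; first by rewrite leqn0 => /eqP ->; rewrite big_geq// mul0r subrr.
rewrite leq_eqVlt => /orP[/eqP ->|]; first by rewrite big_geq// mul0r subrr.
by rewrite ltnS => nm; rewrite big_nat_recr//= mulrDl IH// exprSr; ring.
Qed.

Lemma neumann_resolvent (X : completeNormedModType R[i]) (T : bop X X) (K rho : R) z :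
  0 <= K -> 0 <= rho -> (forall n, opnorm (T ^+ n) <= K * rho ^+ n) ->
  rho < rnorm (z : R[i]^o) -> exists S, is_resolvent T z S.
Proof.
move=> K0 rho0 hT hz; set a := rnorm _ in hz.
have a0 : 0 < a by exact: le_lt_trans hz.
have z0 : z != 0 by apply: contraTneq a0 => z0; rewrite /a z0 rnorm0 ltxx.
have ai : rnorm (z^-1 : R[i]^o) = a^-1.
  apply: (mulfI (lt0r_neq0 a0)); rewrite mulfV ?gt_eqF// /a -rnormM mulfV//.
  by rewrite /rnorm normr1.
pose q := rho / a.
have q0 : 0 <= q by rewrite divr_ge0// ltW.
have q1 : q < 1 by rewrite ltr_pdivrMr// mul1r.
have term j x : rnorm ((z^-1 ^+ j.+1 *: T ^+ j) x) <= (K / a * rnorm x) * q ^+ j.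
  rewrite bop_scaleE rnormZ rnormX ai.
  apply: (@le_trans _ _ (a^-1 ^+ j.+1 * (K * rho ^+ j * rnorm x))).
    rewrite ler_wpM2l ?exprn_ge0 ?invr_ge0 ?(ltW a0)//.
    by apply: (le_trans (opnormP _ _)); rewrite ler_wpM2r ?rnorm_ge0.
  by rewrite /q expr_div_n exprS exprVn le_eqVlt; apply/orP; left; apply/eqP; ring.
have dist x n m : (n <= m)%N ->
    rnorm (neumann T z m x - neumann T z n x) <= (K / a * rnorm x) / (1 - q) * q ^+ n.
  move=> nm; rewrite -bop_oppE -bop_addE.
  have -> : neumann T z m - neumann T z n = \sum_(n <= j < m) z^-1 ^+ j.+1 *: T ^+ j.
    by rewrite /neumann -!(big_mkord xpredT (fun j =>
      z^-1 ^+ j.+1 *: T ^+ j)) (big_cat_nat (leq0n n) nm)/= [LHS]addrC addKr.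
  have c0 : 0 <= K / a * rnorm x by rewrite mulr_ge0 ?rnorm_ge0// divr_ge0// ltW.
  apply: (@le_trans _ _ (K / a * rnorm x * \sum_(n <= j < m) q ^+ j)).
    rewrite bop_sumE mulr_sumr; elim/big_ind2 : _ => [|u b v e ub ve|j _]; first by rewrite rnorm0.
      by rewrite (le_trans (rnormD _ _))// lerD.
    exact: term.
  by rewrite -[leRHS]mulrA [(1 - q)^-1 * _]mulrC ler_wpM2l// geometric_sum_le.
have cauchy x : exists l, rconverges (fun n => neumann T z n x) l.
  apply: rconverges_complete => e e0.
  have c0 : 0 <= K / a * rnorm x / (1 - q).
    by rewrite divr_ge0 ?subr_ge0 ?(ltW q1)// mulr_ge0 ?rnorm_ge0// divr_ge0// ltW.
  have [N hN] := geometric_small_scaled c0 q0 q1 e0.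
  by exists N => n m /andP[Nn nm]; exact: le_trans (dist x _ _ nm) (hN n Nn).
have [S hS] := choice cauchy.
have Sl : linear S.
  move=> b x y; apply: (rconverges_unique (hS _)).
  have := rconvergesD (rconvergesZ b (hS x)) (hS y).
  by under eq_fun do rewrite -linearP.
have Sb : exists M : R, forall x, rnorm (S x) <= M * rnorm x.
  exists (K / a / (1 - q)) => x; apply: (rconverges_le (hS x)); exists 0%N => n _.
  have := dist x 0%N n isT; rewrite /neumann big_ord0 subr0 expr0 mulr1.
  by rewrite -!mulrA [rnorm x * _]mulrC.
have Sm : S \in @is_bounded_op R X X by apply/asboolP.
exists (Bop Sm); apply/is_resolventE.
have rem x : rconverges (fun n => (1 - z^-1 ^+ n *: T ^+ n : bop X X) x) x.
  apply: (@rconverges_geometric _ _ _ _ (K * rnorm x) q) => // n.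
  rewrite bop_addE bop_oppE bop_oneE addrC addKr rnormN bop_scaleE rnormZ rnormX ai.
  rewrite /q expr_div_n exprVn.
  apply: (@le_trans _ _ ((a ^+ n)^-1 * (K * rho ^+ n * rnorm x))).
    rewrite ler_wpM2l ?invr_ge0 ?exprn_ge0 ?(ltW a0)//.
    by apply: (le_trans (opnormP _ _)); rewrite ler_wpM2r ?rnorm_ge0.
  by rewrite le_eqVlt; apply/orP; left; apply/eqP; ring.
split; apply: bop_ext => x.
  apply: (rconverges_unique (hS _)); have := rem x.
  by under eq_fun do rewrite -neumann_comm//.
apply: (@rconverges_unique _ _ (fun n => ((z *: (1 : bop X X) - T) * neumann T z n) x)).
  exact: (rconverges_bop (z *: (1 : bop X X) - T) (hS x)).
have := rem x; by under eq_fun do rewrite -neumannE//.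
Qed.

End neumann.

(** * Complex integrals and Bessel's inequality *)

Section cintegral_theory.
Context d (S : measurableType d) (R : realType) (mu : {measure set S -> \bar R}).
Implicit Types f g : S -> R[i].
Notation mR := (measurableTypeR R).
Notation sq := (square_integrable mu).

Definition cmeasurable f := measurable_fun setT (fun s => complex.Re (f s) : mR) /\
  measurable_fun setT (fun s => complex.Im (f s) : mR).

Definition cintegrable f :=
  mu.-integrable setT (EFin \o (fun s => complex.Re (f s))) /\
  mu.-integrable setT (EFin \o (fun s => complex.Im (f s))).

Lemma cintegrable_measurable f : cintegrable f -> cmeasurable f.
Proof.
move=> [f1 f2]; split; apply/measurable_EFinP.
  exact: measurable_int f1.
exact: measurable_int f2.
Qed.

Lemma cintegrableZD (a : R[i]) f g : cintegrable f -> cintegrable g ->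
  cintegrable (fun s => a * f s + g s).
Proof.
move=> [f1 f2] [g1 g2].
have Z (b : R) (u : S -> R) : mu.-integrable setT (EFin \o u) ->
    mu.-integrable setT (EFin \o (fun s => b * u s)).
  move=> iu; have := integrableZl measurableT b iu.
  by apply: eq_integrable => // s _; rewrite /= EFinM.
have D (u v : S -> R) : mu.-integrable setT (EFin \o u) -> mu.-integrable setT (EFin \o v) ->
    mu.-integrable setT (EFin \o (fun s => u s + v s)).
  move=> iu iv; have := integrableD measurableT iu iv.
  by apply: eq_integrable => // s _; rewrite /= EFinD.
split.
  have := D _ _ (D _ _ (Z (complex.Re a) _ f1) (Z (- complex.Im a) _ f2)) g1.
  apply: eq_integrable => // s _ /=; congr _%:E.
  by case: (a) (f s) (g s) => a1 a2 [b1 b2] [c1 c2] /=; ring.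
have := D _ _ (D _ _ (Z (complex.Re a) _ f2) (Z (complex.Im a) _ f1)) g2.
apply: eq_integrable => // s _ /=; congr _%:E.
by case: (a) (f s) (g s) => a1 a2 [b1 b2] [c1 c2] /=; ring.
Qed.

Lemma cintegralZD (a : R[i]) f g : cintegrable f -> cintegrable g ->
  cintegral mu (fun s => a * f s + g s) = a * cintegral mu f + cintegral mu g.
Proof.
move=> [f1 f2] [g1 g2].
have Z (b : R) (u : S -> R) : mu.-integrable setT (EFin \o u) ->
    mu.-integrable setT (EFin \o (fun s => b * u s)).
  move=> iu; have := integrableZl measurableT b iu.
  by apply: eq_integrable => // s _; rewrite /= EFinM.
have L (b c : R) (u v w : S -> R) : mu.-integrable setT (EFin \o u) ->
    mu.-integrable setT (EFin \o v) -> mu.-integrable setT (EFin \o w) ->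
    Rintegral mu setT (fun s => (b * u s + c * v s) + w s) =
    (b * Rintegral mu setT u + c * Rintegral mu setT v) + Rintegral mu setT w.
  move=> iu iv iw; rewrite RintegralD//; last first.
    have := integrableD measurableT (Z b _ iu) (Z c _ iv).
    by apply: eq_integrable => // s _; rewrite /= EFinD.
  by rewrite RintegralD ?RintegralZl//; exact: Z.
rewrite /cintegral; apply/eqP; rewrite eq_complex /=; apply/andP; split; apply/eqP.
  transitivity (Rintegral mu setT (fun s => (complex.Re a * complex.Re (f s) +
     - complex.Im a * complex.Im (f s)) + complex.Re (g s))).
    by apply: eq_Rintegral => s _; case: (a) (f s) (g s) => a1 a2 [b1 b2] [c1 c2] /=; ring.
  by rewrite L//; case: (a) => a1 a2 /=; ring.
transitivity (Rintegral mu setT (fun s => (complex.Re a * complex.Im (f s) +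
   complex.Im a * complex.Re (f s)) + complex.Im (g s))).
  by apply: eq_Rintegral => s _; case: (a) (f s) (g s) => a1 a2 [b1 b2] [c1 c2] /=; ring.
by rewrite L//; case: (a) => a1 a2 /=; ring.
Qed.

Lemma cintegral0 : cintegral mu (fun=> 0) = 0.
Proof.
by rewrite /cintegral /= /Rintegral integral0.
Qed.

Lemma cintegrable0 : cintegrable (fun=> 0).
Proof. by split; exact: integrable0. Qed.

Lemma cintegralZ (a : R[i]) f : cintegrable f ->
  cintegral mu (fun s => a * f s) = a * cintegral mu f.
Proof.
move=> fi; have := cintegralZD a fi cintegrable0; rewrite cintegral0 addr0 => <-.
by congr (cintegral mu _); apply/funext => s; rewrite addr0.
Qed.

Lemma cintegrable_sum n (a : 'I_n -> R[i]) (F : 'I_n -> S -> R[i]) :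
  (forall j, cintegrable (F j)) -> cintegrable (fun s => \sum_(j < n) a j * F j s).
Proof.
elim: n a F => [|n IH] a F iF.
  by under eq_fun do rewrite big_ord0; exact: cintegrable0.
under eq_fun do rewrite big_ord_recl.
by apply: cintegrableZD => //; apply: IH.
Qed.

Lemma cintegral_sum n (a : 'I_n -> R[i]) (F : 'I_n -> S -> R[i]) :
  (forall j, cintegrable (F j)) ->
  cintegral mu (fun s => \sum_(j < n) a j * F j s) = \sum_(j < n) a j * cintegral mu (F j).
Proof.
elim: n a F => [|n IH] a F iF.
  by under eq_fun do rewrite big_ord0; rewrite big_ord0 cintegral0.
under eq_fun do rewrite big_ord_recl.
rewrite big_ord_recl cintegralZD//; last exact: cintegrable_sum.
by rewrite IH.
Qed.

Lemma cintegral_conj f : cintegrable f ->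
  cintegral mu (fun s => (f s)^*) = (cintegral mu f)^*.
Proof.
move=> [f1 f2]; rewrite /cintegral; apply/eqP; rewrite eq_complex /=; apply/andP; split; apply/eqP.
  by apply: eq_Rintegral => s _; case: (f s).
transitivity (Rintegral mu setT (fun s => -1 * complex.Im (f s))).
  by apply: eq_Rintegral => s _; case: (f s) => u v /=; rewrite mulN1r.
by rewrite RintegralZl// mulN1r.
Qed.

Lemma ae_eq_cintegral f g : cmeasurable f -> cmeasurable g ->
  {ae mu, forall s, f s = g s} -> cintegral mu f = cintegral mu g.
Proof.
move=> [f1 f2] [g1 g2] fg; rewrite /cintegral /Rintegral.
congr (fine _ +i* fine _); apply: ae_eq_integral => //;
  try exact/measurable_EFinP; by apply: filterS fg => s -> _.
Qed.

Lemma rnorm_cintegral_le f (G : S -> R) : cmeasurable f ->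
  mu.-integrable setT (EFin \o G) -> (forall s, rnorm (f s : R[i]^o) <= G s) ->
  rnorm (cintegral mu f : R[i]^o) <= 2 * Rintegral mu setT G.
Proof.
move=> [f1 f2] iG fG.
have main (u : S -> R) : measurable_fun setT u -> (forall s, `|u s| <= G s) ->
    `|Rintegral mu setT u| <= Rintegral mu setT G.
  move=> mu' uG; have iu : mu.-integrable setT (EFin \o u).
    apply: le_integrable iG => //; first exact/measurable_EFinP.
    move=> s _ /=; rewrite lee_fin; apply: (le_trans (uG s)); exact: ler_norm.
  apply: (le_trans (le_normr_Rintegral _ iu)) => //.
  by apply: le_Rintegral => //; exact: integrable_norm iu.
apply: (le_trans (rnorm_le_parts _)); rewrite mulr_natl mulr2n lerD//.
  by apply: main => // s; exact: le_trans (parts_le_rnorm _).1 (fG s).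
by apply: main => // s; exact: le_trans (parts_le_rnorm _).2 (fG s).
Qed.

Lemma sq_measurable f : f \in sq -> cmeasurable f.
Proof.
by move=> /andP[/sub_Lfun_mfun f1 /sub_Lfun_mfun f2]; split; [move: f1|move: f2]; rewrite inE.
Qed.

Lemma cintegrable_mul f g : f \in sq -> g \in sq -> cintegrable (fun s => f s * g s).
Proof.
move=> /andP[f1 f2] /andP[g1 g2].
have M (u v : S -> R) : u \in Lfun mu 2%:E -> v \in Lfun mu 2%:E ->
    mu.-integrable setT (EFin \o (fun s => u s * v s)).
  by move=> u2 v2; have /Lfun1_integrable := Lfun2_mul_Lfun1 u2 v2.
have B (u v : S -> R) : mu.-integrable setT (EFin \o u) -> mu.-integrable setT (EFin \o v) ->
    mu.-integrable setT (EFin \o (fun s => u s - v s)).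
  move=> iu iv; have := integrableB measurableT iu iv.
  by apply: eq_integrable => // s _; rewrite /= EFinB.
have D (u v : S -> R) : mu.-integrable setT (EFin \o u) -> mu.-integrable setT (EFin \o v) ->
    mu.-integrable setT (EFin \o (fun s => u s + v s)).
  move=> iu iv; have := integrableD measurableT iu iv.
  by apply: eq_integrable => // s _; rewrite /= EFinD.
split.
  have := B _ _ (M _ _ f1 g1) (M _ _ f2 g2).
  by apply: eq_integrable => // s _ /=; case: (f s) (g s) => a1 a2 [b1 b2].
have := D _ _ (M _ _ f1 g2) (M _ _ f2 g1).
apply: eq_integrable => // s _ /=; case: (f s) (g s) => a1 a2 [b1 b2] /=.
by congr _%:E; ring.
Qed.

Lemma sq_conj f : f \in sq -> (fun s => (f s)^*) \in sq.
Proof.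
move=> /andP[f1 f2]; apply/andP; split.
  by have -> : (fun s => complex.Re (f s)^*) = (fun s => complex.Re (f s))
    by apply/funext => s; case: (f s).
have -> : (fun s => complex.Im (f s)^*) = (-1 : R) *: (fun s => complex.Im (f s)).
  by apply/funext => s; rewrite [RHS]mulN1r; case: (f s).
have [h1 h2] := Lfun_submod_closed mu (lee1n 2).
have := h2 (-1) (fun s => complex.Im (f s)) 0 f2 h1.
by rewrite addr0.
Qed.

Lemma sqD f g : f \in sq -> g \in sq -> (fun s => f s + g s) \in sq.
Proof.
move=> fs gs; have [_ h] := square_integrable_submod_closed mu.
have -> : (fun s => f s + g s) = 1 *: f + g by rewrite scale1r.
exact: h.
Qed.

Lemma sqZ (a : R[i]) f : f \in sq -> (fun s => a * f s) \in sq.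
Proof.
move=> fs; have [h0 h] := square_integrable_submod_closed mu.
have -> : (fun s => a * f s) = a *: f + 0 by rewrite addr0.
exact: h.
Qed.

Lemma sq0 : (fun=> 0) \in sq.
Proof. by have [] := square_integrable_submod_closed mu. Qed.

Lemma sq_sum n (F : 'I_n -> S -> R[i]) : (forall j, F j \in sq) ->
  (fun s => \sum_(j < n) F j s) \in sq.
Proof.
elim: n F => [|n IH] F sF; first by under eq_fun do rewrite big_ord0; exact: sq0.
by under eq_fun do rewrite big_ord_recl; apply: sqD => //; exact: IH.
Qed.

Lemma sq_L2_fun (h : L2 mu) : L2_fun h \in sq.
Proof. exact: L2fun_mem. Qed.

Lemma L2_fun_pi (f : L2fun mu) :
  {ae mu, forall s, L2_fun (\pi_(L2 mu)%qT f) s = f s}.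
Proof.
have : \pi_(L2 mu)%qT (repr (\pi_(L2 mu)%qT f)) = \pi_(L2 mu)%qT f by rewrite reprK.
move=> /eqP; rewrite -Quotient.idealrBE => /asboolP; apply: filterS => s.
by move=> /eqP; rewrite [X in X == _]/(_ - _) subr_eq0 => /eqP.
Qed.

Lemma L2_fun_linear (a : R[i]) (g h : L2 mu) :
  {ae mu, forall s, L2_fun (a *: g + h) s = a * L2_fun g s + L2_fun h s}.
Proof.
have -> : a *: g + h = \pi_(L2 mu)%qT (a *: repr g + repr h).
  by rewrite L2_piD reprK.
exact: L2_fun_pi.
Qed.

Lemma L2_ipE (g h : L2 mu) : L2_ip g h = cintegral mu (fun s => L2_fun g s * (L2_fun h s)^*).
Proof. by []. Qed.

Lemma bessel n (u : 'I_n -> S -> R[i]) (g : S -> R[i]) :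
  (forall j, u j \in sq) ->
  (forall i j, cintegral mu (fun s => u i s * (u j s)^*) = (i == j)%:R) -> g \in sq ->
  \sum_(j < n) nsq (cintegral mu (fun s => u j s * g s)) <=
  complex.Re (cintegral mu (fun s => (g s)^* * g s)).
Proof.
move=> us onu gs; set a := fun j => cintegral mu (fun s => u j s * g s).
rewrite (eq_bigr (fun j => nsq (a j)))//.
have gcs := sq_conj gs.
pose k s := (g s)^* + \sum_(j < n) - (a j)^* * u j s.
have ks : k \in sq by apply: sqD => //; apply: sq_sum => j; exact: sqZ.
have k_mul v : v \in sq -> cintegral mu (fun s => k s * v s) =
    cintegral mu (fun s => (g s)^* * v s) +
    \sum_(j < n) - (a j)^* * cintegral mu (fun s => u j s * v s).
  move=> vs; rewrite -cintegral_sum; last by move=> j; exact: cintegrable_mul.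
  have := @cintegralZD 1 (fun s => (g s)^* * v s)
    (fun s => \sum_(j < n) - (a j)^* * (u j s * v s)).
  rewrite mul1r => <-; [|exact: cintegrable_mul|by apply: cintegrable_sum => j;
    exact: cintegrable_mul].
  congr cintegral; apply/funext => s; rewrite mul1r /k mulrDl mulr_suml; congr (_ + _).
  by apply: eq_bigr => j _; rewrite mulrA.
have k_h j : cintegral mu (fun s => k s * (u j s)^*) = 0.
  rewrite k_mul; last exact: sq_conj.
  rewrite (bigD1 j)//= onu eqxx mulr1 big1 ?addr0; last first.
    by move=> i ij; rewrite onu (negbTE ij) mulr0.
  apply/eqP; rewrite subr_eq0; apply/eqP.
  transitivity (cintegral mu (fun s => (u j s * g s)^*)).
    by congr cintegral; apply/funext => s; rewrite [RHS]rmorphM mulrC.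
  by apply: cintegral_conj; exact: cintegrable_mul.
have kk : cintegral mu (fun s => k s * (k s)^*) = cintegral mu (fun s => k s * g s).
  have -> : (fun s => k s * (k s)^*) =
     (fun s => 1 * (k s * g s) + \sum_(j < n) - a j * (k s * (u j s)^*)).
    apply/funext => s; rewrite {2}/k rmorphD /= conjCK mulrDr mul1r; congr (_ + _).
    rewrite rmorph_sum mulr_sumr; apply: eq_bigr => j _.
    by rewrite rmorphM rmorphN /= conjCK mulrCA.
  rewrite cintegralZD; last 2 first.
  - exact: cintegrable_mul.
  - by apply: cintegrable_sum => j; apply: cintegrable_mul => //; exact: sq_conj.
  rewrite mul1r cintegral_sum; last by move=> j; apply: cintegrable_mul => //; exact: sq_conj.
  by rewrite big1 ?addr0// => j _; rewrite k_h mulr0.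
have E : \sum_(j < n) - (a j)^* * a j = - (\sum_(j < n) nsq (a j))%:C.
  have F (z : R[i]) : - z^* * z = - (nsq z)%:C.
    by apply/eqP; rewrite /nsq; case: z => x y; rewrite eq_complex /=; apply/andP; split;
      apply/eqP; ring.
  rewrite rmorph_sum -sumrN; apply: eq_bigr => j _; exact: F.
have e : cintegral mu (fun s => k s * (k s)^*) =
    cintegral mu (fun s => (g s)^* * g s) - (\sum_(j < n) nsq (a j))%:C.
  by rewrite kk -E; exact: k_mul.
have : 0 <= complex.Re (cintegral mu (fun s => k s * (k s)^*)).
  apply: Rintegral_ge0 => s _; case: (k s) => x y /=.
  by rewrite mulrN opprK addr_ge0// -expr2 sqr_ge0.
by rewrite e; case: (cintegral mu (fun s => (g s)^* * g s)) => x y /=; rewrite subr_ge0.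
Qed.

End cintegral_theory.

Section circle_integral.
Context {R : realType}.
Notation mR := (measurableTypeR R).
Notation leb := (@lebesgue_measure R).
Notation circle := (@circle_measure R).
Notation arc := (`[0, 2 * pi[%classic : set R).

Lemma two_pi_gt0 : 0 < 2 * pi :> R.
Proof. by rewrite mulr_gt0// pi_gt0. Qed.

Lemma circle_measureE (A : set mR) : circle A = ((2 * pi)^-1%:E * leb (A `&` arc))%E.
Proof. by []. Qed.

Lemma circle_measureT : circle setT = 1%E.
Proof.
rewrite circle_measureE setTI lebesgue_measure_itv /= lte_fin two_pi_gt0.
by rewrite oppr0 adde0 -EFinM mulVf// gt_eqF// two_pi_gt0.
Qed.

Lemma ge0_integral_circle (f : mR -> \bar R) :
  measurable_fun setT f -> (forall x, 0 <= f x)%E ->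
  (\int[circle]_x f x = (2 * pi)^-1%:E * \int[leb]_(x in arc) f x)%E.
Proof.
move=> mf f0; rewrite /circle_measure ge0_integral_mscale//.
congr (_ * _)%E.
have marc : measurable (arc : set mR) by exact: measurable_itv.
rewrite (ge0_negligible_integral (measurableC marc))//; last first.
  by change (leb (~` (arc : set mR) `&` arc) = 0%E); rewrite setICl measure0.
rewrite setTD setCK; apply: eq_measure_integral => A mA AD.
by change (leb (A `&` (arc : set mR)) = leb A); rewrite (setIidl AD).
Qed.

Lemma circle_bounded_integrable (f : mR -> R) (M : R) : measurable_fun setT f ->
  (forall x, `|f x| <= M) -> circle.-integrable setT (EFin \o f).
Proof.
move=> mf fM; apply: (@le_integrable _ _ _ _ _ _ _ (EFin \o cst M)) => //.
- exact/measurable_EFinP.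
- move=> x _ /=; rewrite lee_fin; exact: le_trans (fM x) (ler_norm _).
apply/integrableP; split; first exact/measurable_EFinP.
have -> : (\int[circle]_x `|(EFin \o cst M) x| = \int[circle]_x cst `|M|%:E x)%E by [].
by rewrite integral_cst// circle_measureT mule1 ltry.
Qed.

Lemma integral_arc_derivative (F f : R -> R) : continuous f ->
  (forall x : R, is_derive x (1 : R) F (f x)) ->
  (\int[leb]_(x in arc) (f x)%:E = (F (2 * pi) - F 0)%:E)%E.
Proof.
move=> cf dF.
have cF : continuous F.
  by move=> x; apply: differentiable_continuous; apply/derivable1_diffP; have [] := dF x.
rewrite integral_itv_bndo_bndc; last first.
  apply/measurable_EFinP/measurable_funTS; exact: continuous_measurable_fun.
rewrite (@continuous_FTC2 _ _ F) ?EFinB//; first exact: two_pi_gt0.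
- exact: continuous_subspaceT.
- split; first by move=> x _; have [] := dF x.
    exact: cvg_at_right_filter (cF 0).
  exact: cvg_at_left_filter (cF _).
- by move=> x _; rewrite derive1E; apply: derive_val.
Qed.

Let circle_trig (g F : R -> R) : continuous g -> (forall x, `|g x| <= 1) ->
  (forall x : R, is_derive x (1 : R) F (g x)) -> F (2 * pi) = F 0 ->
  Rintegral circle setT g = 0.
Proof.
move=> cg g1 dF F0.
have mg : measurable_fun setT (g : mR -> mR) by exact: continuous_measurable_fun.
have i1 : circle.-integrable setT (EFin \o (cst 1 : mR -> R)).
  by apply: (@circle_bounded_integrable _ 1) => // x; rewrite /= normr1.
have ig : circle.-integrable setT (EFin \o g) by exact: (@circle_bounded_integrable _ 1).
have : Rintegral circle setT (fun x => g x + (cst 1 : mR -> R) x) = 1.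
  rewrite /Rintegral ge0_integral_circle; last 2 first.
  - by apply/measurable_EFinP; exact: measurable_funD.
  - by move=> x; rewrite lee_fin; have := g1 x; rewrite ler_norml /=; lra.
  rewrite (@integral_arc_derivative (fun x => F x + x)) /=.
  - have -> : F (2 * pi) + 2 * pi - (F 0 + 0) = 2 * pi by rewrite F0; ring.
    by rewrite mulVf// gt_eqF// two_pi_gt0.
  - by move=> x; apply: continuousD; [exact: cg|exact: cst_continuous].
rewrite RintegralD// => h.
have h1 : Rintegral circle setT (cst 1 : mR -> R) = 1.
  by rewrite /Rintegral (eq_integral (cst 1%:E))// integral_cst// circle_measureT mule1.
by move: h; rewrite h1; lra.
Qed.

Lemma cintegral_expi (m : R) : m != 0 -> expi (m * (2 * pi)) = 1 ->
  cintegral circle (fun t => expi (m * t)) = 0.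
Proof.
move=> m0 em.
have cm : continuous (fun t : R => m * t) by move=> t; apply: continuousM; [exact: cst_continuous|].
have [ec es] : cos (m * (2 * pi)) = 1 /\ sin (m * (2 * pi)) = 0.
  by split; [have := congr1 (@complex.Re R) em|have := congr1 (@complex.Im R) em].
rewrite /cintegral /=; apply/eqP; rewrite eq_complex /=; apply/andP; split; apply/eqP.
  apply: (@circle_trig _ (fun t => m^-1 * sin (m * t))).
  - by move=> t; apply: continuous_comp; [exact: cm|exact: continuous_cos].
  - by move=> t; exact: cos_max.
  - move=> t; apply: is_derive_eq; rewrite /GRing.scale /=; field.
    done.
  - by rewrite es !mulr0 sin0 mulr0.
apply: (@circle_trig _ (fun t => - m^-1 * cos (m * t))).
- by move=> t; apply: continuous_comp; [exact: cm|exact: continuous_sin].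
- by move=> t; exact: sin_max.
- move=> t; apply: is_derive_eq; rewrite /GRing.scale /=; field.
  done.
- by rewrite ec mulr0 cos0.
Qed.

Lemma cintegral_circle1 : cintegral circle (fun=> 1) = 1.
Proof.
rewrite /cintegral /=; apply/eqP; rewrite eq_complex /=; apply/andP; split; apply/eqP.
  by rewrite /Rintegral (eq_integral (cst 1%:E))// integral_cst// circle_measureT mule1.
by rewrite /Rintegral integral0.
Qed.

Lemma cintegral_expi_ortho (n m : nat) :
  cintegral circle (fun t => expi (n%:R * t) * expi (- m%:R * t)) = (n == m)%:R.
Proof.
have -> : (fun t : R => expi (n%:R * t) * expi (- m%:R * t)) = (fun t => expi ((n%:R - m%:R) * t)).
  by apply/funext => t; rewrite -expiD mulrBl mulNr.
have [->|nm] := eqVneq n m.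
  rewrite subrr (_ : (fun t => _) = (fun=> 1)) ?cintegral_circle1//.
  by apply/funext => t; rewrite mul0r expi0.
apply: cintegral_expi; first by rewrite subr_eq0 eqr_nat.
by rewrite mulrBl expiD expiN !expi_2pin invr1 mulr1.
Qed.

End circle_integral.

Lemma cmeasurable_rnorm d (S : measurableType d) (R : realType) (u : S -> R[i]) : cmeasurable u ->
  measurable_fun setT (fun s => rnorm (u s : R[i]^o) : measurableTypeR R).
Proof.
move=> [m1 m2].
have -> : (fun s => rnorm (u s : R[i]^o) : measurableTypeR R) =
   (fun s => Num.sqrt (complex.Re (u s) ^+ 2 + complex.Im (u s) ^+ 2)).
  by apply/funext => t; rewrite /rnorm normc_def.
apply: measurableT_comp; first exact: continuous_measurable_fun (@sqrt_continuous R).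
by apply: measurable_funD; apply: measurable_funX.
Qed.

Section sq_bounded.
Context d (S : measurableType d) (R : realType) (mu : {measure set S -> \bar R}).
Hypothesis mufin : (mu setT < +oo)%E.
Notation mR := (measurableTypeR R).

Lemma bounded_Lfun2 (f : S -> R) (M : R) : measurable_fun setT (f : S -> mR) ->
  (forall s, `|f s| <= M) -> f \in Lfun mu 2%:E.
Proof.
move=> mf fM; apply/andP; split; first by rewrite inE /=.
rewrite inE /= /finite_norm.
apply: (@le_lt_trans _ _ (Lnorm mu 2%:E (EFin \o cst M))).
  apply: le_Lnorm2 => // s; exact: le_trans (fM s) (ler_norm _).
rewrite Lnorm.unlock /Lnorm.body; apply: poweR_lty.
have -> : (\int[mu]_x `|(EFin \o cst M) x| `^ 2 = \int[mu]_x cst ((`|M| `^ 2)%:E) x)%E by [].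
by rewrite integral_cst// lte_mul_pinfty// lee_fin powR_ge0.
Qed.

Lemma bounded_sq (f : S -> R[i]) (M : R) : cmeasurable f ->
  (forall s, rnorm (f s : R[i]^o) <= M) -> f \in square_integrable mu.
Proof.
move=> [f1 f2] fM; apply/andP.
by split; apply: (@bounded_Lfun2 _ M) => // s; [exact: le_trans (parts_le_rnorm _).1 (fM s)|
  exact: le_trans (parts_le_rnorm _).2 (fM s)].
Qed.

End sq_bounded.

Section circle_ord.
Context {R : realType} (N : nat).
Notation mR := (measurableTypeR R).
Notation circle := (@circle_measure R).
Notation mu := (@circle_ord_measure R N).
Notation ST := (mR * 'I_N.+1)%type.

Lemma measurable_slices d (T : measurableType d) (g : ST -> T) :
  (forall k, measurable_fun setT (fun t : mR => g (t, k))) -> measurable_fun setT g.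
Proof.
move=> mg _ B mB; rewrite setTI.
have -> : g @^-1` B = \bigcup_(k in [set: 'I_N.+1]) (((fun t : mR =>
  g (t, k)) @^-1` B) `*` [set k]).
  apply/seteqP; split=> [[t k] /= h|[t k] [k' _ [/= h ->]] //].
  by exists k.
apply: fin_bigcup_measurable; first exact: finite_finset.
move=> k _; apply: measurableX; last by [].
by have := mg k measurableT B mB; rewrite setTI.
Qed.

Lemma circle_ord_rect (A : set mR) (k : 'I_N.+1) : measurable A ->
  mu (A `*` [set k]) = circle A.
Proof.
move=> mA; rewrite [LHS](product_measure1E circle (@counting_ord R N) mA)//.
transitivity (circle A * 1)%E; last by rewrite mule1.
congr (_ * _)%E; change (counting (set1 k : set 'I_N.+1) = 1%E :> \bar R).
by rewrite /counting asboolT; [rewrite fset_set1 finmap.cardfs1|exact: finite_set1].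
Qed.

Lemma circle_ord_fin : (mu setT < +oo)%E.
Proof.
rewrite -setXTT [X in (X < _)%E](product_measure1E circle (@counting_ord R N))// circle_measureT
  mul1e.
change (counting [set: 'I_N.+1] < +oo :> \bar R)%E.
by rewrite /counting asboolT ?ltry//; exact: finite_finset.
Qed.

Lemma Rintegral_slice (k : 'I_N.+1) (u : mR -> R) : circle.-integrable setT (EFin \o u) ->
  Rintegral mu setT (fun s => (s.2 == k)%:R * u s.1) = Rintegral circle setT u.
Proof.
move=> iu; pose D : set ST := setT `*` [set k].
have mD : measurable D by apply: measurableX.
pose io (t : mR) : ST := (t, k).
have mio : measurable_fun setT io by exact: measurable_fun_pair.
have ioD : io @^-1` D = setT by apply/seteqP; split.
have mu' : measurable_fun setT (fun s : ST => u s.1).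
  have mu0 : measurable_fun setT u by apply/measurable_EFinP; exact: measurable_int iu.
  exact: measurableT_comp mu0 measurable_fst.
congr fine.
transitivity (\int[mu]_(x in D) (u x.1)%:E)%E.
  rewrite [RHS]integral_mkcond; apply: eq_integral => -[t k'] _ /=.
  rewrite patchE /D in_setX in_setT /= in_set1 /=.
  by case: eqP; rewrite ?mul1r ?mul0r.
transitivity (\int[pushforward circle io]_(x in D) (u x.1)%:E)%E.
  apply: eq_measure_integral => B mB BD.
  have BE : B = (io @^-1` B) `*` [set k].
    apply/seteqP; split=> [[t k'] Bs|[t k'] /= [h ->] //].
    by have [_ /= kk] := BD _ Bs; split => //=; rewrite /io /= -kk.
  rewrite [in LHS]BE; apply: circle_ord_rect.
  by rewrite -[X in measurable X]setTI; exact: mio.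
have e A : A = setT -> (\int[circle]_(x in A) (u x)%:E = \int[circle]_x (u x)%:E)%E.
  by move=> ->.
have e' A : A = setT -> circle.-integrable A (EFin \o u) by move=> ->.
have muE : measurable_fun setT (fun s : ST => (u s.1)%:E) by exact/measurable_EFinP.
exact: etrans (integral_pushforward mio muE (e' _ ioD) mD) (e _ ioD).
Qed.

Lemma cintegral_slice (k : 'I_N.+1) (u : mR -> R[i]) : cintegrable circle u ->
  cintegral mu (fun s => (s.2 == k)%:R * u s.1) = cintegral circle u.
Proof.
move=> [u1 u2]; rewrite /cintegral -(Rintegral_slice k u1) -(Rintegral_slice k u2).
congr (_ +i* _); apply: eq_Rintegral => s _; case: (s.2 == k); rewrite ?mul1r ?mul0r//.
Qed.

Lemma continuous_cmeasurable_circle (u : R -> R[i]) :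
  continuous (fun t => complex.Re (u t)) -> continuous (fun t => complex.Im (u t)) ->
  cmeasurable (u : mR -> R[i]).
Proof. by move=> c1 c2; split; exact: continuous_measurable_fun. Qed.

Lemma bounded_cintegrable_circle (u : mR -> R[i]) (M : R) : cmeasurable u ->
  (forall t, rnorm (u t : R[i]^o) <= M) -> cintegrable circle u.
Proof.
move=> mu' uM.
have cf : (circle setT < +oo)%E by rewrite circle_measureT ltry.
have h1 := bounded_sq cf mu' uM.
have h2 : (fun=> 1) \in square_integrable circle.
  apply: (@bounded_sq _ _ _ _ cf _ 1) => [|s]; last by rewrite /rnorm normr1.
  by split.
have := cintegrable_mul h1 h2; by under eq_fun do rewrite mulr1.
Qed.

(* The conjugates of the orthonormal functions [e^{i(n+1)t} (x) delta_k]. *)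
Definition fourier (n : nat) (k : 'I_N.+1) (s : ST) : R[i] :=
  (s.2 == k)%:R * expi (- (n.+1)%:R * s.1).

Lemma cmeasurable_expi (m : R) : cmeasurable (fun t : mR => expi (m * t)).
Proof.
have cm : continuous (fun t : R => m * t) by move=> t; apply: continuousM; [exact: cst_continuous|].
apply: continuous_cmeasurable_circle => t.
  by apply: continuous_comp; [exact: cm|exact: continuous_cos].
by apply: continuous_comp; [exact: cm|exact: continuous_sin].
Qed.

Lemma cmeasurable_slices (g : ST -> R[i]) :
  (forall k, cmeasurable (fun t : mR => g (t, k))) -> cmeasurable g.
Proof. by move=> mg; split; apply: measurable_slices => k; have [] := mg k. Qed.

Lemma cmeasurable_mul d (T : measurableType d) (u v : T -> R[i]) : cmeasurable u -> cmeasurable v ->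
  cmeasurable (fun t => u t * v t).
Proof.
move=> [u1 u2] [v1 v2]; split.
  have -> : (fun s => complex.Re (u s * v s)) =
     (fun s => complex.Re (u s) * complex.Re (v s) - complex.Im (u s) * complex.Im (v s)).
    by apply/funext => s; case: (u s) (v s) => ? ? [? ?].
  by apply: measurable_funB; apply: measurable_funM.
have -> : (fun s => complex.Im (u s * v s)) =
   (fun s => complex.Re (u s) * complex.Im (v s) + complex.Im (u s) * complex.Re (v s)).
  by apply/funext => s; case: (u s) (v s) => ? ? [? ?].
by apply: measurable_funD; apply: measurable_funM.
Qed.

Lemma cmeasurable_cst d (T : measurableType d) (a : R[i]) : cmeasurable (fun _ : T => a).
Proof. by split. Qed.

Lemma rnorm_fourier n k s : rnorm (fourier n k s : R[i]^o) <= 1.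
Proof.
rewrite /fourier rnormM rnorm_expi mulr1; case: (_ == _); first by rewrite /rnorm normr1.
by rewrite rnorm0.
Qed.

Lemma cmeasurable_fourier n k : cmeasurable (fourier n k).
Proof.
apply: cmeasurable_slices => k'; apply: cmeasurable_mul; first exact: cmeasurable_cst.
exact: cmeasurable_expi.
Qed.

Lemma sq_fourier n k : fourier n k \in square_integrable mu.
Proof.
apply: (@bounded_sq _ _ _ _ circle_ord_fin _ 1) => [|s]; first exact: cmeasurable_fourier.
exact: rnorm_fourier.
Qed.

Lemma fourier_ortho n k n' k' :
  cintegral mu (fun s => (fourier n k s)^* * fourier n' k' s) = ((n == n') && (k == k'))%:R.
Proof.
have conjE (t : R) : (expi t)^* = expi (- t).
  by apply/eqP; rewrite eq_complex /= cosN sinN !eqxx.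
have -> : (fun s => (fourier n k s)^* * fourier n' k' s) =
   (fun s => (k == k')%:R * ((s.2 == k)%:R * (expi (n.+1%:R * s.1) * expi (- n'.+1%:R * s.1)))).
  apply/funext => s; rewrite /fourier rmorphM rmorph_nat [X in _ * X * _]conjE -mulNr opprK.
  have [->|kk] := eqVneq k k'; first by case: (s.2 == k'); rewrite ?mul1r ?mul0r.
  case: eqP => [->|_]; last by rewrite !mul0r ?mulr0.
  by rewrite (negbTE kk) !mul0r ?mulr0.
have ci : cintegrable circle (fun t : mR => expi (n.+1%:R * t) * expi (- n'.+1%:R * t)).
  apply: (@bounded_cintegrable_circle _ 1).
    by apply: cmeasurable_mul; exact: cmeasurable_expi.
  by move=> t; rewrite rnormM !rnorm_expi mulr1.
rewrite cintegralZ; last first.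
  have h2 : (fun s : ST => (s.2 == k)%:R * (expi (n.+1%:R * s.1) * expi (- n'.+1%:R * s.1))) \in
    square_integrable mu.
    apply: (@bounded_sq _ _ _ _ circle_ord_fin _ 1) => [|s].
      apply: cmeasurable_slices => k0; apply: cmeasurable_mul; first exact: cmeasurable_cst.
      by apply: cmeasurable_mul; exact: cmeasurable_expi.
    rewrite !rnormM !rnorm_expi !mulr1; case: (_ == _); first by rewrite /rnorm normr1.
    by rewrite rnorm0.
  have h1 : (fun _ : ST => 1) \in square_integrable mu.
    apply: (@bounded_sq _ _ _ _ circle_ord_fin _ 1) => [|s]; last by rewrite /rnorm normr1.
    exact: cmeasurable_cst.
  by have := cintegrable_mul h1 h2; under eq_fun do rewrite mul1r.
rewrite (cintegral_slice k ci) cintegral_expi_ortho eqSS -natrM mulnb.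
by rewrite andbC.
Qed.

End circle_ord.

(** * Resolvents along circles as vector-valued functions *)

Section lipschitz_slices.
Context {R : realType} (N : nat).
Notation mR := (measurableTypeR R).
Notation mu := (@circle_ord_measure R N).
Notation ST := (mR * 'I_N.+1)%type.

Lemma rconverges_cvg (E : normedModType R[i]) (u : nat -> E) l :
  rconverges u l -> u n @[n --> \oo] --> l.
Proof.
move=> ul; apply/cvgrPdist_le => e e0.
have e0' : 0 < complex.Re e by move: e0; rewrite ltcE => /andP[_].
have [M hM] := ul _ e0'; exists M => // n Mn /=.
rewrite -rnormE rnormB_sym; have := hM n Mn.
by move: e0; case: (e) => a b; rewrite ltcE lecE /= => /andP[/eqP -> _] ->; rewrite eqxx.
Qed.

Lemma strongly_measurable_lipschitz (E : normedModType R[i]) (f : ST -> E) (L : R) :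
  0 <= L -> (forall k t t', rnorm (f (t', k) - f (t, k)) <= L * `|t' - t|) ->
  strongly_measurable f.
Proof.
move=> L0 fL.
pose J n (t : mR) : nat := Num.truncn ((t + n%:R) * n.+1%:R).
pose inn n (t : mR) := - n%:R <= t < n%:R.
pose idx n (s : ST) : option (nat * 'I_N.+1) := if inn n s.1 then Some (J n s.1, s.2) else None.
pose F n (o : option (nat * 'I_N.+1)) : E :=
  if o is Some (j, k) then f (j%:R / n.+1%:R - n%:R, k) else 0.
have n10 n : (0 : R) < n.+1%:R by rewrite ltr0n.
have Jb n t : inn n t -> (J n t)%:R <= (t + n%:R) * n.+1%:R < (J n t).+1%:R.
  move=> /andP[t1 _]; apply: truncn_itv; rewrite mulr_ge0//; lra.
have midx n o : measurable (idx n @^-1` [set o]).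
  have marc : measurable (`[- n%:R, n%:R[%classic : set mR) by exact: measurable_itv.
  case: o => [[j k]|].
    have -> : idx n @^-1` [set Some (j, k)] =
       (`[- n%:R, n%:R[%classic `&` `[j%:R / n.+1%:R - n%:R, j.+1%:R / n.+1%:R - n%:R[%classic)
         `*` [set k].
      apply/seteqP; split=> [[t k'] |[t k'] [/= [h1 h2] ->]].
        rewrite /idx /=; case: ifP => // it [<- <-]; split => //=; split => //=.
        have := Jb n t it; rewrite in_itv /= lerBlDr ltrBrDr ler_pdivrMr// ltr_pdivlMr//.
      rewrite /idx /= /inn; move: h1; rewrite in_itv /= => -> ; congr (Some (_, _)).
      apply: truncn_def; move: h2; rewrite in_itv /= lerBlDr ltrBrDr ler_pdivrMr// ltr_pdivlMr//.
    apply: measurableX => //; apply: measurableI => //; exact: measurable_itv.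
  have -> : idx n @^-1` [set None] = ~` `[- n%:R, n%:R[%classic `*` setT.
    apply/seteqP; split=> [[t k']|[t k'] [/= h1 _]]; rewrite /idx /=.
      by case: ifP => // h _; split => //=; rewrite in_itv /= -/(inn n t) h.
    by case: ifP => //; move: h1; rewrite in_itv /= /inn => /negP/negbTE ->.
  by apply: measurableX => //; exact: measurableC.
exists (fun n => F n \o idx n); split.
  move=> n; split.
    pose B := (n + n) * n.+1.
    apply: (@sub_finite_set _ _ ((fun o : option ('I_(B.+1) * 'I_N.+1) =>
        F n (omap (fun p => (val p.1, p.2)) o)) @` setT)); last first.
      by apply: finite_image; exact: finite_finset.
    move=> _ [[t k] _ <-] /=; rewrite /idx /=; case: ifP => it; last by exists None.
    have JB : (J n t < B.+1)%N.
      have /andP[h1 _] := Jb n t it; rewrite ltnS -(ler_nat R); apply: (le_trans h1).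
      rewrite /B natrM natrD ler_pM2r// lerD2r ltW//.
      by have /andP[_] := it.
    by exists (Some (Ordinal JB, k)).
  move=> y.
  have -> : (F n \o idx n) @^-1` [set y] =
      \bigcup_o (if `[< F n o = y >] then idx n @^-1` [set o] else set0).
    apply/seteqP; split=> [s /= h|s [ob _]]; last by case: asboolP => // h /= ->.
    by exists (idx n s) => //; rewrite asboolT.
  apply: countable_bigcupT_measurable; first exact: countableP.
  by move=> o; case: asboolP.
move=> [t k]; apply: rconverges_cvg => e e0.
have [M hM] : exists M : nat, `|t| < M%:R /\ L <= e * M%:R.
  exists (Num.bound (`|t| + L / e)).
  have := archi_boundP (addr_ge0 (normr_ge0 t) (divr_ge0 L0 (ltW e0))) => h.
  have Le : 0 <= L / e by rewrite divr_ge0// ltW.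
  split; first by apply: le_lt_trans h; rewrite lerDl.
  by rewrite mulrC -ler_pdivrMr//; apply: le_trans (ltW h); rewrite lerDr.
have [hM1 hM2] := hM; exists M => n Mn.
have Mn' : (M%:R : R) <= n%:R by rewrite ler_nat.
have it : inn n t.
  by move: hM1; rewrite /inn ltr_norml => /andP[h1 h2]; apply/andP; split; lra.
rewrite /= /idx /= it /F; apply: (le_trans (fL _ _ _)).
have /andP[h1 h2] := Jb n t it.
have d : `|(J n t)%:R / n.+1%:R - n%:R - t| <= n.+1%:R^-1.
  have h3 : t + n%:R <= (J n t)%:R / n.+1%:R + n.+1%:R^-1.
    by rewrite -[X in _ <= _ + X]div1r -mulrDl ler_pdivlMr// natr1 ltW.
  have h4 : (J n t)%:R / n.+1%:R <= t + n%:R by rewrite ler_pdivrMr.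
  have h5 : 0 <= n.+1%:R^-1 :> R by rewrite invr_ge0.
  have gen (a b c e' : R) : c + e' <= a + b -> a <= c + e' -> 0 <= b -> `|a - e' - c| <= b.
    by rewrite ler_norml => *; apply/andP; split; lra.
  exact: gen h3 h4 h5.
apply: (@le_trans _ _ (L * n.+1%:R^-1)); first by rewrite ler_wpM2l.
rewrite ler_pdivrMr//; apply: (le_trans hM2); rewrite ler_pM2l//.
by rewrite ler_nat (leq_trans Mn).
Qed.

Lemma cmeasurable_lipschitz (u : mR -> R[i]) (L : R) : 0 <= L ->
  (forall t t', rnorm (u t' - u t : R[i]^o) <= L * `|t' - t|) -> cmeasurable u.
Proof.
move=> L0 uL.
have main (v : R -> R) : (forall t t', `|v t' - v t| <= L * `|t' - t|) -> continuous v.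
  move=> vL t; apply/cvgrPdist_le => e e0.
  have L1 : 0 < L + 1 by rewrite ltr_wpDl.
  have dl0 : 0 < e / (L + 1) by rewrite divr_gt0.
  near=> t'; apply: (le_trans (vL _ _)).
  have : `|t - t'| <= e / (L + 1).
    by near: t'; apply/nbhs_ballP; exists (e / (L + 1)) => // w; rewrite /ball /= => /ltW.
  rewrite ler_pdivlMr//; have := normr_ge0 (t - t'); nra.
apply: continuous_cmeasurable_circle; apply: main => t t'; apply: le_trans (uL t t').
  by have [+ _] := parts_le_rnorm (u t' - u t); case: (u t') (u t) => ? ? [? ?].
by have [_ +] := parts_le_rnorm (u t' - u t); case: (u t') (u t) => ? ? [? ?].
Unshelve. all: by end_near. Qed.

Lemma weakly_L2_lipschitz (E : normedModType R[i]) (f : ST -> E) (L B : R) :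
  0 <= L -> (forall k t t', rnorm (f (t', k) - f (t, k)) <= L * `|t' - t|) ->
  (forall s, rnorm (f s) <= B) -> weakly_L2 mu f.
Proof.
move=> L0 fL fB phi; have p0 := opnorm_ge0 phi.
apply: (@bounded_sq _ _ _ _ (circle_ord_fin N) _ (opnorm phi * B)).
  apply: cmeasurable_slices => k; apply: (@cmeasurable_lipschitz _ (opnorm phi * L)).
    by rewrite mulr_ge0.
  move=> t t'.
  rewrite [X in rnorm X <= _](_ : _ = phi (f (t', k) - f (t, k))); last by rewrite linearB.
  by apply: (le_trans (opnormP _ _)); rewrite -mulrA ler_wpM2l.
by move=> s; rewrite (le_trans (opnormP _ _))// ler_wpM2l.
Qed.

End lipschitz_slices.

Section resolvent_fun_facts.
Context {R : realType} (E : normedModType R[i]) (T : bop E E).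
Hypothesis Tdisc : spectrum_in_disc T.
Notation cres := (cres T).

Lemma circle_bounded_all r : 1 < r -> exists2 M : R, 0 < M & forall t, opnorm (cres r t) <= M.
Proof.
move=> r1; have [M M0 hM] := circle_bounded Tdisc r1; exists M => // t.
have p0 := @two_pi_gt0 R.
pose j := Num.floor (t / (2 * pi)).
have /andP[j1 j2] : j%:~R <= t / (2 * pi) < (j + 1)%:~R by exact: floor_itv.
pose t' := t - j%:~R * (2 * pi).
have et' : expi t = expi t'.
  have ez (z : int) : expi (z%:~R * (2 * pi)) = 1 :> R[i].
    case: z => n; first exact: expi_2pin.
    by rewrite NegzE mulrNz mulNr expiN expi_2pin invr1.
  by rewrite -[in LHS](subrK (j%:~R * (2 * pi)) t) expiD ez mulr1.
rewrite /cres et' -/(cres r t'); apply: hM; apply/andP; split.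
  by rewrite subr_ge0 -ler_pdivlMr.
rewrite lerBlDr -{1}[2 * pi]mul1r -mulrDl -ler_pdivrMr// ltW// addrC.
by move: j2; rewrite intrD.
Qed.

Lemma cres_lipschitz r : 1 < r -> exists2 L : R, 0 < L &
  forall t t', opnorm (cres r t' - cres r t) <= L * `|t' - t|.
Proof.
move=> r1; have [M M0 hM] := circle_bounded_all r1.
exists (2 * r * (M * M)); first by rewrite !mulr_gt0//; lra.
move=> t t'; have h1 := circle_resolvent Tdisc t r1; have h2 := circle_resolvent Tdisc t' r1.
rewrite (resolvent_identity h1 h2) opnorm_scale.
have d := @circle_dist R r t t' (ltW (lt_trans ltr01 r1)).
rewrite [2 * r * _ * _]mulrAC distrC.
apply: ler_pM => //; [exact: rnorm_ge0|exact: opnorm_ge0|].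
by apply: (le_trans (opnormM _ _)); apply: ler_pM; rewrite ?opnorm_ge0.
Qed.

Lemma resolvent_fun_lipschitz N (r : 'I_N.+1 -> R) (x : 'I_N.+1 -> E) :
  (forall k, 1 < r k) -> exists2 L : R, 0 <= L & forall k t t',
  rnorm (resolvent_fun T r x (t', k) - resolvent_fun T r x (t, k)) <= L * `|t' - t|.
Proof.
move=> r1; have /choice[L hL] : forall k, exists L : R, 0 < L /\
    forall t t', opnorm (cres (r k) t' - cres (r k) t) <= L * `|t' - t|.
  by move=> k; have [L L0 hL] := cres_lipschitz (r1 k); exists L.
pose A k := Num.sqrt (r k ^+ 2 - 1) * (L k * rnorm (x k)).
have A0 k : 0 <= A k by rewrite !mulr_ge0 ?sqrtr_ge0 ?rnorm_ge0// ltW// (hL k).1.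
exists (\sum_k A k); first by rewrite sumr_ge0.
move=> k t t'; rewrite /resolvent_fun /= -scalerBr rnorm_real_scale ?sqrtr_ge0//.
apply: (@le_trans _ _ (A k * `|t' - t|)); last first.
  by rewrite ler_wpM2r// (bigD1 k)//= lerDl sumr_ge0.
rewrite /A -mulrA ler_wpM2l ?sqrtr_ge0//.
have -> : resolvent ((r k)%:C * expi t') T (x k) - resolvent ((r k)%:C * expi t) T (x k) =
  (cres (r k) t' - cres (r k) t) (x k) by [].
apply: (le_trans (opnormP _ _)); rewrite mulrAC ler_wpM2r ?rnorm_ge0//.
exact: (hL k).2.
Qed.

Lemma resolvent_fun_bounded N (r : 'I_N.+1 -> R) (x : 'I_N.+1 -> E) :
  (forall k, 1 < r k) -> exists B : R, forall s, rnorm (resolvent_fun T r x s) <= B.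
Proof.
move=> r1; have /choice[L hL] : forall k, exists L : R, 0 < L /\ forall t,
  opnorm (cres (r k) t) <= L.
  by move=> k; have [L L0 hL] := circle_bounded_all (r1 k); exists L.
pose A k := Num.sqrt (r k ^+ 2 - 1) * (L k * rnorm (x k)).
have A0 k : 0 <= A k by rewrite !mulr_ge0 ?sqrtr_ge0 ?rnorm_ge0// ltW// (hL k).1.
exists (\sum_k A k) => -[t k]; rewrite /resolvent_fun /= rnorm_real_scale ?sqrtr_ge0//.
apply: (@le_trans _ _ (A k)); last by rewrite (bigD1 k)//= lerDl sumr_ge0.
rewrite ler_wpM2l ?sqrtr_ge0//; apply: (le_trans (opnormP _ _)).
by rewrite ler_wpM2r ?rnorm_ge0//; exact: (hL k).2.
Qed.

End resolvent_fun_facts.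

(** * From power gamma-boundedness to square functions *)

Section power_families.
Context d (Sigma : measurableType d) (R : realType) (P : probability Sigma R).
Variable gam : nat -> Sigma -> R[i].
Hypothesis gamG : gaussian_sequence P gam.
Notation gnorm := (gauss_norm P gam).

Lemma gauss_norm_scaled_contraction (X : normedModType R[i]) n m (A : 'I_n -> 'I_m -> R[i])
    (x : 'I_m -> X) (e : R) : 0 < e ->
  (forall z : 'I_m -> R[i],
     \sum_(i < n) nsq (\sum_(j < m) A i j * z j) <= e ^+ 2 * \sum_(j < m) nsq (z j)) ->
  (gnorm (fun i => (\sum_(j < m) A i j *: x j)%R) <= e%:E * gnorm x)%E.
Proof.
move=> e0 cA.
have e0' : e%:C != 0 by rewrite fmorph_eq0 gt_eqF.
have -> : gnorm (fun i => \sum_(j < m) A i j *: x j) =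
    gnorm (fun i => e%:C *: \sum_(j < m) (e%:C^-1 * A i j) *: x j).
  apply: eq_gauss_norm => i; rewrite scaler_sumr; apply: eq_bigr => j _.
  by rewrite scalerA mulrA mulfV// mul1r.
rewrite gauss_normZ// rnorm_real gtr0_norm// lee_wpmul2l ?lee_fin ?(ltW e0)//.
apply: (gauss_norm_contraction gamG (A := fun i j => e%:C^-1 * A i j)) => z.
have nsqM a b : nsq (a * b) = nsq a * nsq b :> R.
  by rewrite -!rnorm_nsq rnormM exprMn.
have -> : \sum_(i < n) nsq (\sum_(j < m) e%:C^-1 * A i j * z j) =
   e ^- 2 * \sum_(i < n) nsq (\sum_(j < m) A i j * z j).
  rewrite mulr_sumr; apply: eq_bigr => i _.
  have -> : \sum_(j < m) e%:C^-1 * A i j * z j = e%:C^-1 * \sum_(j < m) A i j * z j.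
    by rewrite mulr_sumr; apply: eq_bigr => j _; rewrite mulrA.
  rewrite nsqM; congr (_ * _).
  by rewrite -(fmorphV (real_complex R)) -rnorm_nsq rnorm_real real_normK ?num_real// exprVn.
by rewrite ler_pdivrMl ?exprn_gt0.
Qed.

Section op.
Context (X : completeNormedModType R[i]) (T : bop X X).

Lemma power_gamma_family : power_gamma_bounded P gam T -> exists2 C : R, 0 <= C &
  forall L (n : 'I_L -> nat) (y : 'I_L -> X),
    (gnorm (fun i => (T ^+ n i)%R (y i)) <= C%:E * gnorm y)%E.
Proof.
move=> [C C0 hC]; exists (C + 1); first by rewrite addr_ge0.
case=> [|L] n y.
  have -> : gnorm (fun i => (T ^+ n i) (y i)) = gnorm y by apply: eq_gauss_norm => -[].
  by rewrite -[leLHS]mul1e lee_wpmul2r ?gauss_norm_ge0// lee_fin lerDr.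
pose mask (b : pred 'I_L.+1) i : X := if b i then y i else 0.
have maskle b : (gnorm (mask b) <= gnorm y)%E.
  have -> : gnorm (mask b) = gnorm (fun i => \sum_(j < L.+1) (b i && (j == i))%:R *: y j).
    apply: eq_gauss_norm => i; rewrite /mask (bigD1 i)//= eqxx andbT big1 ?addr0.
      by case: (b i); rewrite ?scale1r ?scale0r.
    by move=> j /negbTE ->; rewrite andbF scale0r.
  apply: (gauss_norm_contraction gamG (A := fun i j => (b i && (j == i))%:R)) => z;
    apply: ler_sum => i _.
  rewrite (bigD1 i)//= eqxx andbT big1 ?addr0.
    by case: (b i); rewrite ?mul1r ?mul0r// /nsq /= !expr0n addr0 addr_ge0 ?sqr_ge0.
  by move=> j /negbTE ->; rewrite andbF mul0r.
pose pos i := (0 < n i)%N.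
have -> : gnorm (fun i => (T ^+ n i) (y i)) =
    gnorm (fun i => bop_pow T (maxn 1 (n i)) (mask pos i) + mask (predC pos) i).
  apply: eq_gauss_norm => i; rewrite /mask /= /pos bop_powE.
  case: (n i) => [|j] /=; first by rewrite linear0 add0r.
  by rewrite addr0 (maxn_idPr _).
apply: (le_trans (gauss_normD gamG _ _)); rewrite EFinD ge0_muleDl ?lee_fin// mul1e.
apply: leeD; last exact: maskle.
apply: (le_trans (hC L (fun i => bop_pow T (maxn 1 (n i))) (mask pos) _)).
  by move=> i; exists (maxn 1 (n i)) => //=; rewrite leq_max.
by rewrite lee_wpmul2l ?lee_fin.
Qed.

Context (C : R).
Hypothesis C0 : 0 <= C.
Hypothesis hC : forall L (n : 'I_L -> nat) (y : 'I_L -> X),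
    (gnorm (fun i => (T ^+ n i)%R (y i)) <= C%:E * gnorm y)%E.

Lemma power_gamma_opnorm n : opnorm (T ^+ n) <= C.
Proof.
have [k k0 single] := gauss_norm_single gamG.
apply: opnorm_le_mul => // x; have := hC (fun _ : 'I_1 => n) (fun=> x).
by rewrite !single -EFinM lee_fin mulrCA ler_pM2l.
Qed.

Lemma power_gamma_spectrum : spectrum_in_disc T.
Proof.
move=> z /= zs; apply: contrapT => /negP z1; apply: zs.
apply: (@neumann_resolvent _ X T C 1) => //.
  by move=> n; rewrite expr1n mulr1 power_gamma_opnorm.
move: z1; rewrite -(rnormE (z : R[i]^o)) (_ : 1 = 1%:C)// lecR -ltNge//.
Qed.

End op.
End power_families.

Section coefficients.
Context {R : realType}.

Lemma sum_cauchy_schwarz n (a b : 'I_n -> R) :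
  (\sum_(i < n) a i * b i) ^+ 2 <= (\sum_(i < n) a i ^+ 2) * \sum_(i < n) b i ^+ 2.
Proof.
set S := \sum_(i < n) a i * b i; set A := \sum_(i < n) a i ^+ 2.
have A0 : 0 <= A by rewrite sumr_ge0// => i _; rewrite sqr_ge0.
have [A00|A00] := eqVneq A 0.
  have a0 i : a i = 0.
    apply/eqP; rewrite -sqrf_eq0 -[_ == 0]/(true && _).
    by move/eqP: A00; rewrite psumr_eq0 => [/allP/(_ i (mem_index_enum _))//|j _]; rewrite sqr_ge0.
  by rewrite /S big1 ?A00 ?expr0n ?mul0r// => i _; rewrite a0 mul0r.
have Ap : 0 < A by rewrite lt_neqAle eq_sym A00.
have : 0 <= \sum_(i < n) (A * b i - S * a i) ^+ 2 by rewrite sumr_ge0// => i _; rewrite sqr_ge0.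
have -> : \sum_(i < n) (A * b i - S * a i) ^+ 2 =
   A * (A * \sum_(i < n) b i ^+ 2 - S ^+ 2).
  transitivity (\sum_(i < n) (A ^+ 2 * b i ^+ 2 + ((- 2 * A * S) * (a i * b i) + S ^+ 2 * a i ^+
    2))).
    by apply: eq_bigr => i _; ring.
  by rewrite !big_split /= -!mulr_sumr -/S -/A; ring.
by rewrite pmulr_rge0// subr_ge0.
Qed.

Lemma nsq_cauchy_schwarz n (a : 'I_n -> R) (z : 'I_n -> R[i]) :
  nsq (\sum_(i < n) (a i)%:C * z i) <= (\sum_(i < n) a i ^+ 2) * \sum_(i < n) nsq (z i).
Proof.
have re : complex.Re (\sum_(i < n) (a i)%:C * z i) = \sum_(i < n) a i * complex.Re (z i).
  rewrite raddf_sum; apply: eq_bigr => i _; case: (z i) => u v /=; ring.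
have im : complex.Im (\sum_(i < n) (a i)%:C * z i) = \sum_(i < n) a i * complex.Im (z i).
  rewrite raddf_sum; apply: eq_bigr => i _; case: (z i) => u v /=; ring.
by rewrite /nsq re im big_split /= mulrDr lerD// sum_cauchy_schwarz.
Qed.

Definition neumann_coef (r : R) n : R := Num.sqrt (r ^+ 2 - 1) * r^-1 ^+ n.+1.

Lemma neumann_coef_sum (r : R) M m : 1 < r ->
  \sum_(n < m) (if (n < M)%N then 0 else neumann_coef r n) ^+ 2 <= (r^-1 ^+ M) ^+ 2.
Proof.
move=> r1; have r0 : 0 < r by exact: lt_trans r1.
pose q := r^-1 ^+ 2.
have cq n : neumann_coef r n ^+ 2 = q ^+ n - q ^+ n.+1.
  rewrite /neumann_coef exprMn sqr_sqrtr ?subr_ge0 ?exprn_ege1 ?ltW//.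
  rewrite -[X in _ * X]exprM mulnC exprM -/q [q ^+ n.+1]exprS mulrA mulrBl mul1r.
  by rewrite /q exprVn mulfV ?expf_neq0 ?gt_eqF// mulrBl mul1r.
suff -> : \sum_(n < m) (if (n < M)%N then 0 else neumann_coef r n) ^+ 2 = q ^+ M - q ^+ maxn M m.
  by rewrite /q -!exprM mulnC lerBlDr lerDl exprn_ge0// invr_ge0 ltW.
elim: m => [|m IH]; first by rewrite big_ord0 maxn0 subrr.
rewrite big_ord_recr /= IH; case: ltnP => mM.
  by rewrite expr0n addr0 !(maxn_idPl _)// ltnW.
by rewrite cq !(maxn_idPr _)// ?(leq_trans mM)// addrA subrK.
Qed.

Lemma pair_sum_ord (V : nmodType) M N (F : 'I_M -> 'I_N -> V) :
  \sum_(n < M) \sum_(k < N) F n k =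
  \sum_(i < #|{: 'I_M * 'I_N}|) F (enum_val i).1 (enum_val i).2.
Proof.
rewrite pair_big /=.
exact: (big_enum_val (A := {: 'I_M * 'I_N}) (fun p => F p.1 p.2)).
Qed.

End coefficients.

Section parseval.
Context d (S : measurableType d) (R : realType) (mu : {measure set S -> \bar R}).
Notation sq := (square_integrable mu).

Lemma parseval n (v : 'I_n -> S -> R[i]) (z : 'I_n -> R[i]) : (forall j, v j \in sq) ->
  (forall i j, cintegral mu (fun s => (v i s)^* * v j s) = (i == j)%:R) ->
  complex.Re (cintegral mu (fun s => (\sum_(j < n) z j * v j s)^* * \sum_(j < n) z j * v j s)) =
  \sum_(j < n) nsq (z j).
Proof.
move=> vs onv.
have ci i j : cintegrable mu (fun s => (v i s)^* * v j s).
  by apply: cintegrable_mul => //; exact: sq_conj.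
have -> : (fun s => (\sum_(j < n) z j * v j s)^* * \sum_(j < n) z j * v j s) =
   (fun s => \sum_(i < n) (z i)^* * \sum_(j < n) z j * ((v i s)^* * v j s)).
  apply/funext => s; rewrite rmorph_sum mulr_suml; apply: eq_bigr => i _.
  rewrite [X in X * _](rmorphM (@conjc R)) -mulrA; congr (_ * _).
  by rewrite mulr_sumr; apply: eq_bigr => j _; rewrite mulrCA.
rewrite cintegral_sum; last by move=> i; exact: cintegrable_sum.
rewrite raddf_sum; apply: eq_bigr => i _; rewrite cintegral_sum//.
rewrite (bigD1 i)//= onv eqxx mulr1 big1 ?addr0.
  by rewrite /nsq; case: (z i) => a b /=; ring.
by move=> j ji; rewrite onv eq_sym (negbTE ji) mulr0.
Qed.

End parseval.

Section fourier_coefficients.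
Context {R : realType} (N : nat).
Notation mu := (@circle_ord_measure R N).

Definition fcoef (g : L2 mu) n k := cintegral mu (fun s => L2_fun g s * fourier n k s).

Lemma fcoef_sum (g : L2 mu) K (p : 'I_K -> nat * 'I_N.+1) (z : 'I_K -> R[i]) :
  \sum_(i < K) fcoef g (p i).1 (p i).2 * z i =
  cintegral mu (fun s => L2_fun g s * \sum_(i < K) z i * fourier (p i).1 (p i).2 s).
Proof.
under [in RHS]eq_fun do rewrite mulr_sumr.
under [in RHS]eq_fun do under eq_bigr do rewrite mulrCA.
rewrite cintegral_sum; first by apply: eq_bigr => i _; rewrite mulrC.
by move=> j; apply: cintegrable_mul; [exact: sq_L2_fun|exact: sq_fourier].
Qed.

Section orthonormal.
Context L (h : 'I_L -> L2 mu) (onh : orthonormal_system (@L2_ip _ _ _ mu) h).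
Context K (p : 'I_K -> nat * 'I_N.+1) (pinj : injective p).

Let ortho i j : cintegral mu (fun s =>
  (fourier (p i).1 (p i).2 s)^* * fourier (p j).1 (p j).2 s) = (i == j)%:R.
Proof.
rewrite fourier_ortho; congr (_ %:R); congr nat_of_bool.
by rewrite -(inj_eq pinj) -pair_eqE.
Qed.

Lemma fcoef_row_contraction (z : 'I_K -> R[i]) :
  \sum_(j < L) nsq (\sum_(i < K) fcoef (h j) (p i).1 (p i).2 * z i) <= \sum_(i < K) nsq (z i).
Proof.
rewrite -(@parseval _ _ _ mu _ (fun i => fourier (p i).1 (p i).2)) //; last first.
  by move=> j; exact: sq_fourier.
under eq_bigr do rewrite fcoef_sum.
apply: bessel => [j|i j|]; [exact: sq_L2_fun|exact: onh|].
by apply: sq_sum => j; apply: sqZ; exact: sq_fourier.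
Qed.

Lemma fcoef_column_contraction (z : 'I_L -> R[i]) :
  \sum_(i < K) nsq (\sum_(j < L) fcoef (h j) (p i).1 (p i).2 * z j) <= \sum_(j < L) nsq (z j).
Proof.
rewrite -(@parseval _ _ _ mu _ (fun j => L2_fun (h j))) //; last 2 first.
- by move=> j; exact: sq_L2_fun.
- move=> i j; rewrite eq_sym -onh; congr cintegral; apply/funext => s; exact: mulrC.
have E i : \sum_(j < L) fcoef (h j) (p i).1 (p i).2 * z j =
    cintegral mu (fun s => fourier (p i).1 (p i).2 s * \sum_(j < L) z j * L2_fun (h j) s).
  under [in RHS]eq_fun do rewrite mulr_sumr.
  under [in RHS]eq_fun do under eq_bigr do rewrite mulrCA.
  rewrite cintegral_sum; last first.
    by move=> j; apply: cintegrable_mul; [exact: sq_fourier|exact: sq_L2_fun].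
  apply: eq_bigr => j _; rewrite mulrC; congr (_ * cintegral _ _).
  by apply/funext => s; exact: mulrC.
under eq_bigr do rewrite E.
apply: bessel => [j|i j|]; first exact: sq_fourier.
  by rewrite eq_sym -ortho; congr cintegral; apply/funext => s; exact: mulrC.
by apply: sq_sum => j; apply: sqZ; exact: sq_L2_fun.
Qed.

End orthonormal.

Definition partial_op (E : normedModType R[i]) (T : bop E E) (x : 'I_N.+1 -> E)
    (c : nat -> 'I_N.+1 -> R) M (g : L2 mu) : E :=
  \sum_(n < M) \sum_(k < N.+1) (fcoef g n k * (c n k)%:C) *: (T ^+ n) (x k).

End fourier_coefficients.

Section partial_op_bounds.
Context d (Sigma : measurableType d) (R : realType) (P : probability Sigma R).
Variable gam : nat -> Sigma -> R[i].
Hypothesis gamG : gaussian_sequence P gam.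
Notation gnorm := (gauss_norm P gam).
Context (X : completeNormedModType R[i]) (T : bop X X) (C : R).
Hypothesis C0 : 0 <= C.
Hypothesis hC : forall L (n : 'I_L -> nat) (y : 'I_L -> X),
    (gnorm (fun i => (T ^+ n i)%R (y i)) <= C%:E * gnorm y)%E.
Context (N M : nat) (c : nat -> 'I_N.+1 -> R) (e : R) (e0 : 0 < e).
Hypothesis ce : forall k, \sum_(n < M) c n k ^+ 2 <= e ^+ 2.
Notation mu := (@circle_ord_measure R N).
Context L (h : 'I_L -> L2 mu) (onh : orthonormal_system (@L2_ip _ _ _ mu) h).

Let K := #|{: 'I_M * 'I_N.+1}|.
Let p (i : 'I_K) : nat * 'I_N.+1 := (val (enum_val i).1, (enum_val i).2).

Let pinj : injective p.
Proof.
move=> i j [h1 h2]; apply: enum_val_inj.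
by move: (enum_val i) (enum_val j) h1 h2 => [a b] [a' b'] /= /val_inj -> ->.
Qed.

Let partial_op_pairs (E : normedModType R[i]) (U : bop E E) (x : 'I_N.+1 -> E) g :
  partial_op U x c M g = \sum_(i < K)
    fcoef g (p i).1 (p i).2 *: ((U ^+ (p i).1)%R ((c (p i).1 (p i).2)%:C *: x (p i).2)).
Proof.
rewrite /partial_op (pair_sum_ord (fun (n : 'I_M) k =>
  (fcoef g n k * (c n k)%:C) *: (U ^+ n) (x k))).
by apply: eq_bigr => i _; rewrite linearZ scalerA.
Qed.

Lemma gauss_norm_partial_op (x : 'I_N.+1 -> X) :
  (gnorm (fun j => partial_op T x c M (h j)) <= (C * e)%:E * gnorm x)%E.
Proof.
under eq_gauss_norm do rewrite partial_op_pairs.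
apply: (le_trans (gauss_norm_contraction gamG _ (fcoef_row_contraction onh pinj))).
apply: (le_trans (hC _ _)); rewrite EFinM -muleA lee_wpmul2l ?lee_fin//.
pose A (i : 'I_K) (k : 'I_N.+1) : R[i] := (c (p i).1 (p i).2)%:C * (k == (p i).2)%:R.
have -> : gnorm (fun i => (c (p i).1 (p i).2)%:C *: x (p i).2) =
   gnorm (fun i => \sum_(k < N.+1) A i k *: x k).
  apply: eq_gauss_norm => i; rewrite (bigD1 (p i).2)//= /A eqxx mulr1 big1 ?addr0// => k /negbTE ->.
  by rewrite mulr0 scale0r.
apply: gauss_norm_scaled_contraction => // z.
have E i : nsq (\sum_(k < N.+1) A i k * z k) = c (p i).1 (p i).2 ^+ 2 * nsq (z (p i).2).
  rewrite (bigD1 (p i).2)//= /A eqxx mulr1 big1 ?addr0.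
    by rewrite -!rnorm_nsq rnormM exprMn rnorm_real real_normK ?num_real.
  by move=> k /negbTE ->; rewrite mulr0 mul0r.
under eq_bigr do rewrite E.
rewrite -(pair_sum_ord (fun (n : 'I_M) k => c n k ^+ 2 * nsq (z k))) exchange_big /= mulr_sumr.
by apply: ler_sum => k _; rewrite -mulr_suml ler_wpM2r ?nsq_ge0.
Qed.

Lemma adjoint_pow_app (E : normedModType R[i]) (U : bop E E) n (phi : dual E) y :
  (adjoint U ^+ n)%R phi y = phi ((U ^+ n)%R y).
Proof.
elim: n phi => [|n IH] phi; first by rewrite !expr0.
by rewrite exprSr exprS bop_mulE IH.
Qed.

Lemma gauss_trace_partial_op (phi : 'I_N.+1 -> dual X) (y : 'I_L -> X) : (gnorm y <= 1)%E ->
  ((rnorm (\sum_(j < L) partial_op (adjoint T) phi c M (h j) (y j) : R[i]^o))%:E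
    <= (C * e)%:E * gauss_dual_norm P gam phi)%E.
Proof.
move=> y1; have [k0 k00 single] := gauss_norm_single gamG.
pose w i := \sum_(j < L) fcoef (h j) (p i).1 (p i).2 *: y j.
pose A (k : 'I_N.+1) (i : 'I_K) : R[i] := (c (p i).1 (p i).2 * (k == (p i).2)%:R)%:C.
have -> : \sum_(j < L) partial_op (adjoint T) phi c M (h j) (y j) =
   \sum_(k < N.+1) phi k (\sum_(i < K) A k i *: (T ^+ (p i).1)%R (w i)).
  have E1 (k : 'I_N.+1) : phi k (\sum_(i < K) A k i *: (T ^+ (p i).1)%R (w i)) =
      \sum_(i < K) A k i * (phi k ((T ^+ (p i).1)%R (w i)) : R[i]).
    by rewrite linear_sum; apply: eq_bigr => i _; rewrite linearZ.
  under [RHS]eq_bigr do rewrite E1.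
  rewrite exchange_big /=.
  have E2 (i : 'I_K) : \sum_(k < N.+1) A k i * (phi k ((T ^+ (p i).1)%R (w i)) : R[i]) =
     \sum_(j < L) (fcoef (h j) (p i).1 (p i).2 * (c (p i).1 (p i).2)%:C) *
         (phi (p i).2 ((T ^+ (p i).1)%R (y j)) : R[i]).
    rewrite (bigD1 (p i).2)//= /A eqxx mulr1 [X in _ + X]big1 ?addr0.
      rewrite /w !linear_sum /= mulr_sumr; apply: eq_bigr => j _.
      by rewrite !linearZ /= [_ *: _]/(_ * _) mulrCA mulrA.
    by move=> k /negbTE ->; rewrite mulr0 mul0r.
  under [RHS]eq_bigr do rewrite E2.
  rewrite exchange_big /=; apply: eq_bigr => j _; rewrite partial_op_pairs.
  have ev (F : 'I_K -> dual X) : (\sum_(i < K) F i) (y j) = \sum_(i < K) F i (y j).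
    by elim/big_rec2 : _ => // i u v _ <-.
  rewrite ev; apply: eq_bigr => i _.
  rewrite linearZ scalerA.
  transitivity ((fcoef (h j) (p i).1 (p i).2 * (c (p i).1 (p i).2)%:C) *
    ((adjoint T ^+ (p i).1)%R (phi (p i).2) (y j) : R[i])) => //.
  by rewrite adjoint_pow_app.
apply: (le_trans (gauss_trace_le gamG k00 (single X) _ _)).
rewrite muleC; apply: lee_wpmul2r; first exact: (gauss_dual_norm_ge0 gamG (single X)).
apply: (@le_trans _ _ (e%:E * gnorm (fun i => (T ^+ (p i).1)%R (w i)))%E).
  apply: gauss_norm_scaled_contraction => // z.
  have E k : nsq (\sum_(i < K) A k i * z i) <= e ^+ 2 * \sum_(i < K) (k == (p i).2)%:R * nsq (z i).
    have -> : \sum_(i < K) A k i * z i =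
       \sum_(i < K) (c (p i).1 (p i).2 * (k == (p i).2)%:R)%:C * ((k == (p i).2)%:R * z i).
      apply: eq_bigr => i _; rewrite /A; case: (k == _); rewrite ?mul1r//.
      by rewrite !mulr0 mul0r mul0r.
    apply: (le_trans (nsq_cauchy_schwarz _ _)); apply: ler_pM.
    - by rewrite sumr_ge0// => i _; rewrite sqr_ge0.
    - by rewrite sumr_ge0// => i _; rewrite nsq_ge0.
    - rewrite -(pair_sum_ord (fun (n : 'I_M) k' => (c n k' * (k == k')%:R) ^+ 2)).
      apply: le_trans (ce k); apply: ler_sum => n _.
      rewrite (bigD1 k)//= eqxx mulr1 big1 ?addr0// => k' kk.
      by rewrite eq_sym (negbTE kk) mulr0 expr0n.
    apply: ler_sum => i _; case: (k == _); rewrite ?mul1r// !mul0r.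
    by rewrite /nsq /= !expr0n addr0.
  apply: (le_trans (ler_sum _ (fun k _ => E k))).
  rewrite -mulr_sumr ler_wpM2l ?sqr_ge0// exchange_big /=.
  apply: ler_sum => i _; rewrite -mulr_suml (bigD1 (p i).2)//= eqxx big1 ?addr0 ?mul1r//.
  by move=> k /negbTE ->.
rewrite EFinM [leLHS]muleC; apply: lee_wpmul2r; first by rewrite lee_fin ltW.
apply: (le_trans (hC _ _)); rewrite -[leRHS]mule1 lee_wpmul2l ?lee_fin//.
apply: le_trans y1.
exact: (gauss_norm_contraction gamG y (fcoef_column_contraction onh pinj)).
Qed.

End partial_op_bounds.

Section rcomplete.
Context {R : realType}.

Definition rcomplete (E : normedModType R[i]) := forall u : nat -> E,
  (forall e : R, 0 < e -> exists N, forall n m, (N <= n <= m)%N -> rnorm (u m - u n) <= e) ->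
  exists l, rconverges u l.

Lemma rcomplete_complete (X : completeNormedModType R[i]) : rcomplete X.
Proof. exact: rconverges_complete. Qed.

Lemma real_cauchy_limit (u : nat -> R) :
  (forall e : R, 0 < e -> exists N, forall n m, (N <= n <= m)%N -> `|u m - u n| <= e) ->
  exists l, forall e : R, 0 < e -> exists N, forall n, (N <= n)%N -> `|u n - l| <= e.
Proof.
move=> cu.
have : cvg (u @ \oo).
  apply: cauchy_cvg; apply: cauchy_exP => e e0.
  have [N uN] := cu (e / 2) (divr_gt0 e0 (ltr0n _ 2)).
  exists (u N); exists N => // n Nn; rewrite /= /ball /= distrC.
  by apply: (le_lt_trans (uN N n _)); [rewrite leqnn|lra].
move=> /cvg_ex[l ul]; exists l => e e0.
have /cvgrPdist_lt/(_ _ e0)[N _ uN] := ul.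
by exists N => n Nn; rewrite distrC ltW//; exact: uN.
Qed.

Lemma rcomplete_complex : rcomplete R[i]^o.
Proof.
move=> u cu.
have ReB (z w : R[i]) : complex.Re (z - w) = complex.Re z - complex.Re w.
  by case: z w => ? ? [? ?].
have ImB (z w : R[i]) : complex.Im (z - w) = complex.Im z - complex.Im w.
  by case: z w => ? ? [? ?].
have [e e0|a ha] := @real_cauchy_limit (fun n => complex.Re (u n)).
  have [N hN] := cu e e0; exists N => n m nm.
  by apply: le_trans (hN n m nm); rewrite -ReB; exact: (parts_le_rnorm _).1.
have [e e0|b hb] := @real_cauchy_limit (fun n => complex.Im (u n)).
  have [N hN] := cu e e0; exists N => n m nm.
  by apply: le_trans (hN n m nm); rewrite -ImB; exact: (parts_le_rnorm _).2.
exists (a +i* b) => e e0; have e20 : 0 < e / 2 by rewrite divr_gt0.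
have [N hN] := ha _ e20; have [M hM] := hb _ e20.
exists (maxn N M) => n; rewrite geq_max => /andP[Nn Mn].
apply: (le_trans (rnorm_le_parts _)); rewrite (ReB _ (a +i* b)) (ImB _ (a +i* b)) /=.
have := hN n Nn; have := hM n Mn; lra.
Qed.

Lemma rcomplete_dual (X : normedModType R[i]) : rcomplete (dual X).
Proof.
move=> u cu.
have dist (p q : dual X) x : rnorm (p x - q x) <= rnorm (p - q) * rnorm x.
  exact: (opnormP (p - q) x).
have /choice[l hl] : forall x, exists y, rconverges (fun n => u n x : R[i]^o) y.
  move=> x; apply: rcomplete_complex => e e0.
  have x1 : 0 < rnorm x + 1 by rewrite ltr_wpDl// rnorm_ge0.
  have [N hN] := cu _ (divr_gt0 e0 x1); exists N => n m nm.
  apply: (le_trans (dist _ _ _)); have := hN n m nm; rewrite ler_pdivlMr//.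
  have := rnorm_ge0 (u m - u n); have := rnorm_ge0 x; nra.
have bnd n e : (forall m, (n <= m)%N -> rnorm (u m - u n) <= e) ->
    forall x, rnorm (l x - u n x) <= e * rnorm x.
  move=> hn x.
  have h : rconverges (fun m => u m x - u n x : R[i]^o) (l x - u n x).
    apply: rconvergesD; first exact: hl.
    by move=> e' e0'; exists 0%N => k _; rewrite subrr rnorm0 ltW.
  apply: rconverges_le h _; exists n => m nm.
  by apply: (le_trans (dist _ _ _)); rewrite ler_wpM2r ?rnorm_ge0// hn.
have lb : l \in @is_bounded_op R X R[i]^o.
  apply/asboolP; split.
    move=> a x y; apply: rconverges_unique (hl _) _.
    have := rconvergesD (rconvergesZ (a : R[i]) (hl x)) (hl y).
    by congr (rconverges _ _); apply/funext => n; rewrite linearP.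
  have [N hN] := cu 1 ltr01; exists (1 + opnorm (u N)) => x.
  have hb m : (N <= m)%N -> rnorm (u m - u N) <= 1 by move=> h; apply: hN; rewrite leqnn.
  have := bnd N 1 hb x.
  move=> h; rewrite mulrDl; have := opnormP (u N) x.
  by have := rnormD (l x - u N x) (u N x); rewrite subrK; lra.
exists (Bop lb) => e e0; have [N hN] := cu e e0; exists N => n Nn.
apply: opnorm_le => x x1.
rewrite [X in rnorm X](_ : _ = u n x - l x)// rnormB_sym.
apply: (@le_trans _ _ (e * rnorm x)); last by rewrite ler_piMr// ltW.
by apply: bnd => m nm; apply: hN; rewrite Nn.
Qed.

End rcomplete.

Section L1.
Context d (S : measurableType d) (R : realType) (mu : {measure set S -> \bar R}).
Hypothesis mufin : (mu setT < +oo)%E.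
Notation sq := (square_integrable mu).

Definition parts_norm (z : R[i]) : R := `|complex.Re z| + `|complex.Im z|.
Definition L1 (g : L2 mu) : R := Rintegral mu setT (fun s => parts_norm (L2_fun g s)).

Lemma L2_fun_integrable (g : L2 mu) : cintegrable mu (L2_fun g).
Proof.
have h1 : (fun=> 1) \in sq.
  by apply: (@bounded_sq _ _ _ _ mufin _ 1) => [|s]; [split|rewrite /rnorm normr1].
by have := cintegrable_mul (sq_L2_fun g) h1; under eq_fun do rewrite mulr1.
Qed.

Lemma parts_norm_integrable (g : L2 mu) : mu.-integrable setT (EFin \o (fun s =>
  parts_norm (L2_fun g s))).
Proof.
have [g1 g2] := L2_fun_integrable g.
have := integrableD measurableT (integrable_abse g1) (integrable_abse g2).
by [].
Qed.

Lemma L1_ge0 (g : L2 mu) : 0 <= L1 g.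
Proof. by apply: Rintegral_ge0 => s _; rewrite addr_ge0. Qed.

Lemma young2 (a b l : R) : 0 < l -> `|a| + `|b| <= (2 * l)^-1 * (a ^+ 2 + b ^+ 2) + l.
Proof.
move=> l0; have l2 : 0 < 2 * l by rewrite mulr_gt0.
rewrite -lerBlDr -ler_pdivrMl ?invr_gt0// invrK -(real_normK (num_real a)) -(real_normK
  (num_real b)).
move: (sqr_ge0 (`|a| - l)) (sqr_ge0 (`|b| - l)); nra.
Qed.

Lemma L1_le_ip : exists2 M : R, 0 <= M &
  forall g : L2 mu, L1 g <= M * Num.sqrt (complex.Re (L2_ip g g)).
Proof.
pose m := fine (mu setT); have m0 : 0 <= m by rewrite fine_ge0.
have mfin : mu setT \is a fin_num by rewrite ge0_fin_numE.
exists (2^-1 + m) => [|g]; first by rewrite addr_ge0.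
pose u s := complex.Re (L2_fun g s * (L2_fun g s)^*).
have uE s : u s = complex.Re (L2_fun g s) ^+ 2 + complex.Im (L2_fun g s) ^+ 2.
  by rewrite /u; case: (L2_fun g s) => a b /=; ring.
have [ui _] : cintegrable mu (fun s => L2_fun g s * (L2_fun g s)^*).
  by apply: cintegrable_mul; [|apply: sq_conj]; exact: sq_L2_fun.
set Q := complex.Re _; have QE : Q = Rintegral mu setT u by [].
have Q0 : 0 <= Q by rewrite QE; apply: Rintegral_ge0 => s _; rewrite -/(u s) uE addr_ge0 ?sqr_ge0.
have ci (a : R) : mu.-integrable setT (EFin \o (fun=> a) : S -> \bar R).
  have b2 (b : R) : (fun _ : S => b) \in Lfun mu 2%:E.
    by apply: (@bounded_Lfun2 _ _ _ _ mufin _ `|b|).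
  have /Lfun1_integrable := Lfun2_mul_Lfun1 (b2 a) (b2 1).
  by have -> : (fun _ : S => a) \* (fun _ : S => 1) = (fun=> a) by apply/funext => s /=;
    rewrite mulr1.
have main (l : R) : 0 < l -> L1 g <= (2 * l)^-1 * Q + l * m.
  move=> l0.
  have i1 : mu.-integrable setT (EFin \o (fun s => (2 * l)^-1 * u s)).
    have := integrableZl measurableT ((2 * l)^-1) ui; by [].
  have -> : (2 * l)^-1 * Q + l * m = Rintegral mu setT (fun s => (2 * l)^-1 * u s + l).
    rewrite (RintegralD measurableT i1 (ci l)) (RintegralZl (2 * l)^-1 measurableT ui).
    by rewrite Rintegral_cst.
  apply: le_Rintegral => //.
  - exact: parts_norm_integrable.
  - have := integrableD measurableT i1 (ci l); by [].
  move=> s _; rewrite uE /parts_norm.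
  move: (complex.Re _) (complex.Im _) => a b; exact: young2.
have s0 : 0 <= Num.sqrt Q by exact: sqrtr_ge0.
have [Q00|Q00] := eqVneq Q 0.
  rewrite Q00 sqrtr0 mulr0; apply/ler_addgt0Pr => e e0; rewrite add0r.
  have m1 : 0 < m + 1 by rewrite ltr_wpDl.
  have := main _ (divr_gt0 e0 m1); rewrite Q00 mulr0 add0r => /le_trans; apply.
  by rewrite mulrAC ler_pdivrMr// ler_pM2l// lerDl.
have Qp : 0 < Q by rewrite lt_neqAle eq_sym Q00.
have sp : 0 < Num.sqrt Q by rewrite sqrtr_gt0.
apply: (le_trans (main _ sp)).
have -> : (2 * Num.sqrt Q)^-1 * Q = 2^-1 * Num.sqrt Q.
  by rewrite -[X in _ * X = _](sqr_sqrtr Q0) invfM -mulrA expr2 mulKf ?gt_eqF.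
by rewrite mulrDl (mulrC m).
Qed.

End L1.

Section pettis.
Context d (S : measurableType d) (R : realType) (mu : {measure set S -> \bar R}).
Hypothesis mufin : (mu setT < +oo)%E.
Notation sq := (square_integrable mu).
Context (E : normedModType R[i]).

Lemma pettis_integral_eq (f : S -> E) y : is_pettis_integral mu f y -> pettis_integral mu f = y.
Proof.
move=> fy; apply: dual_separates => phi; rewrite fy.
by have -> : cintegral mu (fun s => phi (f s)) = phi (pettis_integral mu f);
  first by rewrite /pettis_integral; case: xgetP => [z _ hz|/(_ y)//]; rewrite hz.
Qed.

Lemma pettis_opE (f : S -> E) (g : L2 mu) :
  (exists y, is_pettis_integral mu (fun s => L2_fun g s *: f s) y) ->
  forall phi : dual E, phi (pettis_op f g) = cintegral mu (fun s => L2_fun g s * phi (f s)).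
Proof.
move=> [y fy] phi; rewrite /pettis_op (pettis_integral_eq fy) fy.
by congr cintegral; apply/funext => s; rewrite linearZ.
Qed.

Lemma pettis_op_linear (f : S -> E) : weakly_L2 mu f ->
  (forall g : L2 mu, exists y, is_pettis_integral mu (fun s => L2_fun g s *: f s) y) ->
  linear (pettis_op f : L2 mu -> E).
Proof.
move=> fw fp a g h; apply: dual_separates => phi.
rewrite linearP !(pettis_opE (fp _)).
have ci (u : L2 mu) : cintegrable mu (fun s => L2_fun u s * phi (f s)).
  by apply: cintegrable_mul; [exact: sq_L2_fun|exact: fw].
transitivity (a * cintegral mu (fun s => L2_fun g s * phi (f s)) +
  cintegral mu (fun s => L2_fun h s * phi (f s))) => //.
rewrite -cintegralZD//.
apply: ae_eq_cintegral; first exact: cintegrable_measurable.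
  by apply: cintegrable_measurable; exact: cintegrableZD.
apply: filterS (L2_fun_linear a g h) => s ->.
by rewrite mulrDl mulrA.
by rewrite -!(pettis_opE (fp _)).
Qed.

Lemma cintegral_L2_bound (g : L2 mu) (u : S -> R[i]) (B : R) : cmeasurable u -> 0 <= B ->
  (forall s, rnorm (u s : R[i]^o) <= B) ->
  rnorm (cintegral mu (fun s => L2_fun g s * u s) : R[i]^o) <= 2 * B * L1 g.
Proof.
move=> mu' B0 uB.
have iG : mu.-integrable setT (EFin \o (fun s => B * parts_norm (L2_fun g s))).
  have := integrableZl measurableT B (parts_norm_integrable mufin g); by [].
rewrite -mulrA -(RintegralZl B measurableT (parts_norm_integrable mufin g)).
apply: rnorm_cintegral_le => // [|s].
  by apply: cmeasurable_mul => //; apply: sq_measurable; exact: sq_L2_fun.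
rewrite rnormM mulrC; apply: ler_pM; rewrite ?rnorm_ge0 ?uB//.
exact: rnorm_le_parts.
Qed.

Lemma pettis_op_bound (f : S -> E) (B : R) : weakly_L2 mu f -> 0 <= B ->
  (forall s, rnorm (f s) <= B) ->
  (forall g : L2 mu, exists y, is_pettis_integral mu (fun s => L2_fun g s *: f s) y) ->
  forall g : L2 mu, rnorm (pettis_op f g) <= 2 * B * L1 g.
Proof.
move=> fw B0 fB fp g; have [phi phi1 phie] := dual_norming (pettis_op f g).
have -> : rnorm (pettis_op f g) = rnorm (phi (pettis_op f g)).
  by rewrite phie rnorm_real ger0_norm ?rnorm_ge0.
rewrite (pettis_opE (fp g)); apply: cintegral_L2_bound => //.
  exact/sq_measurable/fw.
by move=> s; exact: le_trans (phi1 _) (fB s).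
Qed.

End pettis.

Section resolvent_pettis.
Context {R : realType} (E : normedModType R[i]) (T : bop E E).
Hypothesis Ecomp : rcomplete E.
Hypothesis Tdisc : spectrum_in_disc T.
Context (N : nat) (r : 'I_N.+1 -> R) (r1 : forall k, 1 < r k) (x : 'I_N.+1 -> E).
Notation mR := (measurableTypeR R).
Notation mu := (@circle_ord_measure R N).
Notation ST := (mR * 'I_N.+1)%type.
Notation f := (resolvent_fun T r x).

Definition neumann_coefs n k := neumann_coef (r k) n.

Definition partial_fun M (s : ST) : E :=
  \sum_(n < M) \sum_(k < N.+1) (fourier n k s * (neumann_coefs n k)%:C) *: (T ^+ n) (x k).

Lemma resolvent_fun_partial M t k :
  resolvent_fun T r x (t, k) - partial_fun M (t, k) =
  (Num.sqrt (r k ^+ 2 - 1))%:C *: ((r k)%:C * expi t)^-1 ^+ M *: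
    (resolvent ((r k)%:C * expi t) T ((T ^+ M) (x k))).
Proof.
have z0 : (r k)%:C * expi t != 0 :> R[i].
  by rewrite mulf_neq0 ?expi_neq0// fmorph_eq0 gt_eqF// (lt_trans ltr01).
have h : cres T (r k) t (x k) - neumann T ((r k)%:C * expi t) M (x k) =
    ((r k)%:C * expi t)^-1 ^+ M *: cres T (r k) t ((T ^+ M) (x k)).
  exact: (congr1 (fun U : bop E E => U (x k))
    (resolvent_neumann M z0 (circle_resolvent Tdisc t (r1 k)))).
rewrite -scalerA -h.
rewrite scalerBr; congr (_ - _); rewrite /neumann bop_sumE scaler_sumr; apply: eq_bigr => n _.
rewrite (bigD1 k)//= big1 ?addr0; last first.
  by move=> k' kk; rewrite /fourier eq_sym (negbTE kk) !mul0r scale0r.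
transitivity ((Num.sqrt (r k ^+ 2 - 1))%:C *: (((r k)%:C * expi t)^-1 ^+ n.+1 *: (T ^+ n) (x
  k))) => //.
rewrite /fourier eqxx mul1r scalerA; congr (_ *: _).
rewrite /neumann_coefs /neumann_coef rmorphM /= rmorphXn /= fmorphV.
rewrite invfM -expiN exprMn expiX mulrC -mulrA; congr (_ * (_ * expi _)).
by rewrite mulrN mulNr.
Qed.

Lemma lower_bound_gt1 : exists2 m : R, 1 < m & forall k, m <= r k.
Proof.
clear -r1; elim: N r r1 => [|n IH] u u1; first by (exists (u ord0) => [|k]; rewrite ?ord1//;
  exact: u1).
have [m m1 hm] := IH (fun k => u (lift ord0 k)) (fun k => u1 _).
exists (Num.min m (u ord0)); first by rewrite lt_min m1 u1.
move=> k; case: (unliftP ord0 k) => [j ->|->]; rewrite ge_min ?hm ?lexx ?orbT//.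
Qed.

Lemma partial_fun_approx : exists A q : R, [/\ 0 <= A, 0 <= q, q < 1 &
  forall M s, rnorm (f s - partial_fun M s) <= A * q ^+ M].
Proof.
have [m m1 hm] := lower_bound_gt1.
pose rho := (1 + m) / 2; have rho1 : 1 < rho by rewrite /rho; lra.
have rhom : rho < m by rewrite /rho; lra.
have m0 : 0 < m by exact: lt_trans m1.
have [K K0 hK] := power_growth Tdisc rho1.
have /choice[L hL] : forall k, exists L : R, 0 < L /\ forall t, opnorm (cres T (r k) t) <= L.
  by move=> k; have [L L0 hL] := circle_bounded_all Tdisc (r1 k); exists L.
pose A k := Num.sqrt (r k ^+ 2 - 1) * (L k * (K * rnorm (x k))).
have A0 k : 0 <= A k.
  have := (hL k).1 => /ltW ?; have := ltW K0 => ?.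
  by rewrite /A; repeat apply: mulr_ge0 => //; rewrite ?sqrtr_ge0 ?rnorm_ge0.
exists (\sum_k A k), (rho / m); split.
- by rewrite sumr_ge0.
- by rewrite divr_ge0// ltW// (lt_trans ltr01).
- by rewrite ltr_pdivrMr// mul1r.
move=> M [t k]; rewrite resolvent_fun_partial.
apply: (@le_trans _ _ (A k * (rho / m) ^+ M)); last first.
  rewrite ler_wpM2r ?exprn_ge0//; first by rewrite divr_ge0// ltW// (lt_trans ltr01).
  by rewrite (bigD1 k)//= lerDl sumr_ge0.
have r0 : 0 < r k by exact: lt_trans (r1 k).
rewrite -scalerA rnorm_real_scale ?sqrtr_ge0// rnormZ /A -mulrA ler_wpM2l ?sqrtr_ge0//.
have -> : rnorm (((r k)%:C * expi t)^-1 ^+ M : R[i]^o) = (r k)^-1 ^+ M.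
  rewrite rnormX invfM -expiN rnormM rnorm_expi mulr1 -fmorphV rnorm_real ger0_norm//.
  by rewrite invr_ge0 ltW.
have b1 : rnorm (resolvent ((r k)%:C * expi t) T ((T ^+ M) (x k))) <= L k * (K * rho ^+ M *
  rnorm (x k)).
  apply: (le_trans (opnormP _ _)); apply: ler_pM; rewrite ?opnorm_ge0 ?rnorm_ge0 ?(hL k).2//.
  by apply: (le_trans (opnormP _ _)); rewrite ler_wpM2r ?rnorm_ge0.
have b2 : (r k)^-1 ^+ M <= m^-1 ^+ M.
  by apply: lerXn2r; rewrite ?nnegrE ?invr_ge0 ?(ltW r0) ?(ltW m0)// lef_pV2 ?posrE ?hm.
apply: (@le_trans _ _ (m^-1 ^+ M * (L k * (K * rho ^+ M * rnorm (x k))))).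
  by apply: ler_pM => //; rewrite ?rnorm_ge0 ?exprn_ge0 ?invr_ge0 ?ltW.
rewrite (exprMn M rho) le_eqVlt; apply/orP; left; apply/eqP.
by move: (m^-1 ^+ M) (rho ^+ M) (rnorm _) => a b c; ring.
Qed.

Lemma sq_fun (phi : dual E) : (fun s => phi (f s) : R[i]) \in square_integrable mu.
Proof.
have [L L0 hL] := resolvent_fun_lipschitz Tdisc x r1.
have [B hB] := resolvent_fun_bounded Tdisc x r1.
exact: (weakly_L2_lipschitz L0 hL hB).
Qed.

Let mul3 (a b c : R[i]) : a * b * c = b * c * a.
Proof. by rewrite -mulrA mulrC. Qed.

Let partial_fun_app (phi : dual E) M s : phi (partial_fun M s) =
  \sum_(n < M) \sum_(k < N.+1) ((neumann_coefs n k)%:C * phi ((T ^+ n) (x k)) : R[i]) * fourier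
    n k s.
Proof.
rewrite /partial_fun linear_sum; apply: eq_bigr => n _; rewrite linear_sum; apply: eq_bigr => k _.
rewrite linearZ; exact: mul3.
Qed.

Lemma sq_partial_fun (phi : dual E) M : (fun s =>
  phi (partial_fun M s) : R[i]) \in square_integrable mu.
Proof.
under eq_fun do rewrite partial_fun_app.
by apply: sq_sum => n; apply: sq_sum => k; apply: sqZ; exact: sq_fourier.
Qed.

Lemma partial_op_app (phi : dual E) M (g : L2 mu) :
  phi (partial_op T x neumann_coefs M g) = cintegral mu (fun s =>
    L2_fun g s * phi (partial_fun M s)).
Proof.
have sE n k : cintegrable mu (fun s => L2_fun g s * fourier n k s).
  by apply: cintegrable_mul; [exact: sq_L2_fun|exact: sq_fourier].
transitivity (cintegral mu (fun s => \sum_(n < M) 1 * \sum_(k < N.+1)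
    ((neumann_coefs n k)%:C * phi ((T ^+ n) (x k)) : R[i]) * (L2_fun g s * fourier n k s))).
  rewrite cintegral_sum; last by move=> n; exact: cintegrable_sum.
  rewrite /partial_op linear_sum; apply: eq_bigr => n _.
  rewrite cintegral_sum// mul1r linear_sum; apply: eq_bigr => k _.
  rewrite linearZ; exact: mul3.
congr cintegral; apply/funext => s; rewrite partial_fun_app mulr_sumr; apply: eq_bigr => n _.
by rewrite mul1r mulr_sumr; apply: eq_bigr => k _; rewrite mulrCA.
Qed.

Lemma partial_op_approx : exists A q : R, [/\ 0 <= A, 0 <= q, q < 1 &
  forall (g : L2 mu) M (phi : dual E), rnorm (phi (partial_op T x neumann_coefs M g) -
     cintegral mu (fun s => L2_fun g s * phi (f s)) : R[i]^o) <= opnorm phi * L1 g * A * q ^+ M].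
Proof.
have [A [q [A0 q0 q1 hA]]] := partial_fun_approx.
exists (2 * A), q; split => //; first by rewrite mulr_ge0.
move=> g M phi.
have c1 : cintegrable mu (fun s => L2_fun g s * phi (partial_fun M s)).
  by apply: cintegrable_mul; [exact: sq_L2_fun|exact: sq_partial_fun].
have c2 : cintegrable mu (fun s => L2_fun g s * phi (f s)).
  by apply: cintegrable_mul; [exact: sq_L2_fun|exact: sq_fun].
rewrite partial_op_app rnormB_sym.
have -> : cintegral mu (fun s => L2_fun g s * phi (f s)) -
   cintegral mu (fun s => L2_fun g s * phi (partial_fun M s)) =
   cintegral mu (fun s => L2_fun g s * (phi (f s - partial_fun M s) : R[i])).
  rewrite addrC -mulN1r -cintegralZD//; congr cintegral; apply/funext => s.
  by rewrite linearB mulN1r addrC -mulrBr.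
have := @cintegral_L2_bound _ _ _ mu (circle_ord_fin N) g (fun s =>
  phi (f s - partial_fun M s) : R[i])
  (opnorm phi * (A * q ^+ M)) _ _ _.
move=> /(_ _ _ _)/le_trans h; apply: h.
- apply: sq_measurable.
  have -> : (fun s => phi (f s - partial_fun M s) : R[i]) =
     (fun s => (phi (f s) : R[i]) + (-1) * (phi (partial_fun M s) : R[i])).
    by apply/funext => s; rewrite linearB mulN1r.
  by apply: sqD; [exact: sq_fun|apply: sqZ; exact: sq_partial_fun].
- by rewrite mulr_ge0 ?opnorm_ge0// mulr_ge0// exprn_ge0.
- move=> s; apply: (le_trans (opnormP _ _)); rewrite ler_wpM2l ?opnorm_ge0//.
by rewrite le_eqVlt; apply/orP; left; apply/eqP; ring.
Qed.

Lemma resolvent_fun_pettis (g : L2 mu) :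
  (exists y, is_pettis_integral mu (fun s => L2_fun g s *: f s) y) /\
  rconverges (fun M => partial_op T x neumann_coefs M g) (pettis_op f g).
Proof.
have [A [q [A0 q0 q1 hA]]] := partial_op_approx.
set S := fun M => partial_op T x neumann_coefs M g.
have [y Sy] : exists y, rconverges S y.
  apply: Ecomp => e e0.
  have e20 : 0 < e / 2 by rewrite divr_gt0.
  have c0 : 0 <= L1 g * A by rewrite mulr_ge0 ?L1_ge0.
  have [M hM] := geometric_small_scaled c0 q0 q1 e20.
  exists M => n m /andP[Mn nm]; have [phi phi1 phie] := dual_norming (S m - S n).
  have p1 : opnorm phi <= 1.
    by apply: opnorm_le => w w1; exact: le_trans (phi1 _) w1.
  have -> : rnorm (S m - S n) = rnorm (phi (S m - S n)).
    by rewrite phie rnorm_real ger0_norm ?rnorm_ge0.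
  rewrite linearB; set I := cintegral mu (fun s => L2_fun g s * phi (f s)).
  have b k : (M <= k)%N -> rnorm ((phi (S k) : R[i]^o) - I) <= e / 2.
    move=> Mk; apply: (le_trans (hA _ _ _)); apply: le_trans (hM k Mk).
    by rewrite -!mulrA ler_piMl// !mulr_ge0 ?L1_ge0// exprn_ge0.
  have := rnormD ((phi (S m) : R[i]^o) - I) (I - phi (S n)); rewrite addrA subrK => /le_trans;
    apply.
  rewrite [X in _ + X]rnormB_sym.
  have := b m (leq_trans Mn nm); have := b n Mn; lra.
have yp : is_pettis_integral mu (fun s => L2_fun g s *: f s) y.
  move=> phi; apply: rconverges_unique (rconverges_bop phi Sy) _.
  have -> : (fun s => phi (L2_fun g s *: f s)) = (fun s => L2_fun g s * (phi (f s) : R[i])).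
    by apply/funext => s; rewrite linearZ.
  apply: (@rconverges_geometric _ _ _ _ (opnorm phi * L1 g * A) q) => // n; exact: hA.
by split; [exists y|rewrite /pettis_op (pettis_integral_eq yp)].
Qed.

End resolvent_pettis.

Section partial_op_algebra.
Context {R : realType} (E : normedModType R[i]) (T : bop E E).
Context (N : nat) (x : 'I_N.+1 -> E).
Notation mu := (@circle_ord_measure R N).

Definition cut M (c : nat -> 'I_N.+1 -> R) n k := if (n < M)%N then 0 else c n k.

Lemma partial_op_cut (c : nat -> 'I_N.+1 -> R) M m (g : L2 mu) : (M <= m)%N ->
  partial_op T x c m g - partial_op T x c M g = partial_op T x (cut M c) m g.
Proof.
move=> Mm; rewrite -(subnKC Mm); move: (m - M)%N => j.
rewrite /partial_op !big_split_ord /= addrAC subrr add0r [X in _ = X + _]big1 ?add0r.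
  by apply: eq_bigr => n _; apply: eq_bigr => k _; rewrite /cut ltnNge leq_addr.
by move=> n _; apply: big1 => k _; rewrite /cut ltn_ord mulr0 scale0r.
Qed.

Lemma partial_op0 c (g : L2 mu) : partial_op T x c 0 g = 0.
Proof. by rewrite /partial_op big_ord0. Qed.

Lemma fcoef_linear (a : R[i]) (g h : L2 mu) n k :
  fcoef (a *: g + h) n k = a * fcoef g n k + fcoef h n k.
Proof.
have ci (u : L2 mu) : cintegrable mu (fun s => L2_fun u s * fourier n k s).
  by apply: cintegrable_mul; [exact: sq_L2_fun|exact: sq_fourier].
rewrite /fcoef -cintegralZD//; apply: ae_eq_cintegral; first exact: cintegrable_measurable.
  by apply: cintegrable_measurable; exact: cintegrableZD.
by apply: filterS (L2_fun_linear a g h) => s ->; rewrite mulrDl mulrA.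
Qed.

Lemma partial_op_finite_rank c M : finite_rank (partial_op T x c M : L2 mu -> E).
Proof.
split.
  move=> a g h; rewrite /partial_op scaler_sumr -big_split; apply: eq_bigr => n _ /=.
  rewrite scaler_sumr -big_split; apply: eq_bigr => k _ /=.
  by rewrite fcoef_linear scalerA -scalerDl mulrDl mulrA.
pose p (i : 'I_#|{: 'I_M * 'I_N.+1}|) : 'I_M * 'I_N.+1 := enum_val i.
exists #|{: 'I_M * 'I_N.+1}|, (fun i => (T ^+ (p i).1) (x (p i).2)) => g.
exists (fun i => fcoef g (p i).1 (p i).2 * (c (p i).1 (p i).2)%:C).
exact: (pair_sum_ord (fun (n : 'I_M) k => (fcoef g n k * (c n k)%:C) *: (T ^+ n) (x k))).
Qed.

Lemma partial_op_bound c M : exists2 K : R, 0 <= K &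
  forall g : L2 mu, rnorm (partial_op T x c M g) <= K * L1 g.
Proof.
exists (\sum_(n < M) \sum_(k < N.+1) 2 * (rnorm ((c n k)%:C : R[i]^o) * rnorm ((T ^+ n) (x k)))).
  by apply: sumr_ge0 => n _; apply: sumr_ge0 => k _; rewrite mulr_ge0// mulr_ge0 ?rnorm_ge0.
move=> g; apply: (le_trans (rnorm_sum _)); rewrite mulr_suml; apply: ler_sum => n _.
apply: (le_trans (rnorm_sum _)); rewrite mulr_suml; apply: ler_sum => k _.
rewrite rnormZ rnormM.
have := @cintegral_L2_bound _ _ _ _ (circle_ord_fin N) g _ 1 (cmeasurable_fourier n k) ler01
  (rnorm_fourier n k).
rewrite -/(fcoef g n k) mulr1 => h.
have := ler_wpM2r (mulr_ge0 (rnorm_ge0 ((c n k)%:C : R[i]^o)) (rnorm_ge0 ((T ^+ n) (x k)))) h.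
by rewrite mulrA [X in _ <= X -> _]mulrAC.
Qed.

End partial_op_algebra.

Lemma rconverges_sum (R : realType) (E : normedModType R[i]) n (u : 'I_n -> nat -> E) (l : 'I_n
  -> E) :
  (forall j, rconverges (u j) (l j)) ->
  rconverges (fun m => \sum_(j < n) u j m) (\sum_(j < n) l j).
Proof.
elim: n u l => [|n IH] u l ul.
  rewrite big_ord0; under eq_fun do rewrite big_ord0.
  by move=> e e0; exists 0%N => m _; rewrite subrr rnorm0 ltW.
rewrite big_ord_recl; under eq_fun do rewrite big_ord_recl.
by apply: rconvergesD => //; apply: IH.
Qed.

Lemma rconverges_subr (R : realType) (E : normedModType R[i]) (u : nat -> E) l y :
  rconverges u l -> rconverges (fun n => u n - y) (l - y).
Proof.
move=> ul; apply: rconvergesD => // e e0; exists 0%N => n _.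
by rewrite subrr rnorm0 ltW.
Qed.

Section power_to_square_functions.
Context d (Sigma : measurableType d) (R : realType) (P : probability Sigma R).
Variable gam : nat -> Sigma -> R[i].
Hypothesis gamG : gaussian_sequence P gam.
Notation gnorm := (gauss_norm P gam).
Context (X : completeNormedModType R[i]) (T : bop X X) (C : R).
Hypothesis C0 : 0 <= C.
Hypothesis hC : forall L (n : 'I_L -> nat) (y : 'I_L -> X),
    (gnorm (fun i => (T ^+ n i)%R (y i)) <= C%:E * gnorm y)%E.
Context (N : nat) (r : 'I_N.+1 -> R) (r1 : forall k, 1 < r k).
Notation mu := (@circle_ord_measure R N).
Notation c := (neumann_coefs r).

Let Tdisc : spectrum_in_disc T := power_gamma_spectrum gamG C0 hC.

Lemma adjoint_spectrum (U : bop X X) : spectrum_in_disc U -> spectrum_in_disc (adjoint U).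
Proof.
by move=> Ud z zs; apply: Ud => -[S hS]; apply: zs; exists (adjoint S); exact: adjoint_resolvent.
Qed.

Let q_ex : exists2 q : R, 0 < q < 1 & forall k, (r k)^-1 <= q.
Proof.
have [m m1 hm] := lower_bound_gt1 r1; have m0 : 0 < m by exact: lt_trans m1.
exists m^-1; first by rewrite invr_gt0 m0 invf_lt1.
by move=> k; rewrite lef_pV2 ?posrE ?hm// (lt_trans ltr01).
Qed.

Let cut_bound q M m : (forall k, (r k)^-1 <= q) -> forall k : 'I_N.+1,
  \sum_(n < m) cut M c n k ^+ 2 <= (q ^+ M) ^+ 2.
Proof.
move=> hq k; apply: (le_trans (neumann_coef_sum M m (r1 k))).
have i0 : 0 <= (r k)^-1 by rewrite invr_ge0 ltW// (lt_trans ltr01).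
have q0 : 0 <= q by exact: le_trans (hq k).
by apply: lerXn2r; rewrite ?nnegrE ?exprn_ge0//; apply: lerXn2r.
Qed.

Section operator.
Context (x : 'I_N.+1 -> X).
Notation V := (pettis_op (resolvent_fun T r x) : L2 mu -> X).
Notation S := (partial_op T x c).

Let cv g := (resolvent_fun_pettis (rcomplete_complete (X := X)) Tdisc r1 x g).2.

Lemma gamma_norm_tail q M : 0 < q -> (forall k, (r k)^-1 <= q) ->
  (gamma_norm P gam (@L2_ip _ _ _ mu) (fun g => V g - S M g)%R <= (C * q ^+ M)%:E * gnorm x)%E.
Proof.
move=> q0 hq; have [k0 k00 single] := gauss_norm_single gamG.
apply: ge_ereal_sup => _ [L [h [onh ->]]].
have [phi phi1 ->] := gauss_norming gamG (fun j => V (h j) - S M (h j)).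
rewrite -(fineK (gauss_norm_fin_num gamG (single X) x)) -EFinM lee_fin.
have := @rconverges_sum _ _ _ (fun j m => phi j (S m (h j) - S M (h j)) : R[i]^o) _
  (fun j => rconverges_bop (phi j) (rconverges_subr (S M (h j)) (cv (h j)))).
move/rconverges_le; apply; exists M => m Mm; rewrite -lee_fin EFinM fineK; last first.
  exact: (gauss_norm_fin_num gamG (single X) x).
apply: (le_trans (gauss_trace_le gamG k00 (single X) phi (fun j => S m (h j) - S M (h j)))).
rewrite -[leRHS]mul1e; apply: lee_pmul => //;
  [exact: (gauss_dual_norm_ge0 gamG (single X) _)|exact: gauss_norm_ge0|].
under eq_gauss_norm do rewrite partial_op_cut//.
by apply: (gauss_norm_partial_op gamG C0 hC) => //; [exact: exprn_gt0|exact: cut_bound].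
Qed.

Lemma gamma_norm_resolvent_fun :
  (gamma_fun_norm P gam mu (resolvent_fun T r x) <= C%:E * gnorm x)%E.
Proof.
have [q /andP[q0 _] hq] := q_ex; have := gamma_norm_tail 0 q0 hq.
rewrite expr0 mulr1; congr (gamma_norm _ _ _ _ <= _)%E.
by apply/funext => g; rewrite partial_op0 subr0.
Qed.

Lemma gamma_fun_resolvent_fun : gamma_fun P gam mu (resolvent_fun T r x).
Proof.
have [k0 k00 single] := gauss_norm_single gamG.
have [Lc Lc0 hL] := resolvent_fun_lipschitz Tdisc x r1.
have [B hB] := resolvent_fun_bounded Tdisc x r1.
have wL : weakly_L2 mu (resolvent_fun T r x) := weakly_L2_lipschitz Lc0 hL hB.
have pe g := (resolvent_fun_pettis (rcomplete_complete (X := X)) Tdisc r1 x g).1.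
have xfin := gauss_norm_fin_num gamG (single X) x.
split; first by split => //; exact: strongly_measurable_lipschitz Lc0 hL.
split.
  split; first exact: pettis_op_linear.
  by apply: (le_lt_trans gamma_norm_resolvent_fun); rewrite -(fineK xfin) -EFinM ltry.
move=> e e0; have [q /andP[q0 q1] hq] := q_ex.
have a0 : 0 <= C * fine (gnorm x) by rewrite mulr_ge0// fine_ge0// gauss_norm_ge0.
have [M hM] := geometric_small_scaled a0 (ltW q0) q1 (divr_gt0 e0 (ltr0n _ 2)).
exists (S M); split; first exact: partial_op_finite_rank.
  split; first exact: (partial_op_finite_rank _ _ _ _).1.
  apply: (@le_lt_trans _ _ ((C * 1)%:E * gnorm x)%E); last by rewrite -(fineK xfin) -EFinM ltry.
  apply: ge_ereal_sup => _ [L [h [onh ->]]].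
  apply: (gauss_norm_partial_op gamG C0 hC) => // k.
  by have := cut_bound 0 M hq k; rewrite expr0.
apply: (le_lt_trans (gamma_norm_tail M q0 hq)); rewrite -(fineK xfin) -EFinM lte_fin.
have := hM M (leqnn M); rewrite mulrAC; lra.
Qed.

End operator.

Section dual.
Context (phi : 'I_N.+1 -> dual X).
Notation V := (pettis_op (resolvent_fun (adjoint T) r phi) : L2 mu -> dual X).
Notation S := (partial_op (adjoint T) phi c).
Notation dnorm := (gauss_dual_norm P gam phi).

Let Tdisc' := adjoint_spectrum Tdisc.
Let rp g := resolvent_fun_pettis (@rcomplete_dual R X) Tdisc' r1 phi g.

Lemma gamma'_norm_tail q M : 0 < q -> (forall k, (r k)^-1 <= q) ->
  (gamma'_norm P gam (@L2_ip _ _ _ mu) (fun g => V g - S M g)%R <= (C * q ^+ M)%:E * dnorm)%E.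
Proof.
move=> q0 hq; have [k0 k00 single] := gauss_norm_single gamG.
have pf := gauss_dual_norm_fin_num gamG k00 (single X) phi.
apply: ge_ereal_sup => _ [L [h [y [onh y1 ->]]]].
rewrite -(fineK pf) -EFinM lee_fin.
have cvj j : rconverges (fun m =>
  (S m (h j) - S M (h j)) (y j) : R[i]^o) ((V (h j) - S M (h j)) (y j)).
  apply: (@rconverges_lipschitz _ (dual X) R[i]^o (fun u : dual X => u (y j)) (rnorm (y j))).
  - exact: rnorm_ge0.
  - move=> u v; rewrite mulrC; exact: (opnormP (u - v) (y j)).
  - exact: rconverges_subr (rp (h j)).2.
have := rconverges_sum cvj.
move/rconverges_le; apply; exists M => m Mm; rewrite -lee_fin EFinM (fineK pf).
under eq_bigr do rewrite partial_op_cut//.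
apply: (gauss_trace_partial_op gamG C0 hC) => //; [exact: exprn_gt0|exact: cut_bound].
Qed.

Lemma gamma'_norm_resolvent_fun :
  (gamma'_fun_norm P gam mu (resolvent_fun (adjoint T) r phi) <= C%:E * dnorm)%E.
Proof.
have [q /andP[q0 _] hq] := q_ex; have := gamma'_norm_tail 0 q0 hq.
rewrite expr0 mulr1; congr (gamma'_norm _ _ _ _ <= _)%E.
by apply/funext => g; rewrite partial_op0 subr0.
Qed.

Lemma gamma'_fun_resolvent_fun : gamma'_fun P gam mu (resolvent_fun (adjoint T) r phi).
Proof.
have [k0 k00 single] := gauss_norm_single gamG.
have pf := gauss_dual_norm_fin_num gamG k00 (single X) phi.
have [Lc Lc0 hL] := resolvent_fun_lipschitz Tdisc' phi r1.
have [B hB] := resolvent_fun_bounded Tdisc' phi r1.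
have wL : weakly_L2 mu (resolvent_fun (adjoint T) r phi) := weakly_L2_lipschitz Lc0 hL hB.
have B0 : 0 <= B by exact: le_trans (rnorm_ge0 _) (hB (0, ord0)).
have [K K0 hK] : exists2 K : R, 0 <= K &
    forall g : L2 mu, L1 g <= K * Num.sqrt (complex.Re (L2_ip g g)).
  by apply: L1_le_ip; exact: circle_ord_fin.
have ipb (W : L2 mu -> dual X) (A : R) : 0 <= A -> (forall g, rnorm (W g) <= A * L1 g) ->
    exists A' : R, forall g, rnorm (W g) <= A' * Num.sqrt (complex.Re (L2_ip g g)).
  move=> A0 hA; exists (A * K) => g; apply: (le_trans (hA g)).
  by rewrite -mulrA ler_wpM2l.
split; first by split => //; [exact: strongly_measurable_lipschitz Lc0 hL|move=> g;
  exact: (rp g).1].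
split.
  split; first by apply: pettis_op_linear => // g; exact: (rp g).1.
    apply: (ipb _ (2 * B)); first by rewrite mulr_ge0.
    by apply: pettis_op_bound => //; [exact: circle_ord_fin|move=> g; exact: (rp g).1].
  by apply: (le_lt_trans gamma'_norm_resolvent_fun); rewrite -(fineK pf) -EFinM ltry.
move=> e e0; have [q /andP[q0 q1] hq] := q_ex.
have a0 : 0 <= C * fine dnorm.
  by rewrite mulr_ge0// fine_ge0// (gauss_dual_norm_ge0 gamG (single X)).
have [M hM] := geometric_small_scaled a0 (ltW q0) q1 (divr_gt0 e0 (ltr0n _ 2)).
exists (S M); split; first exact: partial_op_finite_rank.
  have [A A0 hA] := partial_op_bound (adjoint T) phi c M.
  split; [exact: (partial_op_finite_rank _ _ _ _).1|exact: ipb A0 hA|].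
  apply: (@le_lt_trans _ _ ((C * 1)%:E * dnorm)%E); last by rewrite -(fineK pf) -EFinM ltry.
  apply: ge_ereal_sup => _ [L [h [y [onh y1 ->]]]].
  apply: (gauss_trace_partial_op gamG C0 hC) => // k.
  by have := cut_bound 0 M hq k; rewrite expr0.
apply: (le_lt_trans (gamma'_norm_tail M q0 hq)); rewrite -(fineK pf) -EFinM lte_fin.
have := hM M (leqnn M); rewrite mulrAC; lra.
Qed.

End dual.
End power_to_square_functions.

Theorem power_gamma_bounded_square_functions d (Sigma : measurableType d) (R : realType)
  (P : probability Sigma R) (gam : nat -> Sigma -> R[i]) (X : completeNormedModType R[i])
  (T : bop X X) : gaussian_sequence P gam ->
  power_gamma_bounded P gam T -> resolvent_square_functions P gam T.
Proof.
move=> gamG /(power_gamma_family gamG)[C C0 hC].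
split; first exact: (power_gamma_spectrum gamG C0 hC).
exists (C + 1); first by rewrite ltr_wpDl.
move=> N r x phi r1; have [k0 k00 single] := gauss_norm_single gamG.
split.
- exact: (gamma_fun_resolvent_fun gamG C0 hC r1 x).
- exact: (gamma'_fun_resolvent_fun gamG C0 hC r1 phi).
- apply: (le_trans (gamma_norm_resolvent_fun gamG C0 hC r1 x)).
  by rewrite lee_wpmul2r ?gauss_norm_ge0// lee_fin lerDl.
- apply: (le_trans (gamma'_norm_resolvent_fun gamG C0 hC r1 phi)).
  by rewrite lee_wpmul2r ?(gauss_dual_norm_ge0 gamG (single X))// lee_fin lerDl.
Qed.

(** * From square functions to the GFS condition *)

Section step_functions.
Context {R : realType} (N n : nat).
Notation mR := (measurableTypeR R).
Notation mu := (@circle_ord_measure R N).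
Notation ST := (mR * 'I_N.+1)%type.
Notation leb := (@lebesgue_measure R).
Notation circle := (@circle_measure R).
Notation L := (n.+1%:R : R).

Definition circle_arc (l : nat) : set mR := `[2 * pi * l%:R / L, 2 * pi * l.+1%:R / L[%classic.

Definition cell (l : nat) (k : 'I_N.+1) : set ST := circle_arc l `*` [set k].

Lemma circle_arc_measurable l : measurable (circle_arc l).
Proof. exact: measurable_itv. Qed.

Lemma cell_measurable l k : measurable (cell l k).
Proof. by apply: measurableX; [exact: circle_arc_measurable|]. Qed.

Let L0 : 0 < L. Proof. by []. Qed.

Lemma arc_iff l t : circle_arc l t <-> l%:R <= t * L / (2 * pi) < l.+1%:R.
Proof.
have p0 := @two_pi_gt0 R.
by rewrite /circle_arc /= in_itv /= ler_pdivrMr// ltr_pdivlMr// ler_pdivlMr// ltr_pdivrMr// ![_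
  * (2 * pi)]mulrC.
Qed.

Lemma arc_inj l l' t : circle_arc l t -> circle_arc l' t -> l = l'.
Proof.
by move=> /arc_iff h /arc_iff h'; rewrite -(truncn_def h) -(truncn_def h').
Qed.

Lemma arc_cover t : 0 <= t < 2 * pi -> exists l : 'I_n.+1, circle_arc l t.
Proof.
move=> /andP[t0 t1]; have p0 := @two_pi_gt0 R.
have u0 : 0 <= t * L / (2 * pi) by rewrite divr_ge0 ?(ltW p0)// mulr_ge0.
have h := truncn_itv u0.
have lL : (Num.truncn (t * L / (2 * pi)) < n.+1)%N.
  rewrite -(ltr_nat R); have /andP[h1 _] := h; apply: (le_lt_trans h1).
  by rewrite ltr_pdivrMr// mulrC ltr_pM2l.
by exists (Ordinal lL); apply/arc_iff.
Qed.

Lemma lebesgue_arc l : leb (circle_arc l) = (2 * pi / L)%:E.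
Proof.
have p0 := @two_pi_gt0 R.
rewrite lebesgue_measure_itv /= lte_fin ltr_pM2r ?invr_gt0// ltr_pM2l// ltr_nat ltnSn.
by rewrite -EFinB -mulrBl -mulrBr -natrB// subSnn mulr1.
Qed.

Lemma arc_sub l : (l < n.+1)%N -> circle_arc l `<=` `[0, 2 * pi[%classic.
Proof.
move=> ln t; have p0 := @two_pi_gt0 R; rewrite /circle_arc /= !in_itv /= => /andP[h1 h2].
apply/andP; split; first by apply: le_trans h1; rewrite divr_ge0// mulr_ge0// ltW.
by apply: (lt_le_trans h2); rewrite ler_pdivrMr// ler_pM2l// ler_nat.
Qed.

Lemma cell_measure l k : (l < n.+1)%N -> mu (cell l k) = (L^-1)%:E.
Proof.
move=> ln; rewrite circle_ord_rect; last exact: circle_arc_measurable.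
rewrite circle_measureE (setIidl (arc_sub ln)) lebesgue_arc -EFinM mulrA mulVf ?mul1r//.
by rewrite gt_eqF// two_pi_gt0.
Qed.

Definition step_fun l k (s : ST) : R[i] := (Num.sqrt L * \1_(cell l k) s)%:C.

Lemma step_fun_cmeasurable l k : cmeasurable (step_fun l k).
Proof.
split; last exact: measurable_cst.
by apply: measurable_funM => //; apply: measurable_indic; exact: cell_measurable.
Qed.

Lemma step_fun_bound l k s : rnorm (step_fun l k s : R[i]^o) = Num.sqrt L * \1_(cell l k) s.
Proof. by rewrite /step_fun rnorm_real ger0_norm// mulr_ge0// sqrtr_ge0. Qed.

Lemma step_fun_sq l k : step_fun l k \in square_integrable mu.
Proof.
apply: (@bounded_sq _ _ _ _ (circle_ord_fin N) _ (Num.sqrt L)) => [|s].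
  exact: step_fun_cmeasurable.
by rewrite step_fun_bound ler_piMr ?sqrtr_ge0// indicE; case: (_ \in _).
Qed.

Lemma cell_integrable (a : R) l k : mu.-integrable setT (EFin \o (fun s => a * \1_(cell l k) s)).
Proof.
have b2 (b : R) : (fun s : ST => b * \1_(cell l k) s) \in Lfun mu 2%:E.
  apply: (@bounded_Lfun2 _ _ _ _ (circle_ord_fin N) _ `|b|) => [|s].
    by apply: measurable_funM => //; apply: measurable_indic; exact: cell_measurable.
  by rewrite normrM ler_piMr// indicE; case: (_ \in _); rewrite ?normr1 ?normr0.
have /Lfun1_integrable := Lfun2_mul_Lfun1 (b2 a) (b2 1).
have -> // : (fun s : ST => a * \1_(cell l k) s) \* (fun s : ST => 1 * \1_(cell l k) s) =
  (fun s => a * \1_(cell l k) s).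
by apply/funext => s /=; rewrite mul1r -mulrA indicE; case: (_ \in _); rewrite ?mulr1 ?mulr0.
Qed.

Lemma Rintegral_cell (a : R) l k : (l < n.+1)%N ->
  Rintegral mu setT (fun s => a * \1_(cell l k) s) = a / L.
Proof.
move=> ln; have i1 : mu.-integrable setT (EFin \o (\1_(cell l k) : ST -> R)).
  have := cell_integrable 1 l k; congr (mu.-integrable _ _).
  by apply/funext => s /=; rewrite mul1r.
rewrite (RintegralZl a measurableT i1); congr (_ * _).
by rewrite /Rintegral integral_indic//; [rewrite setIT cell_measure|exact: cell_measurable].
Qed.

Definition step_L2 l k : L2 mu := (\pi_(L2 mu) (L2Fun (step_fun_sq l k)))%qT.

Lemma step_L2_cintegral l k (u : ST -> R[i]) : cmeasurable u ->
  cintegral mu (fun s => L2_fun (step_L2 l k) s * u s) =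
  cintegral mu (fun s => step_fun l k s * u s).
Proof.
move=> mu'; apply: ae_eq_cintegral.
- by apply: cmeasurable_mul => //; apply: sq_measurable; exact: sq_L2_fun.
- by apply: cmeasurable_mul => //; exact: step_fun_cmeasurable.
by apply: filterS (L2_fun_pi (L2Fun (step_fun_sq l k))) => s ->.
Qed.

Lemma cintegral_step_fun l k : (l < n.+1)%N ->
  cintegral mu (step_fun l k) = (Num.sqrt L / L)%:C.
Proof.
move=> ln; rewrite /cintegral (Rintegral_cell _ k ln); congr (_ +i* _).
by rewrite /Rintegral integral0.
Qed.

Lemma step_L2_ortho l k l' k' : (l < n.+1)%N -> (l' < n.+1)%N ->
  L2_ip (step_L2 l k) (step_L2 l' k') = ((l == l') && (k == k'))%:R.
Proof.
move=> ln ln'; rewrite L2_ipE step_L2_cintegral; last first.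
  by apply: sq_measurable; apply: sq_conj; exact: sq_L2_fun.
transitivity (cintegral mu (fun s => step_fun l k s * (step_fun l' k' s)^*)).
  apply: ae_eq_cintegral.
  - apply: cmeasurable_mul; first exact: step_fun_cmeasurable.
    by apply: sq_measurable; apply: sq_conj; exact: sq_L2_fun.
  - apply: cmeasurable_mul; first exact: step_fun_cmeasurable.
    by apply: sq_measurable; apply: sq_conj; exact: step_fun_sq.
  by apply: filterS (L2_fun_pi (L2Fun (step_fun_sq l' k'))) => s ->.
have conjE l0 k0 s : (step_fun l0 k0 s)^*%R = step_fun l0 k0 s.
  by apply/eqP; rewrite eq_complex /= oppr0 !eqxx.
have [[<- <-]|ne] := pselect ((l, k) = (l', k')).
  rewrite !eqxx /=.
  have -> : (fun s => step_fun l k s * (step_fun l k s)^*) = (fun s => (L * \1_(cell l k) s)%:C).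
    apply/funext => s; rewrite conjE /step_fun -rmorphM; congr (_%:C).
    rewrite mulrACA -expr2 sqr_sqrtr// indicE; case: (_ \in _); rewrite ?mulr1 ?mulr0//.
  rewrite /cintegral (Rintegral_cell _ k ln) mulfV// /Rintegral /= integral0//.
have -> : (l == l') && (k == k') = false.
  by apply/negP => /andP[/eqP ll /eqP kk]; apply: ne; rewrite ll kk.
have -> : (fun s => step_fun l k s * (step_fun l' k' s)^*) = (fun=> 0); last exact: cintegral0.
apply/funext => s; rewrite conjE /step_fun -rmorphM mulrACA !indicE.
have [/set_mem[h1 h2]|] := boolP (s \in cell l k); last by rewrite mul0r mulr0.
have [/set_mem[h1' h2']|] := boolP (s \in cell l' k'); last by rewrite !mulr0.
by case: ne; rewrite (arc_inj h1 h1') -h2 -h2'.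
Qed.

End step_functions.

Section gamma_trace.
Context d (Sigma : measurableType d) (R : realType) (P : probability Sigma R).
Variable gam : nat -> Sigma -> R[i].
Hypothesis gamG : gaussian_sequence P gam.
Notation gnorm := (gauss_norm P gam).
Context (H : lmodType R[i]) (ip : H -> H -> R[i]) (X : normedModType R[i]).

Lemma phase (z : R[i]) : exists2 a : R[i], nsq a <= 1 & a * z = (rnorm (z : R[i]^o))%:C.
Proof.
have [->|z0] := eqVneq z 0.
  by exists 0; rewrite ?mul0r ?rnorm0// /nsq /= !expr0n addr0.
have n0 : rnorm (z : R[i]^o) != 0 by apply: contra_neq z0 => /rnorm0_eq0.
exists ((rnorm (z : R[i]^o))%:C / z); last by rewrite divfK.
rewrite -rnorm_nsq; suff -> : rnorm ((rnorm (z : R[i]^o))%:C / z : R[i]^o) = 1 by rewrite expr1n.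
apply: (mulIf n0); rewrite -rnormM divfK// rnorm_real ger0_norm ?rnorm_ge0// mul1r//.
Qed.

Lemma gamma_trace_le (V : H -> X) (W : H -> dual X) K (h : 'I_K -> H) :
  orthonormal_system ip h ->
  ((\sum_(j < K) rnorm (W (h j) (V (h j)) : R[i]^o))%:E <=
    gamma'_norm P gam ip W * gamma_norm P gam ip V)%E.
Proof.
move=> onh; have [k0 k00 single] := gauss_norm_single gamG.
have /choice[a ha] : forall j, exists a : R[i], nsq a <= 1 /\
    a * (W (h j) (V (h j)) : R[i]) = (rnorm (W (h j) (V (h j)) : R[i]^o))%:C.
  by move=> j; have [a a1 ae] := phase (W (h j) (V (h j))); exists a.
have -> : \sum_(j < K) rnorm (W (h j) (V (h j)) : R[i]^o) =
    rnorm (\sum_(j < K) W (h j) (a j *: V (h j)) : R[i]^o).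
  have -> : \sum_(j < K) W (h j) (a j *: V (h j)) =
      (\sum_(j < K) rnorm (W (h j) (V (h j)) : R[i]^o))%:C.
    rewrite rmorph_sum; apply: eq_bigr => j _ /=; rewrite -(ha j).2; exact: linearZ.
  by rewrite rnorm_real ger0_norm// sumr_ge0// => j _; rewrite rnorm_ge0.
apply: (le_trans (gauss_trace_le gamG k00 (single X) (fun j => W (h j)) (fun j => a j *: V (h j)))).
apply: lee_pmul; [exact: (gauss_dual_norm_ge0 gamG (single X))|exact: gauss_norm_ge0| |].
  apply: ge_ereal_sup => _ [y /= y1 <-]; apply: ereal_sup_ubound.
  by exists K, h, y.
apply: (@le_trans _ _ (gnorm (fun j => V (h j)))); last first.
  by apply: ereal_sup_ubound; exists K, h.
have -> : gnorm (fun j => a j *: V (h j)) =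
    gnorm (fun i => \sum_(j < K) (a i * (j == i)%:R) *: V (h j)).
  apply: eq_gauss_norm => i; rewrite (bigD1 i)//= eqxx mulr1 big1 ?addr0// => j /negbTE ->.
  by rewrite mulr0 scale0r.
apply: (gauss_norm_contraction gamG (A := fun i j => a i * (j == i)%:R)) => z.
apply: ler_sum => i _; rewrite (bigD1 i)//= eqxx mulr1 big1 ?addr0; last first.
  by move=> j /negbTE ->; rewrite mulr0 mul0r.
by rewrite -[leLHS]rnorm_nsq rnormM exprMn !rnorm_nsq ler_piMl ?nsq_ge0// (ha i).1.
Qed.

End gamma_trace.

Section pettis_step.
Context {R : realType} (N n : nat) (E : normedModType R[i]).
Notation mR := (measurableTypeR R).
Notation mu := (@circle_ord_measure R N).
Notation ST := (mR * 'I_N.+1)%type.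
Notation L := (n.+1%:R : R).

Lemma pettis_step (f : ST -> E) (K : R) l k t :
  0 <= K -> (forall k t t', rnorm (f (t', k) - f (t, k)) <= K * `|t' - t|) ->
  weakly_L2 mu f ->
  (forall g : L2 mu, exists y, is_pettis_integral mu (fun s => L2_fun g s *: f s) y) ->
  (l < n.+1)%N -> circle_arc n l t ->
  rnorm (pettis_op f (step_L2 n l k) - (Num.sqrt L)^-1%:C *: f (t, k)) <=
    4 * pi * K / (Num.sqrt L * L).
Proof.
move=> K0 fK fw fp ln tl; set y := pettis_op _ _; have p0 := @two_pi_gt0 R.
have L0 : 0 < L by [].
have s0 : 0 < Num.sqrt L by rewrite sqrtr_gt0.
have sE : Num.sqrt L / L = (Num.sqrt L)^-1.
  by rewrite -{2}(sqr_sqrtr (ltW L0)) expr2 invfM mulrA mulfV ?mul1r// gt_eqF.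
have [phi phi1 phie] := dual_norming (y - (Num.sqrt L)^-1%:C *: f (t, k)).
have -> : rnorm (y - (Num.sqrt L)^-1%:C *: f (t, k)) =
   rnorm (phi (y - (Num.sqrt L)^-1%:C *: f (t, k))).
  by rewrite phie rnorm_real ger0_norm ?rnorm_ge0.
pose u s : R[i] := phi (f s).
have mu' : cmeasurable u by exact/sq_measurable/fw.
have one2 : (fun _ : ST => 1) \in square_integrable mu.
  apply: (@bounded_sq _ _ _ _ (circle_ord_fin N) _ 1) => [|s]; last by rewrite /rnorm normr1.
  exact: cmeasurable_cst.
have -> : phi (y - (Num.sqrt L)^-1%:C *: f (t, k)) =
    cintegral mu (fun s => step_fun n l k s * (u s - u (t, k))).
  have c1 : cintegrable mu (step_fun n l k).
    have := cintegrable_mul (step_fun_sq n l k) one2.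
    by under eq_fun do rewrite mulr1.
  have c2 : cintegrable mu (fun s => step_fun n l k s * u s).
    by apply: cintegrable_mul; [exact: step_fun_sq|exact: fw].
  rewrite linearB linearZ /= (pettis_opE (fp _)) step_L2_cintegral//.
  transitivity ((- u (t, k)) * cintegral mu (step_fun n l k) +
      cintegral mu (fun s => step_fun n l k s * u s)).
    by rewrite cintegral_step_fun// sE [RHS]addrC mulNr [u _ * _]mulrC.
  rewrite -cintegralZD//; congr cintegral; apply/funext => s.
  by rewrite mulrBr addrC mulNr [X in _ - X = _]mulrC.
have -> : 4 * pi * K / (Num.sqrt L * L) =
    2 * Rintegral mu setT (fun s => (Num.sqrt L * (K * (2 * pi / L))) * \1_(cell n l k) s).
  rewrite (Rintegral_cell _ k ln) invfM -sE; ring.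
apply: rnorm_cintegral_le; last 1 first.
- move=> s; rewrite rnormM step_fun_bound -!mulrA ler_wpM2l ?sqrtr_ge0// mulrC.
  rewrite indicE; have [/set_mem[h1 h2]|_] := boolP (s \in cell n l k); last by rewrite !mulr0.
  rewrite !mulr1 /u.
  rewrite [X in rnorm X <= _](_ : _ = phi (f s - f (t, k))); last by rewrite linearB.
  apply: (le_trans (phi1 _)); move: h1 h2; case: s => t' k' /= h1 ->.
  apply: (le_trans (fK _ _ _)); rewrite ler_wpM2l//.
  move: tl h1; rewrite /circle_arc /= !in_itv /= => /andP[a1 a2] /andP[b1 b2].
  have e : 2 * pi * l.+1%:R / L = 2 * pi * l%:R / L + 2 * pi / L.
    by rewrite -[l.+1%:R]natr1 mulrDr mulr1 mulrDl.
  move: a1 a2 b1 b2; rewrite e (mulrA 2 pi);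
    move: (2 * pi * l%:R / L) (2 * pi / L) => a b a1 a2 b1 b2.
  by rewrite ler_norml; apply/andP; split; lra.
- apply: cmeasurable_mul; first exact: step_fun_cmeasurable.
  have -> : (fun s => u s - u (t, k)) = (fun s => u s + (-1) * u (t, k) * 1).
    by apply/funext => s; rewrite mulr1 mulN1r.
  by apply: sq_measurable; apply: sqD; [exact: fw|apply: sqZ].
- exact: cell_integrable.
Qed.

End pettis_step.

Lemma scaled_product_bound (R : realType) (L s pi' Kf Kg Bf Bg df dg yn p : R) :
  0 < s -> s * s = L -> 1 <= L -> 0 <= pi' -> 0 <= Kf -> 0 <= Kg -> 0 <= Bf -> 0 <= Bg ->
  df = pi' * Kf / (s * L) -> dg = pi' * Kg / (s * L) -> yn <= s^-1 * Bf + df ->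
  L * (p + (dg * yn + s^-1 * Bg * df)) <=
  L * p + (pi' * Kg * (Bf + pi' * Kf) + pi' * Bg * Kf) / L.
Proof.
move=> s0 sL L1 p0 Kf0 Kg0 Bf0 Bg0 -> -> yn_le.
have L0 : 0 < L by exact: lt_le_trans L1.
have sn : s != 0 by rewrite gt_eqF.
have Ln : L != 0 by rewrite gt_eqF.
rewrite mulrDr lerD2l.
have dg0 : 0 <= pi' * Kg / (s * L).
  by apply: divr_ge0; [exact: mulr_ge0|rewrite mulr_ge0 ?ltW].
apply: (@le_trans _ _ (L * (pi' * Kg / (s * L) * (s^-1 * Bf + pi' * Kf / (s * L)) +
    s^-1 * Bg * (pi' * Kf / (s * L))))).
  by rewrite ler_pM2l// lerD2r ler_wpM2l.
have -> : L * (pi' * Kg / (s * L) * (s^-1 * Bf + pi' * Kf / (s * L)) +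
    s^-1 * Bg * (pi' * Kf / (s * L))) =
    (pi' * Kg * (Bf + pi' * Kf / L) + pi' * Bg * Kf) / L.
  by rewrite -sL; field; rewrite sn.
rewrite ler_pM2r ?invr_gt0// lerD2r ler_wpM2l ?mulr_ge0// lerD2l.
by rewrite ler_pdivrMr// ler_peMr// mulr_ge0.
Qed.

Lemma square_scale_cancel (R : realType) (a s : R) (c : R[i]) : s != 0 -> s * s = a ->
  a%:C * (s^-1%:C * (s^-1%:C * c)) = c.
Proof.
move=> s0 <-; rewrite mulrA -rmorphM mulrA -rmorphM mulfK// mulfV//.
by rewrite mul1r.
Qed.

Section step_integral.
Context {R : realType} (n : nat).
Notation mR := (measurableTypeR R).
Notation leb := (@lebesgue_measure R).
Notation L := (n.+1%:R : R).

Lemma integral_step_le (w : mR -> R) (b : 'I_n.+1 -> R) (e : R) :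
  measurable_fun setT w -> (forall t, 0 <= w t) -> (forall l, 0 <= b l) -> 0 <= e ->
  (forall (l : 'I_n.+1) t, circle_arc n l t -> w t <= L * b l + e) ->
  (\int[leb]_(t in `[0%R, (2 * pi)%R[) (w t)%:E <= (2 * pi * (\sum_(l < n.+1) b l + e))%:E)%E.
Proof.
move=> mw w0 b0 e0 hw; have p0 := @two_pi_gt0 R.
pose D : set mR := `[0, 2 * pi[%classic.
have mD : measurable D by exact: measurable_itv.
have lD : leb D = (2 * pi)%:E by rewrite lebesgue_measure_itv /= lte_fin p0 oppr0 adde0.
have mi (l : 'I_n.+1) : measurable_fun D (fun t : mR => (\1_(circle_arc n l) t)%:E : \bar R).
  by apply/measurable_EFinP/measurable_funTS; apply: measurable_indic; exact: circle_arc_measurable.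
have mF (l : 'I_n.+1) : measurable_fun D (fun t : mR =>
  (L * b l)%:E * (\1_(circle_arc n l) t)%:E : \bar R)%E.
  by apply: emeasurable_funM => //; exact: measurable_cst.
have F0 (l : 'I_n.+1) (t : mR) : D t -> (0 <= (L * b l)%:E * (\1_(circle_arc n l) t)%:E)%E.
  by move=> _; rewrite -EFinM lee_fin mulr_ge0// mulr_ge0.
apply: (@le_trans _ _ (\int[leb]_(t in D) (\sum_(l < n.+1) (L * b l)%:E * (\1_(circle_arc n l)
  t)%:E + cst e%:E t))%E).
  apply: ge0_le_integral => //.
  - by move=> t _; rewrite lee_fin.
  - by apply/measurable_EFinP; exact: measurable_funTS.
  - apply: emeasurable_funD; [exact: emeasurable_sum|exact: measurable_cst].
  move=> t tD; have [l lt] : exists l : 'I_n.+1, circle_arc n l t.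
    by apply: arc_cover; move: tD; rewrite /D /= in_itv.
  apply: (@le_trans _ _ (L * b l + e)%:E); first by rewrite lee_fin hw.
  rewrite EFinD leeD2r// (bigD1 l)//= indicE mem_set// mule1 leeDl// sume_ge0// => j _.
  exact: F0.
have S0 (t : mR) : D t -> (0 <= \sum_(l < n.+1) (L * b l)%:E * (\1_(circle_arc n l) t)%:E)%E.
  by move=> tD; apply: sume_ge0 => l _; exact: F0.
have mS : measurable_fun D (fun t : mR =>
  \sum_(l < n.+1) (L * b l)%:E * (\1_(circle_arc n l) t)%:E)%E.
  exact: emeasurable_sum.
rewrite (ge0_integralD leb mD S0 mS (fun t _ => e0 : (0 <= cst e%:E t)%E) (measurable_cst _)).
have ec : (\int[leb]_(t in D) cst e%:E t = (2 * pi * e)%:E)%E.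
  rewrite integral_cst//; transitivity (e%:E * (2 * pi)%:E)%E; last by rewrite -EFinM mulrC.
  by congr (_ * _)%E; exact: lD.
rewrite ge0_integral_sum// ec (mulrDr (2 * pi)) EFinD leeD2r//.
rewrite mulr_sumr -sumEFin; apply: lee_sum => l _.
rewrite ge0_integralZl_EFin//; last by rewrite mulr_ge0.
rewrite integral_indic//; last exact: circle_arc_measurable.
rewrite (setIidl (arc_sub (ltn_ord l))).
apply: (@le_trans _ _ ((L * b l)%:E * (2 * pi / L)%:E)%E).
  by rewrite le_eqVlt; apply/orP; left; apply/eqP; congr (_ * _)%E; exact: lebesgue_arc.
rewrite -EFinM lee_fin.
have Ln : L != 0 by rewrite pnatr_eq0.
have -> : L * b l * (2 * pi / L) = 2 * pi * b l by field.
by [].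
Qed.

End step_integral.

Section dual_pairing.
Context {R : realType} (X : normedModType R[i]) (T : bop X X).

Lemma dual_scaleE (a : R[i]) (psi : dual X) y : (a *: psi) y = a * (psi y : R[i]) :> R[i].
Proof. by []. Qed.

Lemma adjointE (S : bop X X) (psi : dual X) y : adjoint S psi y = psi (S y).
Proof. by []. Qed.

Lemma dualZ (a : R[i]) (psi : dual X) y : psi (a *: y) = a * (psi y : R[i]) :> R[i].
Proof. by rewrite linearZ. Qed.

Lemma dualB (psi : dual X) y z : psi (y - z) = (psi y : R[i]) - (psi z : R[i]) :> R[i].
Proof. by rewrite linearB. Qed.

Lemma dualBl (p q : dual X) y : (p - q) y = (p y : R[i]) - (q y : R[i]) :> R[i].
Proof. by []. Qed.

Lemma pairingB (p q : dual X) a b :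
  (p a : R[i]) - (q b : R[i]) = (p (a - b) : R[i]) + ((p - q) b : R[i]).
Proof. by rewrite dualB dualBl addrA subrK. Qed.

Lemma resolvent_adjoint z : is_resolvent T z (resolvent z T) ->
  resolvent z (adjoint T) = adjoint (resolvent z T).
Proof. by move=> h; apply: resolvent_eq; exact: adjoint_resolvent. Qed.

Lemma adjoint_pairing (S : bop X X) (c : R) (psi : dual X) y :
  (c%:C *: adjoint S psi) (c%:C *: S y) = psi ((c ^+ 2)%:C *: S (S y)) :> R[i].
Proof.
apply: (etrans (dual_scaleE _ _ _)).
by rewrite adjointE linearZ !dualZ mulrA -rmorphM -expr2.
Qed.

Lemma bop_pow2 (S : bop X X) y : bop_pow S 2 y = S (S y).
Proof. by rewrite bop_powE expr2. Qed.

End dual_pairing.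

Section square_functions_to_GFS.
Context d (Sigma : measurableType d) (R : realType) (P : probability Sigma R).
Variable gam : nat -> Sigma -> R[i].
Hypothesis gamG : gaussian_sequence P gam.
Notation gnorm := (gauss_norm P gam).
Context (X : completeNormedModType R[i]) (T : bop X X).
Hypothesis Tdisc : spectrum_in_disc T.
Context (N : nat) (r : 'I_N.+1 -> R) (r1 : forall k, 1 < r k).
Context (x : 'I_N.+1 -> X) (phi : 'I_N.+1 -> dual X).
Notation mR := (measurableTypeR R).
Notation mu := (@circle_ord_measure R N).
Notation f := (resolvent_fun T r x).
Notation g := (resolvent_fun (adjoint T) r phi).
Notation V := (pettis_op f : L2 mu -> X).
Notation W := (pettis_op g : L2 mu -> dual X).

Let Tdisc' := adjoint_spectrum Tdisc.

Lemma resolvent_fun_pairing (t : mR) k :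
  g (t, k) (f (t, k)) = phi k (((r k + 1) * (r k - 1) ^+ 1)%:C *:
    bop_pow (resolvent ((r k)%:C * expi t) T) 2 (x k)) :> R[i].
Proof.
have -> : (r k + 1) * (r k - 1) ^+ 1 = Num.sqrt (r k ^+ 2 - 1) ^+ 2.
  by rewrite sqr_sqrtr ?subr_ge0 ?exprn_ege1 ?ltW// expr1; ring.
rewrite bop_pow2 -adjoint_pairing -resolvent_adjoint//.
exact: (circle_resolvent Tdisc t (r1 k)).
Qed.

Hypothesis fL2 : pettis_L2 mu f.
Hypothesis gL2 : pettis_L2 mu g.

Lemma pairing_step : exists2 A : R, 0 <= A & forall n (l : 'I_n.+1) k t, circle_arc n l t ->
  rnorm (g (t, k) (f (t, k)) : R[i]^o) <=
  n.+1%:R * rnorm (W (step_L2 n l k) (V (step_L2 n l k)) : R[i]^o) + A / n.+1%:R.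
Proof.
have [Kf Kf0 hKf] := resolvent_fun_lipschitz Tdisc x r1.
have [Kg Kg0 hKg] := resolvent_fun_lipschitz Tdisc' phi r1.
have [Bf hBf] := resolvent_fun_bounded Tdisc x r1.
have [Bg hBg] := resolvent_fun_bounded Tdisc' phi r1.
have Bf0 : 0 <= Bf by exact: le_trans (rnorm_ge0 _) (hBf (0, ord0)).
have Bg0 : 0 <= Bg by exact: le_trans (rnorm_ge0 _) (hBg (0, ord0)).
have p0 : 0 <= 4 * pi :> R by rewrite mulr_ge0// pi_ge0.
exists (4 * pi * Kg * (Bf + 4 * pi * Kf) + 4 * pi * Bg * Kf).
  by rewrite addr_ge0// mulr_ge0// ?addr_ge0// mulr_ge0.
move=> n l k t tl; set L : R := n.+1%:R; set s := Num.sqrt L.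
have L0 : 0 < L by [].
have s0 : 0 < s by rewrite sqrtr_gt0.
have ss : s * s = L by rewrite -expr2 sqr_sqrtr.
set y := V _; set psi := W _.
have [_ fw fp] := fL2; have [_ gw gp] := gL2.
have hf := pettis_step k Kf0 hKf fw fp (ltn_ord l) tl; rewrite -/y -/L -/s in hf.
have hg := pettis_step k Kg0 hKg gw gp (ltn_ord l) tl; rewrite -/psi -/L -/s in hg.
set f0 := f (t, k) in hf *; set g0 := g (t, k) in hg *.
have si0 : 0 <= s^-1 by rewrite invr_ge0 ltW.
have yn : rnorm y <= s^-1 * Bf + 4 * pi * Kf / (s * L).
  rewrite -[y](subrK (s^-1%:C *: f0)); apply: (le_trans (rnormD _ _)); rewrite addrC lerD//.
  by rewrite rnorm_real_scale// ler_wpM2l//; exact: hBf.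
apply: le_trans (scaled_product_bound (rnorm (psi y : R[i]^o)) s0 ss _ p0 Kf0 Kg0 Bf0 Bg0 erefl
  erefl yn); last first.
  by rewrite /L ler1n.
have -> : g0 f0 = L%:C *: (psi y - ((psi - s^-1%:C *: g0) y +
    (s^-1%:C *: g0) (y - s^-1%:C *: f0))) :> R[i]^o.
  have e1 : (psi - s^-1%:C *: g0) y = (psi y : R[i]) - s^-1%:C * (g0 y : R[i]) :> R[i].
    by rewrite dualBl; congr (_ - _); exact: dual_scaleE.
  have e2 : (s^-1%:C *: g0) (y - s^-1%:C *: f0) =
      s^-1%:C * ((g0 y : R[i]) - s^-1%:C * (g0 f0 : R[i])).
    by apply: (etrans (dual_scaleE _ _ _)); rewrite dualB dualZ.
  rewrite e1 e2 [RHS]/(_ * _); move: (psi y : R[i]) (g0 y : R[i]) (g0 f0 : R[i]) => a b c.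
  have -> : a - (a - s^-1%:C * b + s^-1%:C * (b - s^-1%:C * c)) = s^-1%:C * (s^-1%:C * c).
    by ring.
  exact: (esym (square_scale_cancel c (lt0r_neq0 s0) ss)).
rewrite (rnorm_real_scale _ (ltW L0)) ler_pM2l//.
apply: (le_trans (rnormD _ _)); rewrite lerD2l -[X in rnorm X]/(- _) rnormN.
apply: (le_trans (rnormD _ _)); apply: lerD.
  by apply: (le_trans (opnormP _ _)); rewrite ler_wpM2r ?rnorm_ge0.
apply: (le_trans (opnormP _ _)).
apply: ler_pM; rewrite ?rnorm_ge0 ?opnorm_ge0//.
rewrite -[leLHS]/(rnorm (s^-1%:C *: g0)) rnorm_real_scale// ler_wpM2l//.
exact: hBg.
Qed.

Lemma pairing_measurable k : measurable_fun setT (fun t : mR =>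
  rnorm (g (t, k) (f (t, k)) : R[i]^o) : mR).
Proof.
have [Kf Kf0 hKf] := resolvent_fun_lipschitz Tdisc x r1.
have [Kg Kg0 hKg] := resolvent_fun_lipschitz Tdisc' phi r1.
have [Bf hBf] := resolvent_fun_bounded Tdisc x r1.
have [Bg hBg] := resolvent_fun_bounded Tdisc' phi r1.
have Bf0 : 0 <= Bf by exact: le_trans (rnorm_ge0 _) (hBf (0, ord0)).
have Bg0 : 0 <= Bg by exact: le_trans (rnorm_ge0 _) (hBg (0, ord0)).
apply: cmeasurable_rnorm.
apply: (@cmeasurable_lipschitz _ _ (Bg * Kf + Kg * Bf)); first by rewrite addr_ge0 ?mulr_ge0.
move=> t t'.
rewrite pairingB.
apply: (le_trans (rnormD _ _)); rewrite mulrDl; apply: lerD.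
  apply: (le_trans (opnormP _ _)); rewrite -mulrA; apply: ler_pM => //;
    [exact: opnorm_ge0|exact: rnorm_ge0|exact: hBg].
apply: (le_trans (opnormP _ _)); rewrite mulrAC; apply: ler_pM => //;
  [exact: opnorm_ge0|exact: rnorm_ge0|exact: hKg].
Qed.

Lemma square_functions_integral (C : R) : 0 <= C ->
  (gamma_fun_norm P gam mu f <= C%:E * gnorm x)%E ->
  (gamma'_fun_norm P gam mu g <= C%:E * gauss_dual_norm P gam phi)%E ->
  (\sum_(k < N.+1) \int[lebesgue_measure]_(t in `[0%R, (2 * pi)%R[)
     (rnorm (g (t, k) (f (t, k)) : R[i]^o))%:E
   <= (2 * pi * (C * C))%:E * (gnorm x * gauss_dual_norm P gam phi))%E.
Proof.
move=> C0 hf hg; have [k0 k00 single] := gauss_norm_single gamG.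
have p0 := @two_pi_gt0 R.
have xf := gauss_norm_fin_num gamG (single X) x.
have pf := gauss_dual_norm_fin_num gamG k00 (single X) phi.
rewrite -(fineK xf) -(fineK pf) -!EFinM in hf hg *.
set a := fine _ in hf hg *; set b := fine _ in hg *.
have a0 : 0 <= a by rewrite fine_ge0// gauss_norm_ge0.
have b0 : 0 <= b by rewrite fine_ge0// (gauss_dual_norm_ge0 gamG (single X)).
have [A A0 hA] := pairing_step.
have main n : (\sum_(k < N.+1) \int[lebesgue_measure]_(t in `[0%R, (2 * pi)%R[)
     (rnorm (g (t, k) (f (t, k)) : R[i]^o))%:E
   <= (2 * pi * (C * C) * (a * b) + 2 * pi * N.+1%:R * A / n.+1%:R)%:E)%E.
  pose c (l : 'I_n.+1) k := rnorm (W (step_L2 n l k) (V (step_L2 n l k)) : R[i]^o).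
  have c0 l k : 0 <= c l k by exact: rnorm_ge0.
  have cab : \sum_(l < n.+1) \sum_(k < N.+1) c l k <= (C * b) * (C * a).
    rewrite pair_sum_ord -lee_fin.
    pose h (i : 'I_#|{: 'I_n.+1 * 'I_N.+1}|) : L2 mu := step_L2 n (enum_val i).1 (enum_val i).2.
    have onh : orthonormal_system (@L2_ip _ _ _ mu) h.
      move=> i j; rewrite /h step_L2_ortho//; congr (_ %:R); congr nat_of_bool.
      by rewrite -(inj_eq enum_val_inj) -pair_eqE.
    apply: (le_trans (gamma_trace_le gamG V W onh)); rewrite EFinM.
    have on0 : orthonormal_system (@L2_ip _ _ _ mu) (fun _ : 'I_0 => 0) by case.
    apply: lee_pmul => //; apply: ereal_sup_ge.
      exists 0%E => //; exists 0%N, (fun=> 0), (fun=> 0); split => //;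
        last by rewrite big_ord0 rnorm0.
      by apply: (le_trans (gauss_norm_le_sum gamG (single X) _)); rewrite big_ord0 mulr0 lee_fin.
    exists (gnorm (fun j : 'I_0 => V ((fun=> 0) j))); last exact: gauss_norm_ge0.
    by exists 0%N, (fun=> 0).
  apply: (@le_trans _ _ (\sum_(k < N.+1) (2 * pi * (\sum_(l < n.+1) c l k + A / n.+1%:R))%:E)%E).
    apply: lee_sum => k _; apply: integral_step_le.
    - exact: pairing_measurable.
    - by move=> t; exact: rnorm_ge0.
    - by move=> l; exact: c0.
    - by rewrite divr_ge0.
    - by move=> l t tl; exact: hA.
  have e : \sum_(k < N.+1) 2 * pi * (\sum_(l < n.+1) c l k + A / n.+1%:R) =
      2 * pi * (\sum_(l < n.+1) \sum_(k < N.+1) c l k) + 2 * pi * N.+1%:R * A / n.+1%:R.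
    rewrite -mulr_sumr big_split /= exchange_big /= sumr_const card_ord -[_ *+ N.+1]mulr_natl.
    by rewrite mulrDr !mulrA.
  rewrite sumEFin lee_fin e lerD2r -[leRHS]mulrA ler_pM2l//.
  by apply: (le_trans cab); rewrite le_eqVlt; apply/orP; left; apply/eqP; ring.
apply/lee_addgt0Pr => e e0.
have K0 : 0 <= 2 * pi * N.+1%:R * A by rewrite mulr_ge0// mulr_ge0// ltW.
pose n := Num.bound (2 * pi * N.+1%:R * A / e).
apply: (le_trans (main n)); rewrite -EFinD lee_fin lerD2l ler_pdivrMr// [e * _]mulrC -ler_pdivrMr//.
have hb := archi_boundP (divr_ge0 K0 (ltW e0)).
by apply: (le_trans (ltW hb)); rewrite ler_nat.
Qed.

End square_functions_to_GFS.

Theorem square_functions_GFS d (Sigma : measurableType d) (R : realType)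
  (P : probability Sigma R) (gam : nat -> Sigma -> R[i]) (X : completeNormedModType R[i])
  (T : bop X X) : gaussian_sequence P gam ->
  resolvent_square_functions P gam T -> gamma_GFS P gam 1 T.
Proof.
move=> gamG [Tdisc [C C0 hC]]; split => //.
exists (2 * pi * (C * C)); first by rewrite !mulr_gt0// pi_gt0.
move=> N r x phi r1; have [[fL2 _] [gL2 _] hf hg] := hC N r x phi r1.
have := square_functions_integral gamG Tdisc r1 fL2 gL2 (ltW C0) hf hg.
congr (_ <= _)%E; apply: eq_bigr => k _; apply: eq_integral => t _.
by rewrite resolvent_fun_pairing.
Qed.

(** * From the GFS condition to power gamma-boundedness *)

Lemma succ_ratio_power_bound (R : realType) n : (1 + n.+1%:R^-1 : R) ^+ n.+2 <= 2 * expR 1.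
Proof.
have n0 : 0 < n.+1%:R :> R by [].
have r0 : 0 <= 1 + n.+1%:R^-1 :> R by rewrite addr_ge0// invr_ge0 ltW.
rewrite exprS; apply: ler_pM; [exact: r0|exact: exprn_ge0| |].
  by rewrite -[leRHS]/(1 + 1) lerD2l invf_le1// ler1n.
have -> : expR 1 = expR n.+1%:R^-1 ^+ n.+1 :> R.
  by rewrite -expRM_natl mulfV// gt_eqF.
by apply: lerXn2r; rewrite ?nnegrE ?expR_ge0// expR_ge1Dx.
Qed.

Section power_integral.
Context {R : realType} (X : normedModType R[i]) (T : bop X X).
Hypothesis Tdisc : spectrum_in_disc T.
Notation mR := (measurableTypeR R).
Notation circle := (@circle_measure R).
Notation cres := (cres T).
Context (r : R) (r1 : 1 < r).

Let r0 : 0 < r. Proof. exact: lt_trans r1. Qed.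
Let z t : R[i] := r%:C * expi t.
Let z0 t : z t != 0.
Proof. by rewrite mulf_neq0 ?expi_neq0// fmorph_eq0 gt_eqF. Qed.

Lemma resolvent_square_cmeasurable (phi : dual X) x :
  cmeasurable (fun t : mR => phi ((cres r t ^+ 2) x) : R[i]).
Proof.
have [B B0 hB] := circle_bounded_all Tdisc r1.
have [L L0 hL] := cres_lipschitz Tdisc r1.
apply: (@cmeasurable_lipschitz _ _ (opnorm phi * (2 * B * L * rnorm x))).
  by rewrite mulr_ge0 ?opnorm_ge0// mulr_ge0 ?rnorm_ge0// !mulr_ge0 ?ltW.
move=> t t'; rewrite -dualB; apply: (le_trans (opnormP _ _)).
rewrite -mulrA ler_wpM2l ?opnorm_ge0//.
have -> : (cres r t' ^+ 2) x - (cres r t ^+ 2) x = (cres r t' ^+ 2 - cres r t ^+ 2) x by [].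
apply: (le_trans (opnormP _ _)); rewrite mulrAC ler_wpM2r ?rnorm_ge0//.
have -> : cres r t' ^+ 2 - cres r t ^+ 2 =
    cres r t' * (cres r t' - cres r t) + (cres r t' - cres r t) * cres r t.
  by rewrite !expr2 mulrBr mulrBl addrA subrK.
apply: (le_trans (opnorm_triangle _ _)).
have -> : 2 * B * L * `|t' - t| = B * (L * `|t' - t|) + (L * `|t' - t|) * B by ring.
by apply: lerD; apply: (le_trans (opnormM _ _)); apply: ler_pM; rewrite ?opnorm_ge0.
Qed.

Lemma resolvent_square_bounded (phi : dual X) x : exists B : R,
  forall t, rnorm (phi ((cres r t ^+ 2) x) : R[i]^o) <= B.
Proof.
have [B B0 hB] := circle_bounded_all Tdisc r1.
exists (opnorm phi * (B ^+ 2 * rnorm x)) => t.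
apply: (le_trans (opnormP _ _)); rewrite ler_wpM2l ?opnorm_ge0//.
apply: (le_trans (opnormP _ _)); rewrite ler_wpM2r ?rnorm_ge0//.
apply: (le_trans (opnormX _ _)); apply: lerXn2r; rewrite ?nnegrE ?opnorm_ge0//.
exact: ltW.
Qed.

Lemma neumann_square_approx : exists c q : R, [/\ 0 <= c, 0 <= q, q < 1 &
  forall M t, opnorm (cres r t ^+ 2 - neumann T (z t) M ^+ 2) <= c * q ^+ M].
Proof.
have r1' := r1; pose rho := (1 + r) / 2; have rho1 : 1 < rho by rewrite /rho; lra.
have rhor : rho < r by rewrite /rho; lra.
have [K K0 hK] := power_growth Tdisc rho1.
have [B B0 hB] := circle_bounded_all Tdisc r1.
have q0 : 0 <= rho / r by rewrite divr_ge0 ?ltW// (lt_trans ltr01).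
have q1 : rho / r < 1 by rewrite ltr_pdivrMr// mul1r.
exists (B * K * (B + (B + B * K))), (rho / r); split => //.
  by rewrite !mulr_ge0 ?addr_ge0 ?mulr_ge0 ?ltW.
move=> M t; set S := neumann T (z t) M; set Q := cres r t.
have d : opnorm (Q - S) <= B * K * (rho / r) ^+ M.
  rewrite (resolvent_neumann M (z0 t) (circle_resolvent Tdisc t r1)) opnorm_scale.
  have -> : rnorm ((z t)^-1 ^+ M : R[i]^o) = r^-1 ^+ M.
    rewrite rnormX invfM -expiN rnormM rnorm_expi mulr1 -fmorphV rnorm_real ger0_norm//.
    by rewrite invr_ge0 ltW.
  apply: (@le_trans _ _ (r^-1 ^+ M * (B * (K * rho ^+ M)))).
    rewrite ler_wpM2l ?exprn_ge0 ?invr_ge0 ?(ltW r0)//.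
    by apply: (le_trans (opnormM _ _)); apply: ler_pM; rewrite ?opnorm_ge0.
  rewrite (exprMn M rho) le_eqVlt; apply/orP; left; apply/eqP.
  by move: (r^-1 ^+ M) (rho ^+ M) => a b; ring.
have d' : opnorm (Q - S) <= B * K.
  by apply: (le_trans d); rewrite ler_piMr ?mulr_ge0 ?(ltW B0) ?(ltW K0)// exprn_ile1// ltW.
have hS : opnorm S <= B + B * K.
  have -> : S = Q - (Q - S) by rewrite opprB addrC subrK.
  by apply: (le_trans (opnorm_triangle _ _)); rewrite opnormN lerD ?hB.
have -> : Q ^+ 2 - S ^+ 2 = Q * (Q - S) + (Q - S) * S.
  by rewrite !expr2 mulrBr mulrBl addrA subrK.
apply: (le_trans (opnorm_triangle _ _)).
have -> : B * K * (B + (B + B * K)) * (rho / r) ^+ M =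
   B * (B * K * (rho / r) ^+ M) + (B * K * (rho / r) ^+ M) * (B + B * K).
  by move: (_ ^+ M) => a; ring.
by apply: lerD; apply: (le_trans (opnormM _ _)); apply: ler_pM; rewrite ?opnorm_ge0 ?hB.
Qed.

Lemma sum_diagonal (V : nmodType) n M (v : V) : (n < M)%N ->
  \sum_(i < M) \sum_(j < M) (if n == (i + j)%N then v else 0) = v *+ n.+1.
Proof.
move=> nM.
have E (i : 'I_M) : \sum_(j < M) (if n == (i + j)%N then v else 0) = if (i < n.+1)%N then v else 0.
  case: ltnP => hi; last first.
    apply: big1 => j _; case: eqP => // e; move: hi; rewrite e ltnNge leq_addr//.
  have jM : (n - i < M)%N by rewrite (leq_ltn_trans (leq_subr _ _)).
  rewrite (bigD1 (Ordinal jM))//= subnKC// eqxx big1 ?addr0// => j /eqP jne.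
  by case: eqP => // e; case: jne; apply: val_inj; rewrite /= e addKn.
under eq_bigr do rewrite E.
by rewrite -big_mkcond /= -(big_ord_widen M (fun _ => v) nM) sumr_const card_ord.
Qed.

Lemma neumann_square_integral (phi : dual X) x n M : (n < M)%N ->
  cintegrable circle (fun t => z t ^+ n.+2 * (phi ((neumann T (z t) M ^+ 2) x) : R[i])) /\
  cintegral circle (fun t => z t ^+ n.+2 * (phi ((neumann T (z t) M ^+ 2) x) : R[i])) =
  n.+1%:R * (phi ((T ^+ n) x) : R[i]).
Proof.
move=> nM.
pose a (i j : nat) : R[i] := (r ^+ n.+2 * r^-1 ^+ (i + j).+2)%:C * (phi ((T ^+ (i + j)) x) : R[i]).
pose F (i j : nat) (t : mR) : R[i] := expi (n.+2%:R * t) * expi (- (i + j).+2%:R * t).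
have FE t : z t ^+ n.+2 * (phi ((neumann T (z t) M ^+ 2) x) : R[i]) =
   \sum_(i < M) 1 * \sum_(j < M) a i j * F i j t.
  have -> : (neumann T (z t) M ^+ 2) x =
      \sum_(i < M) \sum_(j < M) ((z t)^-1 ^+ (i + j).+2) *: (T ^+ (i + j)) x.
    rewrite expr2 /neumann mulr_suml bop_sumE; apply: eq_bigr => i _.
    rewrite mulr_sumr bop_sumE; apply: eq_bigr => j _.
    rewrite bop_scaleAl bop_scaleAr -exprD scalerA -exprD addSn addnS.
    by [].
  rewrite linear_sum mulr_sumr; apply: eq_bigr => i _; rewrite mul1r.
  rewrite linear_sum mulr_sumr; apply: eq_bigr => j _; rewrite /= dualZ mulrA /a [RHS]mulrAC;
    congr (_ * _).
  rewrite /F /z exprMn invfM -expiN exprMn !expiX rmorphM /= !rmorphXn /= fmorphV.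
  by rewrite mulrACA mulrN -mulNr.
have Fi i j : cintegrable circle (F i j).
  apply: (@bounded_cintegrable_circle _ _ 1).
    by apply: cmeasurable_mul; exact: cmeasurable_expi.
  by move=> t; rewrite rnormM !rnorm_expi mulr1.
rewrite (_ : (fun t => _) = (fun t => \sum_(i < M) 1 * \sum_(j < M) a i j * F i j t));
  last exact/funext.
split; first by apply: cintegrable_sum => i; exact: cintegrable_sum.
rewrite cintegral_sum; last by move=> i; exact: cintegrable_sum.
transitivity (\sum_(i < M) \sum_(j < M) (if n == (i + j)%N then (phi ((T ^+ n) x) : R[i]) else 0)).
  apply: eq_bigr => i _; rewrite mul1r cintegral_sum//; apply: eq_bigr => j _.
  rewrite /F cintegral_expi_ortho !eqSS; case: eqP => [e|_]; last by rewrite mulr0.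
  by rewrite mulr1 /a -e -exprMn mulfV ?gt_eqF// expr1n mul1r.
by rewrite sum_diagonal// mulr_natl.
Qed.

Lemma power_integral (phi : dual X) x n :
  n.+1%:R * (phi ((T ^+ n) x) : R[i]) =
  cintegral circle (fun t => z t ^+ n.+2 * (phi ((cres r t ^+ 2) x) : R[i])).
Proof.
have [c [q [c0 q0 q1 hc]]] := neumann_square_approx.
have zm : cmeasurable (fun t : mR => z t ^+ n.+2).
  have -> : (fun t : mR => z t ^+ n.+2) = (fun t => (r ^+ n.+2)%:C * expi (n.+2%:R * t)).
    by apply/funext => t; rewrite /z exprMn expiX rmorphXn.
  by apply: cmeasurable_mul; [exact: cmeasurable_cst|exact: cmeasurable_expi].
have zn t : rnorm (z t ^+ n.+2 : R[i]^o) = r ^+ n.+2.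
  by rewrite rnormX rnormM rnorm_expi mulr1 rnorm_real ger0_norm// ltW.
have [B hB] := resolvent_square_bounded phi x.
have c1 : cintegrable circle (fun t => z t ^+ n.+2 * (phi ((cres r t ^+ 2) x) : R[i])).
  apply: (@bounded_cintegrable_circle _ _ (r ^+ n.+2 * B)).
    by apply: cmeasurable_mul => //; exact: resolvent_square_cmeasurable.
  by move=> t; rewrite rnormM zn ler_wpM2l// exprn_ge0// ltW.
set I := cintegral _ _.
pose K := 2 * (r ^+ n.+2 * (opnorm phi * (c * rnorm x))).
have rn0 : 0 <= r ^+ n.+2 by rewrite exprn_ge0// ltW.
have K0 : 0 <= K.
  by rewrite /K; repeat apply: mulr_ge0 => //; rewrite ?opnorm_ge0 ?rnorm_ge0.
apply: (@rconverges_unique _ _ (fun _ => n.+1%:R * (phi ((T ^+ n) x) : R[i]) : R[i]^o)).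
  by move=> e e0; exists 0%N => m _; rewrite subrr rnorm0 ltW.
move=> e e0; have [M0 hM] := geometric_small_scaled K0 q0 q1 e0.
exists (maxn M0 0) => m _; set M := maxn M0 n.+1.
have nM : (n < M)%N by rewrite leq_max leqnn orbT.
apply: le_trans (hM M (leq_maxl _ _)).
have [c2 <-] := neumann_square_integral phi x nM.
rewrite rnormB_sym /I.
set w := fun t => z t ^+ n.+2 * (phi ((cres r t ^+ 2) x) : R[i]) in c1 *.
set u := fun t => z t ^+ n.+2 * (phi ((neumann T (z t) M ^+ 2) x) : R[i]) in c2 *.
have -> : cintegral circle w - cintegral circle u = cintegral circle (fun t => (-1) * u t + w t).
  by rewrite cintegralZD// mulN1r addrC.
have -> : K * q ^+ M = 2 * Rintegral circle setT (fun=> r ^+ n.+2 * (opnorm phi * (c * q ^+ M *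
  rnorm x))).
  rewrite Rintegral_cst// circle_measureT mulr1 /K.
  by move: (r ^+ _) (q ^+ M) => a b; ring.
apply: rnorm_cintegral_le.
- exact: (cintegrable_measurable (cintegrableZD (-1) c2 c1)).
- by apply: (@circle_bounded_integrable _ _ `|r ^+ n.+2 * (opnorm phi * (c * q ^+ M * rnorm x))|).
move=> t; have -> : (-1) * u t + w t =
    z t ^+ n.+2 * (phi ((cres r t ^+ 2 - neumann T (z t) M ^+ 2) x) : R[i]).
  have -> : (cres r t ^+ 2 - neumann T (z t) M ^+ 2) x =
    (cres r t ^+ 2) x - (neumann T (z t) M ^+ 2) x by [].
  by rewrite dualB mulrBr mulN1r addrC.
rewrite rnormM zn ler_wpM2l//; apply: (le_trans (opnormP _ _)); rewrite ler_wpM2l ?opnorm_ge0//.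
by apply: (le_trans (opnormP _ _)); rewrite ler_wpM2r ?rnorm_ge0.
Qed.

End power_integral.

Lemma power_pairing_le (R : realType) (X : normedModType R[i]) (T : bop X X) (phi : dual X) x n
  (r : R) :
  spectrum_in_disc T -> r = 1 + n.+1%:R^-1 ->
  ((rnorm (phi ((T ^+ n)%R x) : R[i]^o))%:E <= (2 * expR 1 / (2 * pi))%:E *
    \int[lebesgue_measure]_(t in `[0%R, (2 * pi)%R[)
      (rnorm (phi (((r + 1) * (r - 1) ^+ 1)%:C *:
        bop_pow (resolvent (r%:C * expi t) T) 2 x) : R[i]^o))%:E)%E.
Proof.
move=> Tdisc rD; set m : R := n.+1%:R; set E : R := 2 * expR 1.
have m0 : 0 < m by [].
have r1 : 1 < r by rewrite rD ltrDl invr_gt0.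
have rE : r ^+ n.+2 <= E by rewrite rD; exact: succ_ratio_power_bound.
have E0 : 0 <= E by rewrite mulr_ge0// expR_ge0.
set c := (r + 1) * (r - 1) ^+ 1.
have cm : 1 <= m / 2 * c.
  have -> : m / 2 * c = 1 + (2 * m)^-1.
    by rewrite /c rD; field; rewrite gt_eqF.
  by rewrite lerDl invr_ge0 mulr_ge0// ltW.
have c0 : 0 <= c.
  rewrite /c expr1 mulr_ge0//; last by rewrite subr_ge0 ltW.
  by rewrite addr_ge0// ltW// (lt_trans ltr01).
pose v t := rnorm (phi ((cres T r t ^+ 2) x) : R[i]^o).
have UE t : rnorm (phi (c%:C *: bop_pow (resolvent (r%:C * expi t) T) 2 x) : R[i]^o) = c * v t.
  by rewrite linearZ rnorm_real_scale// bop_powE.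
under eq_integral do rewrite UE.
have mv : measurable_fun setT (v : measurableTypeR R -> measurableTypeR R).
  exact/cmeasurable_rnorm/resolvent_square_cmeasurable.
have v0 t : 0 <= v t by exact: rnorm_ge0.
have [B hB] := resolvent_square_bounded Tdisc r1 phi x.
have iU : (@circle_measure R).-integrable setT (EFin \o (fun t => c * v t)).
  apply: (@circle_bounded_integrable _ _ (c * B)).
    by apply: measurable_funM => //; exact: measurable_cst.
  by move=> t; rewrite ger0_norm; [apply: ler_wpM2l => //; exact: hB|exact: mulr_ge0].
have key : m * rnorm (phi ((T ^+ n)%R x) : R[i]^o) <=
    2 * Rintegral (@circle_measure R) setT (fun t => (E * (m / 2)) * (c * v t)).
  have -> : m * rnorm (phi ((T ^+ n)%R x) : R[i]^o) = rnorm (m%:C * (phi ((T ^+ n)%R x) : R[i])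
    : R[i]^o).
    by rewrite rnormM rnorm_real ger0_norm// ltW.
  rewrite /m rmorph_nat (power_integral Tdisc r1); apply: rnorm_cintegral_le.
  - apply: cmeasurable_mul; last exact: resolvent_square_cmeasurable.
    have -> : (fun t => (r%:C * expi t) ^+ n.+2) = (fun t : measurableTypeR R =>
      (r ^+ n.+2)%:C * expi (n.+2%:R * t)).
      by apply/funext => t; rewrite exprMn expiX rmorphXn.
    by apply: cmeasurable_mul; [exact: cmeasurable_cst|exact: cmeasurable_expi].
  - by have := integrableZl measurableT (E * (m / 2)) iU.
  - move=> t; rewrite rnormM rnormX rnormM rnorm_expi mulr1 rnorm_real ger0_norm; last first.
      by rewrite ltW// (lt_trans ltr01).
    rewrite -mulrA; apply: ler_pM => //; [|exact: rnorm_ge0|].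
      by rewrite exprn_ge0// ltW// (lt_trans ltr01).
    by rewrite mulrA; apply: ler_peMl => //; exact: v0.
have key2 : rnorm (phi ((T ^+ n)%R x) : R[i]^o) <= E * Rintegral (@circle_measure R) setT (fun t
  => c * v t).
  rewrite -(ler_pM2l m0); apply: (le_trans key); rewrite (RintegralZl _ measurableT iU).
  by rewrite le_eqVlt; apply/orP; left; apply/eqP; field.
apply: (@le_trans _ _ (E%:E * (\int[@circle_measure R]_t (c * v t)%:E))%E).
  have fU : (\int[@circle_measure R]_t (c * v t)%:E)%E \is a fin_num by exact: integrable_fin_num.
  by rewrite -(fineK fU) -EFinM lee_fin.
rewrite ge0_integral_circle; last 2 first.
- by apply/measurable_EFinP; apply: measurable_funM => //; exact: measurable_cst.
- by move=> t; rewrite lee_fin mulr_ge0.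
by rewrite muleA -EFinM.
Qed.

Theorem GFS_power_gamma_bounded d (Sigma : measurableType d) (R : realType)
  (P : probability Sigma R) (gam : nat -> Sigma -> R[i]) (X : completeNormedModType R[i])
  (T : bop X X) : gaussian_sequence P gam ->
  gamma_GFS P gam 1 T -> power_gamma_bounded P gam T.
Proof.
move=> gamG [Tdisc [C C0 hC]].
have [k0 k00 single] := gauss_norm_single gamG.
set K : R := 2 * expR 1 / (2 * pi).
have K0 : 0 <= K by rewrite divr_ge0 ?mulr_ge0 ?expR_ge0 ?pi_ge0.
exists (K * C); first by rewrite mulr_ge0// ltW.
move=> N U x hU.
have /choice[n hn] : forall k, exists n, bop_pow T n = U k.
  by move=> k; have [n _ <-] := hU k; exists n.
have [phi phi1 ->] := gauss_norming gamG (fun k => U k (x k)).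
pose r k : R := 1 + (n k).+1%:R^-1.
have r1 k : 1 < r k by rewrite /r ltrDl invr_gt0.
apply: (@le_trans _ _ (\sum_(k < N.+1) (rnorm (phi k (U k (x k)) : R[i]^o))%:E)%E).
  by rewrite sumEFin lee_fin rnorm_sum.
apply: (@le_trans _ _ (\sum_(k < N.+1) K%:E * \int[lebesgue_measure]_(t in `[0%R, (2 * pi)%R[)
      (rnorm (phi k (((r k + 1) * (r k - 1) ^+ 1)%:C *:
        bop_pow (resolvent ((r k)%:C * expi t) T) 2 (x k)) : R[i]^o))%:E)%E).
  by apply: lee_sum => k _; rewrite -hn bop_powE; exact: power_pairing_le.
rewrite -ge0_sume_distrr; last first.
  by move=> k _; apply: integral_ge0 => t _; rewrite lee_fin rnorm_ge0.
rewrite (EFinM K C) -muleA; apply: lee_wpmul2l => //.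
apply: (le_trans (hC N r x phi r1)); apply: lee_wpmul2l; first by rewrite lee_fin ltW.
by rewrite -[leRHS]mule1; apply: lee_wpmul2l; [exact: gauss_norm_ge0|].
Qed.

Theorem theorem4p18 (R : realType)
  (d : measure_display) (Sigma : measurableType d) (P : probability Sigma R)
  (gam : nat -> Sigma -> R[i]) (gamG : gaussian_sequence P gam)
  (X : completeNormedModType R[i]) (T : bop X X) :
  (power_gamma_bounded P gam T <-> resolvent_square_functions P gam T) /\
  (resolvent_square_functions P gam T <-> gamma_GFS_operator P gam T).
Proof.
have h1 := @power_gamma_bounded_square_functions _ _ _ _ _ _ T gamG.
have h2 := @square_functions_GFS _ _ _ _ _ _ T gamG.
have h3 := @GFS_power_gamma_bounded _ _ _ _ _ _ T gamG.
by split; split => // h; [exact/h3/h2|exact/h1/h3].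
Qed.
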